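(* Let $\xi(t)=\sum_{p\ge 1}\beta_p^2t^p$ with real coefficients $\beta_p$ and $\xi(1+\epsilon)<\infty$ for some $\epsilon>0$, and let $\mu$ be a Borel probability measure on $[0,1]$. Then the Parisi PDE \[ \begin{cases} \partial_t u+\frac{\xi''(t)}{2}\left(\partial_{xx}u+\mu[0,t]\,(\partial_xu)^2\right)=0, & (t,x)\in(0,1)\times\mathbb{R},\\ u(1,x)=\log\cosh(x), & x\in\mathbb{R}, \end{cases} \] admits a unique weak solution $u:[0,1]\times\mathbb{R}\to\mathbb{R}$. This solution is continuous, is differentiable in time at every $t\in(0,1)$ which is a continuity point of $\mu$ (i.e. of $t\mapsto\mu[0,t]$), and is smooth in the space variable $x$.
   Context: Weak solution: a continuous function $u:[0,1]\times\mathbb{R}\to\mathbb{R}$ with essentially bounded weak derivative $\partial_x u$ is called a weak solution of the Parisi PDE if \[ 0=\int_0^1\int_{\mathbb{R}}-u\,\partial_t\phi+\frac{\xi''(t)}{2}\left(u\,\partial_{xx}\phi+\mu[0,t](\partial_xu)^2\phi\right)dx\,dt+\int_{\mathbb{R}}\phi(1,x)\log\cosh x\,dx \] for every $\phi\in C_c^\infty((0,1]\times\mathbb{R})$. Here $\mu[0,t]$ denotes the $\mu$-measure of the interval $[0,t]$. *)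

(* Defs.v *)
From mathcomp Require Import all_boot all_order all_algebra.
From mathcomp Require Import all_classical all_reals all_analysis.

Set Implicit Arguments.
Unset Strict Implicit.
Unset Printing Implicit Defensive.

Import Order.TTheory GRing.Theory Num.Theory.
Import numFieldNormedType.Exports.

Local Open Scope classical_set_scope.
Local Open Scope ring_scope.

Section parisi.
Context {R : realType}.
Implicit Types (u v phi : R -> R -> R).

Definition log_cosh (x : R) : R := ln ((expR x + expR (- x)) / 2).

(* A real limit: meaningful where the series converges. *)
Definition xi (beta : nat -> R) (t : R) : R :=
  limn (fun n => \sum_(1 <= p < n) beta p ^+ 2 * t ^+ p).

Definition strip : set (R * R) := `[0, 1] `*` setT.

Definition partial_t phi : R -> R -> R := fun t x => derive1 (phi^~ x) t.

Definition partial_x phi : R -> R -> R := fun t x => derive1 (phi t) x.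

Fixpoint class_C (n : nat) phi : Prop :=
  continuous (fun z : R * R => phi z.1 z.2) /\
  (if n is m.+1 then
     [/\ forall t x, derivable (phi^~ x) t 1,
         forall t x, derivable (phi t) x 1,
         class_C m (partial_t phi) & class_C m (partial_x phi)]
   else True).

Definition smooth2 phi : Prop := forall n, class_C n phi.

Definition smooth1 (f : R -> R) : Prop := forall n x, derivable (derive1n n f) x 1.

(* C_c^oo(D).  Test functions are represented by smooth functions on the plane;
   only their restriction to D is constrained to have compact support in D, and
   only that restriction is ever used, up to null sets.  For D = (0, 1] x R this
   is smoothness up to the boundary t = 1, where phi need not vanish. *)
Definition test_function (D : set (R * R)) phi : Prop :=
  let K := closure [set z | D z /\ phi z.1 z.2 != 0] in
  [/\ smooth2 phi, compact K & K `<=` D].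

Notation leb := (@lebesgue_measure R).

Definition weak_partial_x u v : Prop :=
  forall phi, test_function (`]0, 1[ `*` setT) phi ->
    \int[leb]_(t in `[0, 1]) (\int[leb]_x (u t x * partial_x phi t x)) =
    - \int[leb]_(t in `[0, 1]) (\int[leb]_x (v t x * phi t x)).

Definition ess_bounded v : Prop :=
  measurable_fun strip
    (fun z : measurableTypeR R * measurableTypeR R => v z.1 z.2) /\
  exists M : R, {ae (leb \x leb)%E, forall z, strip z -> `|v z.1 z.2| <= M}.

Definition cdf01 (mu : probability (measurableTypeR R) R) (t : R) : R :=
  fine (mu `[0, t]%classic).

(* The weak derivative v is determined by u only almost everywhere, which is
   all that the integrals see. *)
Definition parisi_weak_solution (beta : nat -> R)
    (mu : probability (measurableTypeR R) R) u : Prop :=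
  {within strip, continuous (fun z : R * R => u z.1 z.2)} /\
  exists v, [/\ weak_partial_x u v, ess_bounded v &
    forall phi, test_function (`]0, 1] `*` setT) phi ->
      0 = \int[leb]_(t in `[0, 1]) (\int[leb]_x
            (- u t x * partial_t phi t x +
             derive1n 2 (xi beta) t / 2 *
               (u t x * partial_x (partial_x phi) t x +
                cdf01 mu t * v t x ^+ 2 * phi t x)))
          + \int[leb]_x (phi 1 x * log_cosh x)].

End parisi.

(* Main.v *)
Require Import Defs.
From mathcomp Require Import all_boot all_order all_algebra.
From mathcomp Require Import all_classical all_reals all_analysis measurable_realfun.
From mathcomp Require Import ring lra zify.
Set Implicit Arguments.
Unset Strict Implicit.
Unset Printing Implicit Defensive.

Import Order.TTheory GRing.Theory Num.Theory.
Import numFieldNormedType.Exports.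
Local Open Scope classical_set_scope.
Local Open Scope ring_scope.

(** Existence.  In the clock xi', the explicit step
      f |-> (f(x+h) + f(x-h))/2 + a/8 (f(x+h) - f(x-h))^2,   a = mu[0,t],
    with h^2 the increment of xi', is consistent with the equation up to O(h^4),
    is a sup-norm contraction on 1-Lipschitz functions, and preserves
    |f'| <= 1, f'' >= 0, f'' + 2 f'^2 <= 2; the higher derivatives then stay bounded
    as well.  Iterating from log cosh along dyadic times gives a Cauchy sequence, whose
    limit u is smooth in x and satisfies
      u(s) - u(t) = (xi'(t) - xi'(s))/2 (u_xx + mu[0,t] u_x^2)(t)
                    + O(|t-s| (|t-s| + mu(s,t])).
    This yields the time derivative at continuity points of mu and, by telescoping,
    the integrated equation.

    Uniqueness.  Testing a weak solution y, with weak derivative v, against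
    theta(t) eta_eps(x - z) shows that the mollification y_eps solves the equation up
    to the residual (v^2)_eps - (v_eps)^2, which vanishes as eps -> 0 by Lebesgue's
    differentiation theorem.  Moreover y is Lipschitz in x and y - u is bounded, so that
    the integral of (y_eps - u)^2 / (1 + x^2) over [-N, N] satisfies a Gronwall
    inequality with boundary terms O(1/N^2). *)

(** Two degeneracies shape the existence proof: [xi''] may vanish, and [mu[0,t]] may jump, so that
    the solution need not be differentiable in time. In the clock [xi'] a step simply has length
    zero where the diffusion vanishes, and nothing is divided by [xi'']. Freezing [mu[0,t]] on a
    time cell costs the cell length times the increment of [mu[0,t]] there; by monotonicity these
    increments add up to at most 1, so the total error is of the order of the mesh without any
    continuity of [mu[0,t]]. The factor a/8 arises because (f(x+h) - f(x-h))^2 is close to 4 h^2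
    f'^2, while a h^2 f'^2 / 2 is wanted. For uniqueness, the difference of squares turns the
    equation for d = y_eps - u into a linear one with bounded drift y_eps_x + u_x, and the
    dissipation d_x^2 absorbs this drift. As d is bounded but not integrable, a decaying weight q is
    required; 1/(1 + x^2) satisfies |q'| <= q, so differentiating it costs no more than the energy
    itself. *)

(** * Derivatives and Taylor estimates in one variable *)

Section calculus.
Context {R : realType}.
Implicit Types (f g : R -> R) (a b c h x K M : R).

Lemma is_derive_ext f g x a b :
  is_derive x 1 f a -> f = g -> a = b -> is_derive x 1 g b.
Proof. by move=> + <- <-. Qed.

Lemma der_cst c x : is_derive x 1 (fun=> c : R) 0.
Proof. exact: is_derive_cst. Qed.

Lemma der_id x : is_derive x 1 (fun y : R => y) 1.
Proof. exact: is_derive_id. Qed.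

Lemma derD f g x a b : is_derive x 1 f a -> is_derive x 1 g b ->
  is_derive x 1 (fun y => f y + g y) (a + b).
Proof. exact: is_deriveD. Qed.

Lemma derB f g x a b : is_derive x 1 f a -> is_derive x 1 g b ->
  is_derive x 1 (fun y => f y - g y) (a - b).
Proof. exact: is_deriveB. Qed.

Lemma derN f x a : is_derive x 1 f a -> is_derive x 1 (fun y => - f y) (- a).
Proof. exact: is_deriveN. Qed.

Lemma derM f g x a b : is_derive x 1 f a -> is_derive x 1 g b ->
  is_derive x 1 (fun y => f y * g y) (a * g x + f x * b).
Proof.
move=> fa gb; apply: is_derive_ext (is_deriveM fa gb) _ _ => //.
by rewrite addrC -[g x *: a]/(g x * a) (mulrC (g x)).
Qed.

Lemma derZ c f x a : is_derive x 1 f a ->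
  is_derive x 1 (fun y => c * f y) (c * a).
Proof. by move=> fa; exact: (is_deriveZ c fa). Qed.

Lemma der_comp f g x a b : is_derive (g x) 1 f a -> is_derive x 1 g b ->
  is_derive x 1 (fun y => f (g y)) (a * b).
Proof. exact: is_derive1_comp. Qed.

Lemma der_sum n (F : 'I_n -> R -> R) (d : 'I_n -> R) x :
  (forall i, is_derive x 1 (F i) (d i)) ->
  is_derive x 1 (fun y => \sum_(i < n) F i y) (\sum_(i < n) d i).
Proof.
move=> H; apply: is_derive_ext (is_derive_sum H) _ _ => //.
by apply/funext => y; rewrite fct_sumE.
Qed.

Lemma der_shift f h x a : is_derive (x + h) 1 f a ->
  is_derive x 1 (fun y => f (y + h)) a.
Proof.
move=> fa; apply: is_derive_ext (der_comp (g := fun y => y + h) fa (derD (der_id x) (der_cst h x))) _ _ => //.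
by rewrite addr0 mulr1.
Qed.

(** The way limits and parametrized integrals are differentiated below: an expansion with a
    quadratic error, uniform in the parameter, survives a limit or an integration, and no theorem on
    exchanging derivatives is called for. *)
Lemma der_quadratic f x d M :
  (forall h, `|h| <= 1 -> `|f (x + h) - f x - h * d| <= M * h ^+ 2) ->
  is_derive x 1 f d.
Proof.
move=> H.
have M0 : 0 <= M.
  have := H 1; rewrite normr1 lexx expr1n mulr1 => /(_ isT); exact: le_trans.
have D : h^-1 *: (f (h *: 1 + x) - f x) @[h --> (0 : R)^'] --> d.
  have M1 : 0 < M + 1 by rewrite ltr_wpDl.
  apply/cvgrPdist_le => e e0; near=> h.
  have h0 : h != 0 by near: h; exact: nbhs_dnbhs_neq.
  have hn0 : 0 < `|h| by rewrite normr_gt0.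
  have he : `|h| <= e / (M + 1) by near: h; apply: dnbhs0_le; exact: divr_gt0.
  have h1 : `|h| <= 1 by near: h; exact: dnbhs0_le.
  rewrite -[h *: 1]/(h * 1) mulr1 (addrC h x) distrC -[_ *: _]/(_ * _).
  have -> : h^-1 * (f (x + h) - f x) - d = h^-1 * (f (x + h) - f x - h * d) by field.
  rewrite normrM normfV ler_pdivrMl// (le_trans (H h h1))//.
  have -> : h ^+ 2 = `|h| * `|h| by rewrite -normrM -expr2 ger0_norm// sqr_ge0.
  rewrite mulrCA ler_wpM2l// mulrC; apply: le_trans (_ : _ <= `|h| * (M + 1)) _.
    by rewrite ler_wpM2l// lerDl.
  by rewrite -ler_pdivlMr.
have dD : derivable f x 1 by apply/cvg_ex; exists d.
by split => //; exact: cvg_lim D.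
Unshelve. all: by end_near. Qed.

Lemma MVT_is_derive f f' a b : a <= b ->
  (forall x, a <= x <= b -> is_derive x 1 f (f' x)) ->
  exists2 c, a <= c <= b & f b - f a = f' c * (b - a).
Proof.
move=> ab df; have [||c cab ->] := @MVT_segment R f f' a b ab.
- by move=> x; rewrite in_itv/= => /andP[ax xb]; apply: df; rewrite !ltW.
- apply: derivable_within_continuous => x; rewrite in_itv/= => xab.
  by have [] := df x xab.
- by exists c => //; move: cab; rewrite in_itv.
Qed.

Lemma lipschitz_is_derive f f' M a b :
  (forall x, is_derive x 1 f (f' x)) -> (forall x, `|f' x| <= M) ->
  `|f b - f a| <= M * `|b - a|.
Proof.
move=> df fM; wlog ab : a b / a <= b.
  move=> H; have [/H//|/ltW/H] := leP a b.
  by rewrite distrC (distrC b).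
have [c _ ->] := MVT_is_derive ab (fun x _ => df x).
by rewrite normrM ler_wpM2r.
Qed.

(** A mean value argument in place of integration: the factor 1/(n+1) is given up, which only
    affects constants. *)
Lemma growth_is_derive (n : nat) f f' K h : 0 <= h ->
  (forall x, is_derive x 1 f (f' x)) -> f 0 = 0 -> 0 <= K ->
  (forall x, 0 <= x <= h -> `|f' x| <= K * x ^+ n) -> `|f h| <= K * h ^+ n.+1.
Proof.
move=> h0 df f0 K0 fK.
have [c /andP[c0 ch]] := MVT_is_derive h0 (fun x _ => df x).
rewrite f0 !subr0 => ->; rewrite normrM (ger0_norm h0) exprSr mulrA.
apply: ler_wpM2r => //; apply: le_trans (fK c _) _; first by rewrite c0.
by apply: ler_wpM2l => //; apply: lerXn2r; rewrite ?nnegrE.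
Qed.

Lemma taylor1 f f' f'' M a h :
  (forall x, is_derive x 1 f (f' x)) -> (forall x, is_derive x 1 f' (f'' x)) ->
  (forall x, `|f'' x| <= M) ->
  `|f (a + h) - f a - h * f' a| <= M * h ^+ 2.
Proof.
move=> df df' fM.
have M0 : 0 <= M by exact: le_trans (fM 0).
(* Negative increments are reduced to positive ones by reflecting [f] through the origin. *)
wlog h0 : f f' f'' a h df df' fM / 0 <= h.
  move=> H; have [/H|/ltW h0] := leP 0 h; first by apply; eassumption.
  have := H (fun x => f (- x)) (fun x => - f' (- x)) (fun x => f'' (- x)) (- a) (- h).
  rewrite -opprD !opprK mulrNN sqrrN; apply.
  - move=> x; apply: is_derive_ext (der_comp (g := fun y => - y) (df (- x)) (derN (der_id x))) _ _ => //.
    by rewrite mulrN1.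
  - move=> x; apply: is_derive_ext (derN (der_comp (g := fun y => - y) (df' (- x)) (derN (der_id x)))) _ _ => //.
    by rewrite mulrN1 opprK.
  - by move=> x; exact: fM.
  - by rewrite oppr_ge0.
pose r y := f (a + y) - f a - y * f' a.
pose r' y := f' (a + y) - f' a.
have dr (y : R) : is_derive y 1 r (r' y).
  have dfa : is_derive y 1 (fun y => f (a + y)) (f' (a + y)).
    by rewrite addrC; under eq_fun do rewrite addrC; apply: der_shift.
  apply: is_derive_ext
    (derB (derB dfa (der_cst (f a) y)) (derM (der_id y) (der_cst (f' a) y))) _ _ => //.
  by rewrite /r'; ring.
have -> : f (a + h) - f a - h * f' a = r h by [].
apply: (growth_is_derive (n := 1) h0 dr) => //.
  by rewrite /r addr0 mul0r subr0 subrr.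
move=> y /andP[y0 _]; rewrite /r' expr1.
by have := lipschitz_is_derive a (a + y) df' fM; rewrite addrAC subrr add0r (ger0_norm y0).
Qed.

End calculus.

(** * The explicit scheme *)

Section jets.
Context {R : realType}.
Implicit Types (J : nat -> R -> R) (a b c h x K M T : R).

(** A smooth function stored with all its derivatives. Constructions act on the whole family, so
    smoothness is carried along instead of being recovered afterwards. *)
Definition jet J := forall k x, is_derive x 1 (J k) (J k.+1 x).

Definition leibniz (A B : nat -> R -> R) k x : R :=
  \sum_(i < k.+1) 'C(k, i)%:R * (A i x * B (k - i)%N x).

Lemma jet_leibniz A B : jet A -> jet B -> jet (leibniz A B).
Proof.
move=> jA jB k x.
have H (i : 'I_k.+1) := derZ 'C(k, i)%:R (derM (jA i x) (jB (k - i)%N x)).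
apply: is_derive_ext (der_sum H) _ _ => //.
(* Pascal's rule splits the sum of order [k.+1] into the two sums that come from differentiating
   either factor. *)
rewrite /leibniz [RHS]big_ord_recl /= bin0 mul1r subn0.
under [in RHS]eq_bigr do rewrite /bump /= add1n binS natrD mulrDl subSS.
rewrite big_split /=.
under eq_bigr do rewrite mulrDr.
rewrite big_split /= [RHS]addrA [RHS]addrC; congr (_ + _).
rewrite big_ord_recl /= bin0 mul1r subn0; congr (_ + _).
rewrite [RHS]big_ord_recr /= bin_small ?ltnSn// mul0r addr0.
apply: eq_bigr => i _; rewrite /bump /= add1n.
by rewrite subnSK// ltn_ord.
Qed.

Definition dj h J k x := J k (x + h) - J k (x - h).

Lemma jet_dj h J : jet J -> jet (dj h J).
Proof. by move=> jJ k x; apply: derB; apply: der_shift; exact: jJ. Qed.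

(* An explicit backward step for [u_xx + a * u_x ^+ 2], of length [h ^+ 2] in the
   clock [xi']; by [step1E] it averages [J 1] with weights in [0, 1]. *)
Definition step a h J k x : R :=
  (J k (x + h) + J k (x - h)) / 2 + a / 8 * leibniz (dj h J) (dj h J) k x.

Lemma jet_step a h J : jet J -> jet (step a h J).
Proof.
move=> jJ k x.
apply: is_derive_ext (derD
  (derZ 2^-1 (derD (der_shift (jJ k (x + h))) (der_shift (jJ k (x - h)))))
  (derZ (a / 8) (jet_leibniz (jet_dj h jJ) (jet_dj h jJ) k x))) _ _.
- by apply/funext => y; rewrite /step mulrC.
- by rewrite /step mulrC.
Qed.

Lemma step0E a h J x : step a h J 0 x =
  (J 0%N (x + h) + J 0%N (x - h)) / 2 + a / 8 * (J 0%N (x + h) - J 0%N (x - h)) ^+ 2.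
Proof. by rewrite /step /leibniz big_ord_recl big_ord0 /= bin0 mul1r addr0 expr2. Qed.

Lemma step1E a h J x (p := 2^-1 + a / 4 * dj h J 0 x) (q := 2^-1 - a / 4 * dj h J 0 x) :
  step a h J 1 x = p * J 1%N (x + h) + q * J 1%N (x - h).
Proof.
rewrite /step /leibniz !big_ord_recl big_ord0 /= bin0 bin1 /p /q /dj /=.
by field.
Qed.

(** Differentiating the weights of [step1E] leaves a nonnegative square: it preserves convexity but
    threatens the upper bound on [J 2]. *)
Lemma step2E a h J x (p := 2^-1 + a / 4 * dj h J 0 x) (q := 2^-1 - a / 4 * dj h J 0 x) :
  step a h J 2 x = p * J 2%N (x + h) + q * J 2%N (x - h)
    + a / 4 * (J 1%N (x + h) - J 1%N (x - h)) ^+ 2.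
Proof.
rewrite /step /leibniz !big_ord_recl big_ord0 /= bin0 bin1 binn /p /q /dj /=.
by field.
Qed.

(* Bernstein's trick: averaging [J 1] decreases its square, which pays for the
   quadratic term in [step2E]. *)
Definition inv_jet J := [/\ jet J, forall x, `|J 1%N x| <= 1,
  forall x, 0 <= J 2 x & forall x, J 2 x + 2 * J 1%N x ^+ 2 <= 2].

Lemma dj_le h J k x M : jet J -> 0 <= h -> (forall x, `|J k.+1 x| <= M) ->
  `|dj h J k x| <= 2 * h * M.
Proof.
move=> jJ h0 JM; apply: le_trans (lipschitz_is_derive _ _ (jJ k) JM) _.
have -> : x + h - (x - h) = 2 * h by ring.
by rewrite ger0_norm ?mulr_ge0// mulrC.
Qed.

Lemma inv_step a h J : 0 <= a <= 1 -> 0 <= h -> h ^+ 2 <= 2^-1 -> inv_jet J ->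
  inv_jet (step a h J).
Proof.
move=> /andP[a0 a1] h0 h2 [jJ J1 J2 J21].
have h1 : h <= 1 by nra.
(* With [p = 1/2 + d] one has [4 p (1 - p) = 1 - 4 d^2], and [|d| <= h/2] because the difference of
   [J 0] is at most [2 h]. *)
have H x : exists p, [/\ 0 <= p, p <= 1, 4 * (p * (1 - p)) >= 1 - h ^+ 2,
    step a h J 1 x = p * J 1%N (x + h) + (1 - p) * J 1%N (x - h) &
    step a h J 2 x = p * J 2 (x + h) + (1 - p) * J 2 (x - h)
      + a / 4 * (J 1%N (x + h) - J 1%N (x - h)) ^+ 2].
  have dJ := dj_le x jJ h0 J1; rewrite mulr1 in dJ.
  have {dJ}d2 : `|a / 4 * dj h J 0 x| <= h / 2.
    rewrite normrM ger0_norm ?divr_ge0//.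
    apply: le_trans (ler_wpM2l _ dJ) _; first by rewrite divr_ge0.
    nra.
  set d := a / 4 * dj h J 0 x in d2.
  exists (2^-1 + d); have := d2; rewrite ler_norml => /andP[d3 d4].
  have d5 : d ^+ 2 <= h ^+ 2 / 4 by nra.
  split; [lra|lra|nra| |].
  - by rewrite step1E -/d; congr (_ + _ * _); lra.
  - by rewrite step2E -/d; congr (_ + _ * _ + _); lra.
split.
- exact: jet_step.
- move=> x; have [p [p0 p1 _ -> _]] := H x.
  have := J1 (x + h); have := J1 (x - h); rewrite !ler_norml.
  by move=> /andP[? ?] /andP[? ?]; apply/andP; split; nra.
- move=> x; have [p [p0 p1 _ _ ->]] := H x.
  by apply: addr_ge0; first apply: addr_ge0; apply: mulr_ge0;
    rewrite ?subr_ge0 ?sqr_ge0 ?divr_ge0.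
- move=> x; have [p [p0 p1 pq -> ->]] := H x.
  have := J21 (x + h); have := J21 (x - h).
  set v := J 1%N (x - h); set v' := J 1%N (x + h); set z := J 2 (x - h); set z' := J 2 (x + h) => Hz Hz'.
  (* The variance identity: averaging lowers the square by [p (1 - p) (v' - v)^2]. Since
     [h^2 <= 1/2] gives [p (1 - p) >= 1/8], twice this gain covers the term [a/4 (v' - v)^2]. *)
  have e1 : (p * v' + (1 - p) * v) ^+ 2 =
     p * v' ^+ 2 + (1 - p) * v ^+ 2 - (p * (1 - p)) * (v' - v) ^+ 2 by ring.
  have s0 : 0 <= (v' - v) ^+ 2 by exact: sqr_ge0.
  have e2 : a / 4 * (v' - v) ^+ 2 <= 2 * (p * (1 - p)) * (v' - v) ^+ 2.
    by apply: ler_wpM2r => //; nra.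
  rewrite e1; nra.
Qed.

End jets.

(** * Bounds on all derivatives, uniform in the number of steps *)

Section evolution.
Context {R : realType}.
Implicit Types (J : nat -> R -> R) (a b c h x K M T : R) (A : set R).

Lemma sum_bin_natr k : \sum_(i < k.+1) 'C(k, i)%:R = 2 ^+ k :> R.
Proof.
rewrite -[2]/(1 + 1) exprDn; apply: eq_bigr => i _.
by rewrite !expr1n mulr1.
Qed.

Lemma leibniz_le (A B : nat -> R -> R) k c x :
  (forall i, (i <= k)%N -> `|A i x * B (k - i)%N x| <= c) ->
  `|leibniz A B k x| <= 2 ^+ k * c.
Proof.
move=> H; rewrite /leibniz -sum_bin_natr mulr_suml.
apply: le_trans (ler_norm_sum _ _ _) _; apply: ler_sum => i _.
by rewrite normrM ger0_norm ?ler_wpM2l// H// -ltnS.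
Qed.

(** The two extreme terms contain the derivative of top order and are kept apart: in [step_bound]
    they merge into the averaging weights, and only the middle terms cause growth. *)
Lemma leibniz_mid (A B : nat -> R -> R) k c x : 0 <= c ->
  (forall i, (0 < i < k.+1)%N -> `|A i x * B (k.+1 - i)%N x| <= c) ->
  `|leibniz A B k.+1 x - (A 0%N x * B k.+1 x + A k.+1 x * B 0%N x)| <= 2 ^+ k.+1 * c.
Proof.
move=> c0 H; rewrite /leibniz big_ord_recr big_ord_recl /= bin0 binn !mul1r subnn subn0.
have cancel (p S q : R) : p + S + q - (p + q) = S by ring.
rewrite cancel.
rewrite -sum_bin_natr big_ord_recr big_ord_recl /= mulrDl mulrDl mulr_suml.
apply: le_trans (ler_norm_sum _ _ _) _.
rewrite -addrA addrCA; apply: ler_wpDr; first by rewrite addr_ge0 ?mulr_ge0.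
apply: ler_sum => i _; rewrite /bump /= add1n.
rewrite normrM ger0_norm//; apply: ler_wpM2l => //; apply: H.
by rewrite /= ltnS ltn_ord.
Qed.

Definition bounded_upto J k M :=
  forall j, (0 < j <= k)%N -> forall x, `|J j x| <= M.

(** Each middle term is a product of two differences of size O(h), of which at most one involves the
    top derivative, so the growth is linear in [B]. This starts at order 3: at order 2 both factors
    would involve the top derivative, and [inv_jet] provides the bound instead. *)
Lemma step_bound a h J k N B : 0 <= a <= 1 -> 0 <= h -> h ^+ 2 <= 2^-1 ->
  jet J -> (forall x, `|J 1%N x| <= 1) -> 1 <= N -> 0 <= B ->
  bounded_upto J k.+2 N -> (forall x, `|J k.+3 x| <= B) ->
  forall x, `|step a h J k.+3 x| + 1 <= (B + 1) * (1 + 2 ^+ k.+3 * N ^+ 2 * h ^+ 2).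
Proof.
move=> /andP[a0 a1] h0 h2 jJ J1 N1 B0 JN JB x.
have h1 : h <= 1 by nra.
pose c := (2 * h * N) * (2 * h * (N + B)).
have dN j : (j <= k.+1)%N -> `|dj h J j x| <= 2 * h * N.
  by move=> jk; apply: dj_le => // y; apply: JN; rewrite ltnS.
have dNB j : (j <= k.+2)%N -> `|dj h J j x| <= 2 * h * (N + B).
  move=> jk; apply: dj_le => // y; have [jk'|jk'] := leqP j k.+1.
    by apply: le_trans (JN j.+1 _ y) _; [rewrite ltnS|rewrite lerDl].
  have -> : j = k.+2 by apply/eqP; rewrite eqn_leq jk.
  by apply: le_trans (JB y) _; rewrite lerDr (le_trans _ N1).
have := @leibniz_mid (dj h J) (dj h J) k.+2 c x.
have c0 : 0 <= c by rewrite /c !mulr_ge0// ?addr_ge0// (le_trans _ N1).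
move=> /(_ c0) H.
have {}H := H _.
have {}H : `|leibniz (dj h J) (dj h J) k.+3 x - (dj h J 0 x * dj h J k.+3 x + dj h J k.+3 x * dj h J 0 x)| <= 2 ^+ k.+3 * c.
  apply: H => i /andP[i0 ik]; rewrite normrM /c.
  have [ik1|ik1] := leqP i k.+1.
    apply: ler_pM => //; first exact: dN.
    by apply: dNB; lia.
  rewrite mulrC; apply: ler_pM => //; last exact: dNB.
  by apply: dN; lia.
set L := leibniz _ _ _ _ in H.
have dJ := dj_le x jJ h0 J1; rewrite mulr1 in dJ.
have {dJ}d2 : `|a / 4 * dj h J 0 x| <= h / 2.
  rewrite normrM ger0_norm ?divr_ge0//.
  apply: le_trans (ler_wpM2l _ dJ) _; first by rewrite divr_ge0.
  nra.
set d := a / 4 * dj h J 0 x in d2.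
have [d3 d4] : - (h / 2) <= d /\ d <= h / 2 by move: d2; rewrite ler_norml => /andP.
have e : step a h J k.+3 x = (2^-1 + d) * J k.+3 (x + h) + (2^-1 - d) * J k.+3 (x - h)
    + a / 8 * (L - (dj h J 0 x * dj h J k.+3 x + dj h J k.+3 x * dj h J 0 x)).
  by rewrite /step -/L /d -[dj h J k.+3 x]/(J k.+3 (x + h) - J k.+3 (x - h)); field.
have E1 : `|(2^-1 + d) * J k.+3 (x + h) + (2^-1 - d) * J k.+3 (x - h)| <= B.
  have := JB (x + h); have := JB (x - h); rewrite !ler_norml.
  by move=> /andP[? ?] /andP[? ?]; apply/andP; split; nra.
have E2 : `|a / 8 * (L - (dj h J 0 x * dj h J k.+3 x + dj h J k.+3 x * dj h J 0 x))| <= 8^-1 * (2 ^+ k.+3 * c).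
  rewrite normrM ger0_norm ?divr_ge0//; apply: ler_pM => //; first by rewrite divr_ge0.
  by rewrite ler_pdivrMr// mulVf.
have E3 : `|step a h J k.+3 x| <= B + 8^-1 * (2 ^+ k.+3 * c).
  by rewrite e; apply: le_trans (ler_normD _ _) _; exact: lerD.
have p0 : 0 <= 2 ^+ k.+3 :> R by rewrite exprn_ge0.
have c1 : 8^-1 * c <= (B + 1) * (N ^+ 2 * h ^+ 2).
  have -> : 8^-1 * c = 2^-1 * (N * (N + B)) * h ^+ 2 by rewrite /c; field.
  rewrite [leRHS]mulrA; apply: ler_wpM2r; first exact: sqr_ge0.
  have NB0 : 0 <= N * B by rewrite mulr_ge0// (le_trans _ N1).
  have : N * B <= N ^+ 2 * B by rewrite expr2 -mulrA ler_peMl.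
  by have := sqr_ge0 N; lra.
have := ler_wpM2l p0 c1; rewrite mulrCA; lra.
Qed.

(* [steps A J T J']: [J'] is obtained from [J] by steps with coefficients in [A]
   and total squared length [T]. *)
Inductive steps A J : R -> (nat -> R -> R) -> Prop :=
| steps0 : steps A J 0 J
| stepsS T J' a h of steps A J T J' & A a & 0 <= h & h ^+ 2 <= 2^-1 :
    steps A J (T + h ^+ 2) (step a h J').

Lemma steps_ge0 A J T J' : steps A J T J' -> 0 <= T.
Proof. by elim=> // {}T _ a h _ T0 _ _ _; rewrite addr_ge0 ?sqr_ge0. Qed.

Lemma sub_steps A A' J T J' : A `<=` A' -> steps A J T J' -> steps A' J T J'.
Proof. by move=> AA'; elim=> [|{}T {}J' a h _ IH Aa h0 h2]; constructor => //; exact: AA'. Qed.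

Lemma steps_trans A J1 J2 J3 T1 T2 :
  steps A J1 T1 J2 -> steps A J2 T2 J3 -> steps A J1 (T1 + T2) J3.
Proof.
move=> s12; elim=> [|{}T2 {}J3 a h _ IH Aa h0 h2]; first by rewrite addr0.
by rewrite addrA; constructor.
Qed.

Local Notation unit_itv := [set a : R | 0 <= a <= 1].

Lemma inv_steps J T J' : inv_jet J -> steps unit_itv J T J' -> inv_jet J'.
Proof. by move=> iJ; elim=> // {}T {}J' a h _ iJ' aI h0 h2; exact: inv_step. Qed.

Lemma inv_jet2 J x : inv_jet J -> `|J 2 x| <= 2.
Proof.
move=> [_ _ /(_ x) J2 /(_ x) J21]; rewrite ger0_norm//.
by apply: le_trans J21; rewrite lerDl mulr_ge0// sqr_ge0.
Qed.

Variable f0 : nat -> R -> R.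
Hypothesis if0 : inv_jet f0.
Hypothesis bf0 : forall k, exists B, forall x, `|f0 k.+1 x| <= B.

(** Orders 1 and 2 come from the invariant. From order 3 on, [step_bound] is a discrete Gronwall
    inequality: the factors [1 + C h^2] multiply to at most [exp (C T)], whatever the number of
    steps. *)
Lemma steps_bounded T k : 0 <= T -> exists M, 1 <= M /\
  forall T' J, steps unit_itv f0 T' J -> T' <= T -> bounded_upto J k M.
Proof.
move=> T0; elim: k => [|[|[|k]] [N [N1 IH]]].
- by exists 1; split => // T' J _ _ j; case: j.
- exists 1; split => // T' J s _ [|[|j]]// _ x.
  by have [_ J1 _ _] := inv_steps if0 s.
- exists 2; split; first by rewrite ler1n.
  move=> T' J s _ [|[|[|j]]]// _ x; have iJ := inv_steps if0 s.
    by have [_ /(_ x) J1 _ _] := iJ; apply: le_trans J1 _; rewrite ler1n.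
  exact: inv_jet2.
have [B0 f0B] := bf0 k.+2.
have B00 : 0 <= B0 by apply: le_trans (f0B 0).
pose C := 2 ^+ k.+3 * N ^+ 2.
have C0 : 0 <= C by rewrite mulr_ge0 ?exprn_ge0// (le_trans _ N1).
exists (Num.max N ((B0 + 1) * expR (C * T))); split; first by rewrite le_max N1.
have H T' J : steps unit_itv f0 T' J -> T' <= T ->
    forall x, `|J k.+3 x| + 1 <= (B0 + 1) * expR (C * T').
  elim=> [_ x|{}T' {}J a h s IHs aI h0 h2 T'T].
    by rewrite mulr0 expR0 mulr1 lerD2r.
  have T'T1 : T' <= T by apply: le_trans T'T; rewrite lerDl sqr_ge0.
  have [jJ J1 _ _] := inv_steps if0 s.
  pose B := (B0 + 1) * expR (C * T') - 1.
  have JB x : `|J k.+3 x| <= B by rewrite lerBrDr IHs.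
  have B0' : 0 <= B by apply: le_trans (JB 0).
  move=> x; apply: le_trans (step_bound aI h0 h2 jJ J1 N1 B0' (IH _ _ s T'T1) JB x) _.
  rewrite /B subrK [C * (_ + _)]mulrDr expRD [leRHS]mulrA.
  apply: ler_wpM2l; first by rewrite mulr_ge0 ?expR_ge0// addr_ge0.
  exact: expR_ge1Dx.
move=> T' J s T'T j /andP[j0]; rewrite leq_eqVlt => /orP[/eqP -> x|jk x].
  rewrite le_max; apply/orP; right.
  apply: le_trans (_ : _ <= `|J k.+3 x| + 1) _; first by rewrite lerDl.
  apply: le_trans (H _ _ s T'T x) _; rewrite ler_wpM2l ?addr_ge0//.
  by rewrite ler_expR ler_wpM2l.
by rewrite le_max (IH _ _ s T'T j _ x)// j0.
Qed.

End evolution.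

(** * Consistency and stability of the scheme *)

Section consistency.
Context {R : realType}.
Implicit Types (J : nat -> R -> R) (a b c h x K M T : R) (A : set R).

Lemma taylor_sym J k M x h : jet J -> (forall y, `|J k.+2 y| <= M) ->
  `|J k (x + h) + J k (x - h) - 2 * J k x| <= 2 * M * h ^+ 2.
Proof.
move=> jJ JM.
have := taylor1 x (- h) (jJ k) (jJ k.+1) JM.
have := taylor1 x h (jJ k) (jJ k.+1) JM.
rewrite sqrrN !ler_norml => /andP[? ?] /andP[? ?].
by apply/andP; split; lra.
Qed.

Lemma step_incr a h J k M x : 0 <= a <= 1 -> 0 <= h -> jet J -> 0 <= M ->
  bounded_upto J k.+2 M ->
  `|step a h J k x - J k x| <= (M + 2 ^+ k * M ^+ 2) * h ^+ 2.
Proof.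
move=> /andP[a0 a1] h0 jJ M0 JM.
have JM2 y : `|J k.+2 y| <= M by apply: JM; rewrite ltnSn.
have T := taylor_sym x h jJ JM2.
have L : `|leibniz (dj h J) (dj h J) k x| <= 2 ^+ k * ((2 * h * M) * (2 * h * M)).
  apply: leibniz_le => i ik; rewrite normrM.
  by apply: ler_pM => //; apply: dj_le => // y; apply: JM; lia.
set l := leibniz _ _ _ _ in L.
have -> : step a h J k x - J k x =
  (J k (x + h) + J k (x - h) - 2 * J k x) / 2 + a / 8 * l.
  by rewrite /step -/l; field.
apply: le_trans (ler_normD _ _) _; rewrite [leRHS]mulrDl; apply: lerD.
  by rewrite normrM [`|2^-1|]ger0_norm//; lra.
rewrite normrM [`|a / 8|]ger0_norm ?divr_ge0//.
have -> : 2 ^+ k * M ^+ 2 * h ^+ 2 = 4^-1 * (2 ^+ k * ((2 * h * M) * (2 * h * M))) by field.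
by apply: ler_pM; rewrite ?divr_ge0//; lra.
Qed.

Definition source J b x := J 2 x + b * J 1%N x ^+ 2.

(** Symmetry in [h] cancels the odd orders, whence O(h^4). About h^(-2) steps fit into a unit of
    clock, so the accumulated error is still O(h^2). *)
Lemma step_consistent a h J M x : 0 <= a <= 1 -> 0 <= h -> jet J ->
  (forall y, `|J 1%N y| <= 1) -> bounded_upto J 4 M ->
  `|step a h J 0 x - J 0%N x - h ^+ 2 / 2 * source J a x| <= 2 * M * h ^+ 4.
Proof.
move=> /andP[a0 a1] h0 jJ J1 JM.
have M0 : 0 <= M by apply: le_trans (JM 1%N isT 0).
have J4 y : `|J 4 y| <= M by exact: JM.
have J3 y : `|J 3 y| <= M by exact: JM.
have dp k (s : R) : is_derive s 1 (fun s => J k (x + s)) (J k.+1 (x + s)).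
  rewrite addrC; under eq_fun do rewrite addrC; exact: (der_shift (jJ k (s + x))).
have dm k (s : R) : is_derive s 1 (fun s => J k (x - s)) (- J k.+1 (x - s)).
  have d := der_comp (f := fun s => J k (x + s)) (g := fun s => - s) (dp k (- s)) (derN (der_id s)).
  by apply: is_derive_ext d _ _ => //; rewrite mulrN1.
pose r3 s := J 1%N (x + s) - J 1%N (x - s) - 2 * s * J 2 x.
have r3P s : 0 <= s -> `|r3 s| <= 2 * M * s ^+ 3.
  move=> s0; apply: (growth_is_derive (n := 2) s0
     (f' := fun s => J 2 (x + s) + J 2 (x - s) - 2 * J 2 x)).
  - move=> y; apply: is_derive_ext (derB (derB (dp 1%N y) (dm 1%N y))
      (derM (derZ 2 (der_id y)) (der_cst (J 2 x) y))) _ _ => //.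
    by ring.
  - by rewrite /r3 addr0 subr0; ring.
  - by rewrite mulr_ge0.
  - by move=> y _; exact: taylor_sym.
pose r4 s := J 0%N (x + s) + J 0%N (x - s) - 2 * J 0%N x - s ^+ 2 * J 2 x.
have r4P s : 0 <= s -> `|r4 s| <= 2 * M * s ^+ 4.
  move=> s0; apply: (growth_is_derive (n := 3) s0 (f' := r3)).
  - move=> y; apply: is_derive_ext (derB (derB (derD (dp 0%N y) (dm 0%N y)) (der_cst (2 * J 0%N x) y))
      (derM (derM (der_id y) (der_id y)) (der_cst (J 2 x) y))) _ _.
      by apply/funext => z; rewrite /r4 expr2.
    by rewrite /r3; ring.
  - by rewrite /r4 addr0 subr0; ring.
  - by rewrite mulr_ge0.
  - by move=> y /andP[y0 _]; exact: r3P.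
pose q s := J 0%N (x + s) - J 0%N (x - s) - 2 * s * J 1%N x.
have qP : `|q h| <= 2 * M * h ^+ 3.
  apply: (growth_is_derive (n := 2) h0
     (f' := fun s => J 1%N (x + s) + J 1%N (x - s) - 2 * J 1%N x)).
  - move=> y; apply: is_derive_ext (derB (derB (dp 0%N y) (dm 0%N y))
      (derM (derZ 2 (der_id y)) (der_cst (J 1%N x) y))) _ _ => //.
    by ring.
  - by rewrite /q addr0 subr0; ring.
  - by rewrite mulr_ge0.
  - by move=> y _; exact: taylor_sym.
rewrite step0E /source.
(* The nonlinear error is a difference of squares: the cubic remainder [q h] times a factor of size
   [4 h]. *)
have -> : (J 0%N (x + h) + J 0%N (x - h)) / 2 + a / 8 * (J 0%N (x + h) - J 0%N (x - h)) ^+ 2 -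
   J 0%N x - h ^+ 2 / 2 * (J 2 x + a * J 1%N x ^+ 2) =
   r4 h / 2 + a / 8 * (q h * (J 0%N (x + h) - J 0%N (x - h) + 2 * h * J 1%N x)).
  by rewrite /r4 /q; field.
have D : `|J 0%N (x + h) - J 0%N (x - h) + 2 * h * J 1%N x| <= 4 * h.
  apply: le_trans (ler_normD _ _) _.
  have := dj_le x jJ h0 J1; rewrite mulr1 /dj => d.
  rewrite (_ : 4 * h = 2 * h + 2 * h); last by ring.
  apply: lerD => //; rewrite normrM ger0_norm ?mulr_ge0//.
  by rewrite -[leRHS]mulr1 ler_wpM2l// mulr_ge0.
have Q : `|a / 8 * (q h * (J 0%N (x + h) - J 0%N (x - h) + 2 * h * J 1%N x))|
   <= 8^-1 * ((2 * M * h ^+ 3) * (4 * h)).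
  rewrite normrM [`|a / 8|]ger0_norm ?divr_ge0//.
  apply: ler_pM; rewrite ?divr_ge0//; first lra.
  by rewrite normrM; apply: ler_pM.
apply: le_trans (ler_normD _ _) _.
rewrite (_ : 2 * M * h ^+ 4 = 2 * M * h ^+ 4 / 2 + 8^-1 * (2 * M * h ^+ 3 * (4 * h))); last by field.
apply: lerD => //; rewrite normrM [`|2^-1|]ger0_norm// ler_wpM2r//.
exact: r4P.
Qed.

(** Factoring the difference of the two squares shows that the difference of two steps is an average
    of the old difference, with weights [1/2 + s] and [1/2 - s] where [|s| <= h/2]. *)
Lemma step_contraction a h J J' e x : 0 <= a <= 1 -> 0 <= h -> h ^+ 2 <= 2^-1 ->
  jet J -> jet J' -> (forall y, `|J 1%N y| <= 1) -> (forall y, `|J' 1%N y| <= 1) ->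
  (forall y, `|J 0%N y - J' 0%N y| <= e) ->
  `|step a h J 0 x - step a h J' 0 x| <= e.
Proof.
move=> /andP[a0 a1] h0 h2 jJ jJ' J1 J1' H.
have h1 : h <= 1 by nra.
have d := dj_le x jJ h0 J1; have d' := dj_le x jJ' h0 J1'.
have e0 : `|a / 8 * (dj h J 0 x + dj h J' 0 x)| <= h / 2.
  rewrite normrM [`|a / 8|]ger0_norm ?divr_ge0//.
  apply: le_trans (_ : _ <= 8^-1 * (2 * h + 2 * h)) _; last lra.
  apply: ler_pM; rewrite ?divr_ge0//; first lra.
  by apply: le_trans (ler_normD _ _) _; apply: lerD; lra.
rewrite !step0E.
set s := a / 8 * _ in e0.
have -> : (J 0%N (x + h) + J 0%N (x - h)) / 2 + a / 8 * (J 0%N (x + h) - J 0%N (x - h)) ^+ 2 -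
   ((J' 0%N (x + h) + J' 0%N (x - h)) / 2 + a / 8 * (J' 0%N (x + h) - J' 0%N (x - h)) ^+ 2) =
   (2^-1 + s) * (J 0%N (x + h) - J' 0%N (x + h)) + (2^-1 - s) * (J 0%N (x - h) - J' 0%N (x - h)).
  by rewrite /s /dj; field.
move: e0 (H (x + h)) (H (x - h)); rewrite !ler_norml.
move=> /andP[? ?] /andP[? ?] /andP[? ?]; apply/andP; split; nra.
Qed.

Local Notation unit_itv := [set a : R | 0 <= a <= 1].

Lemma steps_incr A J J' T T' k M x : A `<=` unit_itv -> inv_jet J -> 0 <= M ->
  (forall T' J', steps A J T' J' -> T' <= T -> bounded_upto J' k.+2 M) ->
  steps A J T' J' -> T' <= T ->
  `|J' k x - J k x| <= (M + 2 ^+ k * M ^+ 2) * T'.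
Proof.
move=> AI iJ M0 HM; elim=> [_|{}T' {}J' a h s IH Aa h0 h2 T'T].
  by rewrite subrr normr0 mulr0.
have T'T1 : T' <= T by apply: le_trans T'T; rewrite lerDl sqr_ge0.
have [jJ' _ _ _] := inv_steps iJ (sub_steps AI s).
have := step_incr x (AI _ Aa) h0 jJ' M0 (HM _ _ s T'T1).
have := IH T'T1; rewrite mulrDr => H1 H2.
rewrite (_ : _ - J k x = (step a h J' k x - J' k x) + (J' k x - J k x)); last by ring.
by apply: le_trans (ler_normD _ _) _; rewrite addrC lerD.
Qed.

(** Many steps with coefficients in [A] against one Euler step with the single coefficient [b]: the
    drift of the jet contributes [T'], that of the coefficient contributes [O]. *)
Lemma steps_consistent A J J' T T' M b O x : A `<=` unit_itv -> inv_jet J -> 0 <= M ->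
  0 <= b <= 1 -> (forall a, A a -> `|a - b| <= O) -> 0 <= O ->
  (forall T' J', steps A J T' J' -> T' <= T -> bounded_upto J' 4 M) ->
  steps A J T' J' -> T' <= T ->
  `|J' 0%N x - J 0%N x - T' / 2 * source J b x| <= (1 + 5 * M + 8 * M ^+ 2) * T' * (T' + O).
Proof.
move=> AI iJ M0 bI AO O0 HM; elim=> [_|{}T' {}J' a h s IH Aa h0 h2 T'T].
  by rewrite subrr mul0r mul0r subr0 normr0 mulr0 mul0r.
have T'T1 : T' <= T by apply: le_trans T'T; rewrite lerDl sqr_ge0.
have T'0 := steps_ge0 s.
have [jJ' J1' _ _] := inv_steps iJ (sub_steps AI s).
have [_ J1 _ _] := iJ.
have H1 := IH T'T1.
have H2 := step_consistent x (AI _ Aa) h0 jJ' J1' (HM _ _ s T'T1).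
have le_upto k J'' : (k <= 4)%N -> bounded_upto J'' 4 M -> bounded_upto J'' k M.
  by move=> k4 HJ j /andP[j0 jk]; apply: HJ; rewrite j0 (leq_trans jk).
have I1 : `|J' 1%N x - J 1%N x| <= (M + 2 ^+ 1 * M ^+ 2) * T'.
  apply: (steps_incr x AI iJ M0 _ s T'T1) => T1 K s1 T1T; apply: le_upto => //; exact: HM T1T.
have I2 : `|J' 2 x - J 2 x| <= (M + 2 ^+ 2 * M ^+ 2) * T'.
  apply: (steps_incr x AI iJ M0 _ s T'T1) => T1 K s1 T1T; apply: le_upto => //; exact: HM T1T.
have H3 : `|source J' a x - source J b x| <= (M + 2 ^+ 2 * M ^+ 2) * T' + 2 * ((M + 2 ^+ 1 * M ^+ 2) * T') + O.
  rewrite (_ : _ - _ = (J' 2 x - J 2 x) + (a * ((J' 1%N x - J 1%N x) * (J' 1%N x + J 1%N x)) + (a - b) * J 1%N x ^+ 2)); last by rewrite /source; ring.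
  apply: le_trans (ler_normD _ _) _; rewrite -addrA; apply: lerD => //.
  apply: le_trans (ler_normD _ _) _; apply: lerD.
    have /andP[a0 a1] := AI _ Aa.
    rewrite normrM (ger0_norm a0) -[leRHS]mul1r; apply: ler_pM => //.
    rewrite normrM mulrC; apply: ler_pM => //.
    by apply: le_trans (ler_normD _ _) _; have := J1 x; have := J1' x; lra.
  rewrite normrM -[leRHS]mulr1; apply: ler_pM => //; first exact: AO.
  by rewrite normrX; apply: exprn_ile1.
(* Here [3 M + 8 M^2] bounds the drift of [source] per unit of clock, [2 M] is the consistency error
   of one step, and 1 goes with [O]. *)
set C := 1 + 5 * M + 8 * M ^+ 2.
rewrite (_ : _ - _ = (J' 0%N x - J 0%N x - T' / 2 * source J b x) +
  ((step a h J' 0 x - J' 0%N x - h ^+ 2 / 2 * source J' a x) +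
    h ^+ 2 / 2 * (source J' a x - source J b x))); last by field.
apply: le_trans (ler_normD _ _) _.
apply: le_trans (lerD H1 (le_trans (ler_normD _ _) (lerD H2 (lexx _)))) _.
rewrite normrM (ger0_norm (_ : 0 <= h ^+ 2 / 2)) ?divr_ge0 ?sqr_ge0//.
apply: le_trans (lerD (lexx _) (lerD (lexx _) (ler_wpM2l _ H3))) _.
  by rewrite divr_ge0 ?sqr_ge0.
have h4 : h ^+ 4 = h ^+ 2 * h ^+ 2 by ring.
have M2 := sqr_ge0 M.
rewrite h4; set k := h ^+ 2; have k0 : 0 <= k by exact: sqr_ge0.
have : 0 <= M * T' * k by rewrite !mulr_ge0.
have : 0 <= M ^+ 2 * T' * k by rewrite !mulr_ge0.
have : 0 <= M * k * k by rewrite !mulr_ge0.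
have : 0 <= M ^+ 2 * k * k by rewrite !mulr_ge0.
have : 0 <= k * O by rewrite !mulr_ge0.
have : 0 <= M * k * O by rewrite !mulr_ge0.
have : 0 <= M ^+ 2 * k * O by rewrite !mulr_ge0.
have : 0 <= T' * k by rewrite !mulr_ge0.
have : 0 <= k * k by rewrite !mulr_ge0.
rewrite /C expr1 expr2; lra.
Qed.

End consistency.

(** * Cauchy criteria for real sequences *)

Section sequences.
Context {R : realType}.
Implicit Types (u v : R^nat) (C e : R).

Lemma cauchy_crit_cvg u :
  (forall e, 0 < e -> exists N, forall n m, (N <= n)%N -> (N <= m)%N -> `|u n - u m| <= e) ->
  cvgn u.
Proof.
move=> H; apply/cauchy_cvgP; apply/cauchy_ballP => e e0.
have [N HN] := H _ (divr_gt0 e0 (ltr0Sn _ 1)).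
exists (u @` [set n | (N <= n)%N], u @` [set n | (N <= n)%N]).
  by split; exists N => // n Nn; exists n.
move=> [_ _] [/= [n Nn <-] [m Nm <-]]; rewrite /ball /=.
by apply: le_lt_trans (HN _ _ Nn Nm) _; rewrite ltr_pdivrMr// ltr_pMr// ltr1n.
Qed.

Lemma cvg_cauchy_crit u : cvgn u ->
  forall e, 0 < e -> exists N, forall n m, (N <= n)%N -> (N <= m)%N -> `|u n - u m| <= e.
Proof.
move=> /cvgrPdist_le H e e0.
have [N _ HN] := H _ (divr_gt0 e0 (ltr0Sn _ 1)).
exists N => n m Nn Nm.
have := HN _ Nn; have := HN _ Nm => /= h1 h2.
have -> : u n - u m = (limn u - u m) - (limn u - u n) by ring.
by apply: le_trans (ler_normB _ _) _; lra.
Qed.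

Lemma cvg_expr2V : (2^-1 ^+ n : R) @[n --> \oo] --> (0 : R).
Proof. by apply: cvg_expr; rewrite ger0_norm// invf_lt1// ltr1n. Qed.

Lemma cvg_of_geometric u C N :
  (forall n d, (N <= n)%N -> `|u n - u (n + d)%N| <= C * 2^-1 ^+ n) -> cvgn u.
Proof.
move=> H; apply: cauchy_crit_cvg => e e0.
have C0 : 0 <= C.
  have := H N 0%N (leqnn _); rewrite addn0 subrr normr0 => h.
  by rewrite -(pmulr_lge0 _ (_ : 0 < 2^-1 ^+ N)) ?exprn_gt0.
have : (C * 2^-1 ^+ n : R) @[n --> \oo] --> (0 : R).
  by rewrite -[X in _ --> X](mulr0 C); apply: cvgM; [exact: cvg_cst|exact: cvg_expr2V].
move=> /cvgrPdist_le /(_ _ e0)[N' _ HN].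
exists (maxn N N') => n m Nn Nm.
wlog nm : n m Nn Nm / (n <= m)%N.
  move=> W; have [|/ltnW] := leqP n m; first exact: W.
  by move=> mn; rewrite distrC; exact: W.
have n1 : (N <= n)%N by rewrite (leq_trans _ Nn)// leq_maxl.
have n2 : (N' <= n)%N by rewrite (leq_trans _ Nn)// leq_maxr.
have := H n (m - n)%N n1; rewrite subnKC// => /le_trans; apply.
by have := HN n n2; rewrite /= sub0r normrN; apply: le_trans; exact: ler_norm.
Qed.

End sequences.

(** * Convergence of the scheme along dyadic times *)

Section flow.
Context {R : realType}.
Variables (alpha g : R -> R) (L : R) (f0 : nat -> R -> R).
Implicit Types (J : nat -> R -> R) (a b c h x K M T s t : R) (A : set R).
Hypothesis alpha_nd : {homo alpha : s t / s <= t}.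
Hypothesis alpha01 : forall t, 0 <= alpha t <= 1.
Hypothesis alpha_rc : forall t e, 0 < e -> exists2 d, 0 < d & alpha (t + d) <= alpha t + e.
Hypothesis L0 : 0 <= L.
Hypothesis g_nd : {homo g : s t / s <= t}.
Hypothesis g_lip : forall s t, s <= t -> g t - g s <= L * (t - s).
Hypothesis g_bd : forall t, g 1 - g t <= L.
Hypothesis if0 : inv_jet f0.
Hypothesis bf0 : forall k, exists B, forall x, `|f0 k.+1 x| <= B.

Local Notation unit_itv := [set a : R | 0 <= a <= 1].
Local Notation del n := (2^-1 ^+ n : R).

Definition grid n j : R := 1 - j%:R * del n.

(** Time runs backwards from 1. The coefficient on a cell is the one at its later endpoint, so that
    refining the grid approaches a given time from above, the side on which [alpha] is
    continuous. *)
Fixpoint flow n j : nat -> R -> R :=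
  if j is i.+1 then
    step (alpha (grid n i)) (Num.sqrt (g (grid n i) - g (grid n i.+1))) (flow n i)
  else f0.

(** By [gridstep_le] this gives [h^2 <= 1/2] for every step of level [n]. *)
Definition fine_grid n := L * del n <= 2^-1.

Lemma fine_grid_near : exists N, forall n, (N <= n)%N -> fine_grid n.
Proof.
have : (L * del n : R) @[n --> \oo] --> (0 : R).
  by rewrite -[X in _ --> X](mulr0 L); apply: cvgM; [exact: cvg_cst|exact: cvg_expr2V].
move=> /cvgrPdist_le /(_ 2^-1); rewrite invr_gt0 ltr0n => /(_ isT)[N _ HN].
exists N => n Nn; have := HN n Nn.
by rewrite /= sub0r normrN ger0_norm// mulr_ge0// exprn_ge0.
Qed.

Lemma gridS n j : grid n j - grid n j.+1 = del n.
Proof. by rewrite /grid -natr1; ring. Qed.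

Lemma grid_le n i j : (j <= i)%N -> grid n i <= grid n j.
Proof. by move=> ji; rewrite /grid lerB// ler_wpM2r ?ler_nat// exprn_ge0. Qed.

Lemma grid_refine n d j : grid (n + d) (j * 2 ^ d) = grid n j.
Proof.
rewrite /grid natrM natrX exprD mulrACA [2 ^+ d * _]mulrC -mulrA.
by rewrite [del d * _]mulrC -exprMn mulfV ?expr1n ?mulr1.
Qed.

Lemma sqr_gridstep n j :
  Num.sqrt (g (grid n j) - g (grid n j.+1)) ^+ 2 = g (grid n j) - g (grid n j.+1).
Proof. by rewrite sqr_sqrtr// subr_ge0 g_nd// grid_le. Qed.

Lemma gridstep_le n j : g (grid n j) - g (grid n j.+1) <= L * del n.
Proof. by rewrite -(gridS n j) g_lip// grid_le. Qed.

Lemma steps_flow n i j : fine_grid n -> (j <= i)%N ->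
  steps [set a | alpha (grid n i) <= a <= alpha (grid n j)] (flow n j)
    (g (grid n j) - g (grid n i)) (flow n i).
Proof.
move=> fn /subnKC <-; elim: (i - j)%N => [|d IH].
  by rewrite addn0 subrr; constructor.
rewrite addnS (_ : g (grid n j) - _ = g (grid n j) - g (grid n (j + d)) +
    Num.sqrt (g (grid n (j + d)) - g (grid n (j + d).+1)) ^+ 2); last first.
  by rewrite sqr_gridstep; ring.
apply: stepsS.
- apply: sub_steps IH => a /= /andP[a1 ->]; rewrite andbT.
  by apply: le_trans a1; apply: alpha_nd; exact: grid_le.
- by rewrite /= !alpha_nd// grid_le// leq_addr.
- exact: sqrtr_ge0.
- by rewrite sqr_gridstep (le_trans (gridstep_le _ _)).
Qed.

Lemma sub_unit_itv s t : [set a | alpha s <= a <= alpha t] `<=` unit_itv.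
Proof.
move=> a /= /andP[sa at_]; have /andP[s0 _] := alpha01 s; have /andP[_ t1] := alpha01 t.
by rewrite (le_trans s0 sa) (le_trans at_ t1).
Qed.

Lemma steps_flow0 n i : fine_grid n ->
  steps unit_itv f0 (g 1 - g (grid n i)) (flow n i).
Proof.
move=> fn; have := sub_steps (@sub_unit_itv _ _) (steps_flow fn (leq0n i)).
by rewrite {1}/grid mul0r subr0.
Qed.

Lemma inv_flow n i : fine_grid n -> inv_jet (flow n i).
Proof. by move=> fn; exact: inv_steps if0 (steps_flow0 i fn). Qed.

(** The bound also covers every further run started from the flow whose total clock stays within
    [L]; [steps_incr] and [steps_consistent] ask for it in this form. *)
Lemma flow_bounded k : exists M, 1 <= M /\ forall n i, fine_grid n ->
  forall A T' J, A `<=` unit_itv -> steps A (flow n i) T' J ->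
    T' <= g (grid n i) - g 1 + L -> bounded_upto J k M.
Proof.
have [M [M1 HM]] := steps_bounded if0 bf0 k L0.
exists M; split => // n i fn A T' J AI s T'L.
apply: HM (steps_trans (steps_flow0 i fn) (sub_steps AI s)) _; lra.
Qed.

Lemma flow_le k : exists M, 1 <= M /\ forall n i, fine_grid n -> bounded_upto (flow n i) k M.
Proof.
have [M [M1 HM]] := flow_bounded k; exists M; split => // n i fn.
by apply: (HM _ _ fn unit_itv 0) => //; [constructor|have := g_bd (grid n i); lra].
Qed.

Lemma flow_incr k : exists C, 0 <= C /\ forall n i j x, fine_grid n -> (j <= i)%N ->
  `|flow n i k x - flow n j k x| <= C * (g (grid n j) - g (grid n i)).
Proof.
have [M [M1 HM]] := flow_bounded k.+2.
have M0 : 0 <= M by rewrite (le_trans _ M1).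
exists (M + 2 ^+ k * M ^+ 2); split; first by rewrite addr_ge0// mulr_ge0// exprn_ge0.
move=> n i j x fn ji.
apply: (steps_incr x (@sub_unit_itv _ _) (inv_flow j fn) M0 _ (steps_flow fn ji) (lexx _)).
move=> T' J' s sT; apply: HM fn _ _ _ (@sub_unit_itv _ _) s _.
by have := g_bd (grid n i); lra.
Qed.

Lemma flow_consistent : exists C, 0 <= C /\ forall n i j b x, fine_grid n -> (j <= i)%N ->
  alpha (grid n i) <= b <= alpha (grid n j) ->
  let T := g (grid n j) - g (grid n i) in
  `|flow n i 0 x - flow n j 0%N x - T / 2 * source (flow n j) b x|
    <= C * T * (T + (alpha (grid n j) - alpha (grid n i))).
Proof.
have [M [M1 HM]] := flow_bounded 4.
have M0 : 0 <= M by rewrite (le_trans _ M1).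
exists (1 + 5 * M + 8 * M ^+ 2); split; first by rewrite !addr_ge0// mulr_ge0// exprn_ge0.
move=> n i j b x fn ji bI /=.
apply: (steps_consistent x (@sub_unit_itv _ _) (inv_flow j fn) M0 _ _ _ _ (steps_flow fn ji) (lexx _)).
- exact: sub_unit_itv bI.
- by move=> a /= aI; rewrite ler_norml; apply/andP; split; lra.
- by rewrite subr_ge0 alpha_nd// grid_le.
- move=> T' J' s sT; apply: HM fn _ _ _ (@sub_unit_itv _ _) s _.
  by have := g_bd (grid n i); lra.
Qed.

(** On each coarse cell, one coarse step and the [2 ^ d] fine steps are both compared with the same
    Euler step taken from the fine jet, while [step_contraction] passes on the earlier error without
    amplifying it. *)
Lemma flow_refine : exists C, 0 <= C /\ forall n d j x, fine_grid n ->
  `|flow n j 0%N x - flow (n + d) (j * 2 ^ d) 0%N x| <= C * del n.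
Proof.
have [C [C0 HC]] := flow_consistent; have [M [M1 HM]] := flow_le 4.
have M0 : 0 <= M by rewrite (le_trans _ M1).
pose D := 2 * M + C.
have D0 : 0 <= D by rewrite /D addr_ge0// mulr_ge0.
exists (D * L * (L + 1)); split; first by rewrite !mulr_ge0// addr_ge0.
move=> n d j x fn.
have fnd : fine_grid (n + d).
  apply: le_trans fn; apply: ler_wpM2l => //; rewrite exprD ler_piMr ?exprn_ge0//.
  by rewrite exprn_ile1// invf_le1// ler1n.
(* The induction needs this sharper form: a cell adds [del n] times the increments of [g] and
   [alpha] over it, and these telescope to at most [L + 1]. *)
apply: (@le_trans _ _ (D * (L * del n) * ((g 1 - g (grid n j)) + (alpha 1 - alpha (grid n j))))); last first.
  rewrite (_ : D * L * (L + 1) * _ = D * (L * del n) * (L + 1)); last by ring.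
  apply: ler_wpM2l; first by rewrite !mulr_ge0// exprn_ge0.
  apply: lerD => //.
  by have /andP[_ ?] := alpha01 1; have /andP[? _] := alpha01 (grid n j); lra.
elim: j x => [|j IH] x.
  by rewrite mul0n /= subrr normr0 {1 2}/grid mul0r subr0 !subrr addr0 mulr0.
pose W := flow (n + d) (j * 2 ^ d); pose W' := flow (n + d) (j.+1 * 2 ^ d).
pose h := Num.sqrt (g (grid n j) - g (grid n j.+1)).
have h2 : h ^+ 2 = g (grid n j) - g (grid n j.+1) by rewrite sqr_gridstep.
have h2L : h ^+ 2 <= L * del n by rewrite h2 gridstep_le.
pose O := alpha (grid n j) - alpha (grid n j.+1).
have O0 : 0 <= O by rewrite subr_ge0 alpha_nd// grid_le.
have [jV V1 _ _] := inv_flow j fn; have [jW W1 _ _] := inv_flow (j * 2 ^ d) fnd.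
have jj : (j * 2 ^ d <= j.+1 * 2 ^ d)%N by rewrite leq_mul2r leqnSn orbT.
have bI : alpha (grid (n + d) (j.+1 * 2 ^ d)) <= alpha (grid n j) <= alpha (grid (n + d) (j * 2 ^ d)).
  by rewrite !grid_refine lexx andbT alpha_nd// grid_le.
have E1 := HC _ _ _ _ x fnd jj bI; rewrite /= !grid_refine -h2 -/O -/W -/W' in E1.
have E2 := step_consistent x (alpha01 (grid n j)) (sqrtr_ge0 _ : 0 <= h) jW W1 (HM _ _ fnd).
rewrite -/W in E2.
have E3 := step_contraction x (alpha01 (grid n j)) (sqrtr_ge0 _ : 0 <= h)
  (le_trans h2L fn) jV jW V1 W1 IH.
rewrite -/W in E3.
rewrite -/W'; have -> : flow n j.+1 0%N x - W' 0%N x =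
   (step (alpha (grid n j)) h (flow n j) 0 x - step (alpha (grid n j)) h W 0 x) +
   ((step (alpha (grid n j)) h W 0 x - W 0%N x - h ^+ 2 / 2 * source W (alpha (grid n j)) x) -
   (W' 0%N x - W 0%N x - h ^+ 2 / 2 * source W (alpha (grid n j)) x)).
  by rewrite -[flow n j.+1]/(step _ h (flow n j)); ring.
apply: le_trans (ler_normD _ _) _.
apply: le_trans (lerD E3 (le_trans (ler_normB _ _) (lerD E2 E1))) _.
have k0 : 0 <= h ^+ 2 by exact: sqr_ge0.
have key : 2 * M * h ^+ 4 + C * h ^+ 2 * (h ^+ 2 + O) <= D * (L * del n) * (h ^+ 2 + O).
  apply: (@le_trans _ _ (D * h ^+ 2 * (h ^+ 2 + O))).
    rewrite (_ : h ^+ 4 = h ^+ 2 * h ^+ 2); last by ring.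
    have : 0 <= M * (h ^+ 2 * O) by apply: mulr_ge0 => //; exact: mulr_ge0.
    by rewrite /D; lra.
  by apply: ler_wpM2r; [exact: addr_ge0|exact: ler_wpM2l].
rewrite (_ : g 1 - g (grid n j.+1) + _ = (g 1 - g (grid n j) + (alpha 1 - alpha (grid n j)))
   + (h ^+ 2 + O)); last by rewrite h2 /O; ring.
by rewrite [leRHS]mulrDr lerD.
Qed.

Definition idx n t := Num.truncn ((1 - t) * 2 ^+ n).

Lemma grid_idx n t : t <= 1 -> t <= grid n (idx n t) < t + del n.
Proof.
move=> t1; have p0 : 0 < 2 ^+ n :> R by rewrite exprn_gt0.
have /andP[] : (idx n t)%:R <= (1 - t) * 2 ^+ n < (idx n t).+1%:R.
  by apply: truncn_itv; rewrite mulr_ge0 ?subr_ge0// ltW.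
rewrite -ler_pdivrMr// -ltr_pdivlMr// -(natr1 (idx n t)) mulrDl mul1r => h1 h2.
by rewrite /grid exprVn; apply/andP; split; lra.
Qed.

Lemma idx_le n s t : s <= t -> (idx n t <= idx n s)%N.
Proof. by move=> st; apply: le_truncn; rewrite ler_wpM2r ?exprn_ge0// lerB. Qed.

Lemma idx_refine n d t : t <= 1 -> (idx n t * 2 ^ d <= idx (n + d) t)%N.
Proof.
move=> t1; rewrite truncn_ge_nat ?mulr_ge0 ?subr_ge0 ?exprn_ge0//.
rewrite exprD mulrA natrM natrX ler_wpM2r ?exprn_ge0//.
by rewrite truncn_le mulr_ge0 ?subr_ge0 ?exprn_ge0.
Qed.

(* [flow n (idx n t)] lives at the smallest dyadic time of level [n] above [t]. *)
Definition usol k t x := limn (fun n => flow n (idx n t) k x).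

Lemma flow_cvg0 t x : t <= 1 -> cvgn (fun n => flow n (idx n t) 0%N x).
Proof.
move=> t1; have [C [C0 HC]] := flow_refine; have [C' [C'0 HC']] := flow_incr 0.
have [N HN] := fine_grid_near.
apply: (@cvg_of_geometric _ _ (C + C' * L) N) => n d Nn.
have fn := HN _ Nn; have fnd := HN _ (leq_trans Nn (leq_addr d n)).
have -> : flow n (idx n t) 0%N x - flow (n + d) (idx (n + d) t) 0%N x =
  (flow n (idx n t) 0%N x - flow (n + d) (idx n t * 2 ^ d) 0%N x) -
  (flow (n + d) (idx (n + d) t) 0%N x - flow (n + d) (idx n t * 2 ^ d) 0%N x) by ring.
apply: le_trans (ler_normB _ _) _; rewrite mulrDl; apply: lerD; first exact: HC.
apply: le_trans (HC' _ _ _ x fnd (idx_refine n d t1)) _.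
rewrite grid_refine -mulrA; apply: ler_wpM2l => //.
have /andP[a1 a2] := grid_idx n t1; have /andP[b1 b2] := grid_idx (n + d) t1.
apply: (@le_trans _ _ (g (grid n (idx n t)) - g t)); first by rewrite lerB// g_nd.
by apply: le_trans (g_lip a1) _; apply: ler_wpM2l => //; lra.
Qed.

(** Derivatives converge by interpolation: given the uniform bound on order [k.+2], order [k.+1] is
    a difference quotient of order [k] with a fixed increment [a], up to [M a]. *)
Lemma flow_cvg k t x : t <= 1 -> flow n (idx n t) k x @[n --> \oo] --> usol k t x.
Proof.
move=> t1; elim: k x => [|k IH] x; first exact: flow_cvg0.
have [M [M1 HM]] := flow_le k.+2; have [N HN] := fine_grid_near.
have M0 : 0 < M by rewrite (lt_le_trans _ M1).
apply: cauchy_crit_cvg => e e0.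
(* The two Taylor errors, [2 M a] together, then use up [e/2]; the convergence at [x] and at [x + a]
   accounts for the other half. *)
pose a := e / (4 * M); have a0 : 0 < a by rewrite divr_gt0// mulr_gt0.
have eE : e / 2 = 2 * (M * a) by rewrite /a; field; rewrite gt_eqF.
have ae0 : 0 < a * e / 4 by rewrite divr_gt0// mulr_gt0.
have [N1 H1] := cvg_cauchy_crit (IH x) ae0.
have [N2 H2] := cvg_cauchy_crit (IH (x + a)) ae0.
exists (maxn N (maxn N1 N2)) => n m; rewrite !geq_max.
move=> /andP[nN /andP[nN1 nN2]] /andP[mN /andP[mN1 mN2]].
have T p : (N <= p)%N -> `|flow p (idx p t) k (x + a) - flow p (idx p t) k x - a * flow p (idx p t) k.+1 x| <= M * a ^+ 2.
  move=> Np; have [jV _ _ _] := inv_flow (idx p t) (HN _ Np).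
  apply: taylor1 (jV k) (jV k.+1) _ => y.
  by apply: HM; [exact: HN|rewrite ltnS leqnn].
have := T n nN; have := T m mN; have := H1 n m nN1 mN1; have := H2 n m nN2 mN2.
set p := flow n _ k x; set q := flow m _ k x; set p' := flow n _ k (x + a); set q' := flow m _ k (x + a).
set r := flow n _ k.+1 x; set r' := flow m _ k.+1 x => E1 E2 E3 E4.
have : `|a * (r - r')| <= a * e / 4 + a * e / 4 + M * a ^+ 2 + M * a ^+ 2.
  have -> : a * (r - r') = (p' - q') - (p - q) - (p' - p - a * r) + (q' - q - a * r') by ring.
  apply: le_trans (ler_normD _ _) _; apply: lerD => //.
  apply: le_trans (ler_normB _ _) _; apply: lerD => //.
  by apply: le_trans (ler_normB _ _) _; apply: lerD.
rewrite normrM (gtr0_norm a0) -(ler_pM2l a0) => h.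
rewrite -(ler_pM2l a0); apply: le_trans (_ : _ <= a * (e / 2) + 2 * (M * a) * a) _.
  by move: h; rewrite ler_pM2l// => h; apply: le_trans h _; lra.
by rewrite -eE; lra.
Qed.

Lemma grid_idx_cvg t : t <= 1 -> grid n (idx n t) @[n --> \oo] --> t.
Proof.
move=> t1; apply: (@squeeze_cvgr _ _ _ _ (fun=> t) (fun n => t + del n)).
- by near=> n; have /andP[-> /ltW ->] := grid_idx n t1.
- exact: cvg_cst.
- rewrite -[X in _ --> X](addr0 t); apply: cvgD; [exact: cvg_cst|exact: cvg_expr2V].
Unshelve. all: by end_near. Qed.

Lemma g_grid_cvg t : t <= 1 -> g (grid n (idx n t)) @[n --> \oo] --> g t.
Proof.
move=> t1; apply: (@squeeze_cvgr _ _ _ _ (fun=> g t) (fun n => g t + L * del n)).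
- near=> n; have /andP[h1 h2] := grid_idx n t1; rewrite g_nd//= -lerBlDl.
  by apply: le_trans (g_lip h1) _; apply: ler_wpM2l => //; lra.
- exact: cvg_cst.
- rewrite -[X in _ --> X](addr0 (g t)); apply: cvgD; first exact: cvg_cst.
  by rewrite -(mulr0 L); apply: cvgM; [exact: cvg_cst|exact: cvg_expr2V].
Unshelve. all: by end_near. Qed.

(** The grid times approach [t] from above, so right continuity is enough. *)
Lemma alpha_grid_cvg t : t <= 1 -> alpha (grid n (idx n t)) @[n --> \oo] --> alpha t.
Proof.
move=> t1; apply/cvgrPdist_le => e e0; have [d d0 Hd] := alpha_rc t e0.
have /cvgrPdist_lt /(_ _ d0) := grid_idx_cvg t1.
apply: filterS => n /=; have /andP[h1 h2] := grid_idx n t1 => h3.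
rewrite distrC ger0_norm ?subr_ge0 ?alpha_nd// lerBlDl (le_trans _ Hd)// alpha_nd//.
by rewrite distrC ger0_norm ?subr_ge0// in h3; lra.
Qed.

Lemma near_fine : \forall n \near \oo, fine_grid n.
Proof. by have [N HN] := fine_grid_near; exists N. Qed.

Lemma jet_usol t : t <= 1 -> jet (fun k => usol k t).
Proof.
move=> t1 k x; have [M [M1 HM]] := flow_le k.+2.
have T a : `|usol k t (x + a) - usol k t x - a * usol k.+1 t x| <= M * a ^+ 2.
  apply: (@ler_cvg_to _ \oo _ _ (fun n => `|flow n (idx n t) k (x + a) -
    flow n (idx n t) k x - a * flow n (idx n t) k.+1 x|) (fun=> M * a ^+ 2)).
  - apply: cvg_norm; apply: cvgB; first by apply: cvgB; exact: flow_cvg.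
    by apply: cvgM; [exact: cvg_cst|exact: flow_cvg].
  - exact: cvg_cst.
  - near=> n; have fn : fine_grid n by near: n; exact: near_fine.
    have [jV _ _ _] := inv_flow (idx n t) fn.
    apply: taylor1 (jV k) (jV k.+1) _ => y.
    by apply: HM; [|rewrite ltnS leqnn].
exact: der_quadratic (fun h _ => T h).
Unshelve. all: by end_near. Qed.

Lemma usol_bounded k : exists M, forall t x, t <= 1 -> `|usol k.+1 t x| <= M.
Proof.
have [M [M1 HM]] := flow_le k.+1; exists M => t x t1.
apply: (@ler_cvg_to _ \oo _ _ (fun n => `|flow n (idx n t) k.+1 x|) (fun=> M)).
- by apply: cvg_norm; exact: flow_cvg.
- exact: cvg_cst.
- near=> n; apply: HM; [by near: n; exact: near_fine|by rewrite ltnS leqnn].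
Unshelve. all: by end_near. Qed.

Lemma usol1_le t x : t <= 1 -> `|usol 1 t x| <= 1.
Proof.
move=> t1.
apply: (@ler_cvg_to _ \oo _ _ (fun n => `|flow n (idx n t) 1%N x|) (fun=> 1)).
- by apply: cvg_norm; exact: flow_cvg.
- exact: cvg_cst.
- near=> n; have fn : fine_grid n by near: n; exact: near_fine.
  by have [_ -> _ _] := inv_flow (idx n t) fn.
Unshelve. all: by end_near. Qed.

Lemma usol_lip k : exists C, 0 <= C /\ forall s t x, s <= t -> t <= 1 ->
  `|usol k s x - usol k t x| <= C * (t - s).
Proof.
have [C [C0 HC]] := flow_incr k; exists (C * L); split; first exact: mulr_ge0.
move=> s t x st t1; have s1 := le_trans st t1.
apply: (@le_trans _ _ (C * (g t - g s))); last first.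
  by rewrite -mulrA ler_wpM2l// g_lip.
apply: (@ler_cvg_to _ \oo _ _ (fun n => `|flow n (idx n s) k x - flow n (idx n t) k x|)
  (fun n => C * (g (grid n (idx n t)) - g (grid n (idx n s))))).
- by apply: cvg_norm; apply: cvgB; exact: flow_cvg.
- by apply: cvgM; [exact: cvg_cst|apply: cvgB; exact: g_grid_cvg].
- by near=> n; apply: HC; [near: n; exact: near_fine|exact: idx_le].
Unshelve. all: by end_near. Qed.

Lemma usol_expansion : exists C, 0 <= C /\ forall s t x, s <= t -> t <= 1 ->
  `|usol 0 s x - usol 0 t x - (g t - g s) / 2 * source (usol ^~ t) (alpha t) x|
   <= C * (t - s) * ((t - s) + (alpha t - alpha s)).
Proof.
have [C [C0 HC]] := flow_consistent.
exists (C * L * (L + 1)); split; first by rewrite !mulr_ge0// addr_ge0.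
move=> s t x st t1; have s1 := le_trans st t1.
(* For [s < t] the grid time above [s] is eventually below [t], which makes [alpha t] an admissible
   frozen coefficient in [flow_consistent]; [s = t] is trivial and treated apart. *)
have [<-|snt] := eqVneq s t; first by rewrite !subrr mul0r mul0r subr0 normr0 mulr0 mul0r.
have {snt}st' : s < t by rewrite lt_neqAle snt.
have a0 : 0 <= alpha t - alpha s by rewrite subr_ge0 alpha_nd.
have g0 : 0 <= g t - g s by rewrite subr_ge0 g_nd.
have gL := g_lip st.
apply: (@le_trans _ _ (C * (g t - g s) * ((g t - g s) + (alpha t - alpha s)))); last first.
  rewrite -!mulrA; apply: ler_wpM2l => //.
  rewrite (_ : L * _ = (L * (t - s)) * ((L + 1) * (t - s + (alpha t - alpha s)))); last by ring.
  apply: ler_pM => //; first exact: addr_ge0.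
  have : 0 <= L * (alpha t - alpha s) by exact: mulr_ge0.
  nra.
apply: (@ler_cvg_to _ \oo _ _ (fun n => `|flow n (idx n s) 0%N x - flow n (idx n t) 0%N x -
    (g (grid n (idx n t)) - g (grid n (idx n s))) / 2 *
     (flow n (idx n t) 2 x + alpha t * flow n (idx n t) 1%N x ^+ 2)|)
  (fun n => C * (g (grid n (idx n t)) - g (grid n (idx n s))) *
    ((g (grid n (idx n t)) - g (grid n (idx n s))) +
     (alpha (grid n (idx n t)) - alpha s)))); last first.
  near=> n; have fn : fine_grid n by near: n; exact: near_fine.
  have /andP[h1 h2] := grid_idx n s1; have /andP[h3 h4] := grid_idx n t1.
  have bI : alpha (grid n (idx n s)) <= alpha t <= alpha (grid n (idx n t)).
    rewrite !alpha_nd// ltW//; near: n; exact: cvgr_lt (grid_idx_cvg s1) _ st'.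
  apply: le_trans (HC _ _ _ _ x fn (idx_le n st) bI) _.
  apply: ler_wpM2l.
    by rewrite mulr_ge0// subr_ge0 g_nd// grid_le// idx_le.
  by rewrite lerD2l lerB// alpha_nd.
- apply: cvgM; first by apply: cvgM; [exact: cvg_cst|apply: cvgB; exact: g_grid_cvg].
  by apply: cvgD; apply: cvgB; solve [exact: g_grid_cvg|exact: alpha_grid_cvg|exact: cvg_cst].
- apply: cvg_norm; apply: cvgB; first by apply: cvgB; exact: flow_cvg.
  apply: cvgM.
    by apply: cvgM; [apply: cvgB; exact: g_grid_cvg|exact: cvg_cst].
  apply: cvgD; first exact: flow_cvg.
  apply: cvgM; first exact: cvg_cst.
  by rewrite expr2; under eq_fun do rewrite expr2; apply: cvgM; exact: flow_cvg.
Unshelve. all: by end_near. Qed.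

End flow.

(** * Integrals of locally bounded measurable functions *)

Section locally_bounded.
Context {R : realType}.
Notation mR := (measurableTypeR R).
Notation leb := (@lebesgue_measure R).
Implicit Types (f g : R -> R) (F G : R -> R -> R) (a b c d s t x M N C : R).

(* [lbm]: locally bounded and measurable, hence integrable on segments, which
   makes every side condition of linearity and of Fubini's theorem compositional. *)
Definition lbm f := measurable_fun [set: mR] (f : mR -> mR) /\
  forall N, exists C, forall x, `|x| <= N -> `|f x| <= C.

Definition lbm2 F :=
  measurable_fun [set: mR * mR] (fun z : mR * mR => F z.1 z.2 : mR) /\
  forall N, exists C, forall t x, `|t| <= N -> `|x| <= N -> `|F t x| <= C.

Lemma lbm_cst c : lbm (fun=> c).
Proof. by split; [exact: measurable_cst|move=> N; exists `|c|]. Qed.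

Lemma lbmD f g : lbm f -> lbm g -> lbm (fun x => f x + g x).
Proof.
move=> [mf bf] [mg bg]; split; first exact: measurable_funD.
move=> N; have [C HC] := bf N; have [D HD] := bg N; exists (C + D) => x xN.
by apply: le_trans (ler_normD _ _) _; rewrite lerD ?HC ?HD.
Qed.

Lemma lbmM f g : lbm f -> lbm g -> lbm (fun x => f x * g x).
Proof.
move=> [mf bf] [mg bg]; split; first exact: measurable_funM.
move=> N; have [C HC] := bf N; have [D HD] := bg N; exists (C * D) => x xN.
by rewrite normrM ler_pM ?HC ?HD.
Qed.

Lemma lbmN f : lbm f -> lbm (fun x => - f x).
Proof.
move=> [mf bf]; split; first exact: measurable_funN.
by move=> N; have [C HC] := bf N; exists C => x xN; rewrite normrN HC.
Qed.

Lemma lbmB f g : lbm f -> lbm g -> lbm (fun x => f x - g x).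
Proof. by move=> lf lg; apply: lbmD => //; exact: lbmN. Qed.

Lemma lbmZ c f : lbm f -> lbm (fun x => c * f x).
Proof. by move=> lf; apply: lbmM => //; exact: lbm_cst. Qed.

Lemma lbm_norm f : lbm f -> lbm (fun x => `|f x|).
Proof.
move=> [mf bf]; split; first exact: measurableT_comp.
by move=> N; have [C HC] := bf N; exists C => x xN; rewrite normr_id HC.
Qed.

Lemma lbm_continuous f : continuous f -> lbm f.
Proof.
move=> cf; split; first exact: continuous_measurable_fun.
move=> N; have : compact (f @` `[-N, N]).
  apply: continuous_compact; last exact: segment_compact.
  exact: continuous_subspaceT.
move=> /compact_bounded[C0 [_ HC]]; exists (C0 + 1) => x.
by rewrite ler_norml => xN; apply: (HC (C0 + 1)); [rewrite ltrDl|exists x].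
Qed.

Lemma lbm2D F G : lbm2 F -> lbm2 G -> lbm2 (fun t x => F t x + G t x).
Proof.
move=> [mf bf] [mg bg]; split; first exact: measurable_funD.
move=> N; have [C HC] := bf N; have [D HD] := bg N; exists (C + D) => t x tN xN.
by apply: le_trans (ler_normD _ _) _; rewrite lerD ?HC ?HD.
Qed.

Lemma lbm2M F G : lbm2 F -> lbm2 G -> lbm2 (fun t x => F t x * G t x).
Proof.
move=> [mf bf] [mg bg]; split; first exact: measurable_funM.
move=> N; have [C HC] := bf N; have [D HD] := bg N; exists (C * D) => t x tN xN.
by rewrite normrM ler_pM ?HC ?HD.
Qed.

Lemma lbm2N F : lbm2 F -> lbm2 (fun t x => - F t x).
Proof.
move=> [mf bf]; split; first exact: measurable_funN.
by move=> N; have [C HC] := bf N; exists C => t x tN xN; rewrite normrN HC.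
Qed.

Lemma lbm2B F G : lbm2 F -> lbm2 G -> lbm2 (fun t x => F t x - G t x).
Proof. by move=> lf lg; apply: lbm2D => //; exact: lbm2N. Qed.

Lemma lbm2_norm F : lbm2 F -> lbm2 (fun t x => `|F t x|).
Proof.
move=> [mf bf]; split; first exact: measurableT_comp.
by move=> N; have [C HC] := bf N; exists C => t x tN xN; rewrite normr_id HC.
Qed.

Lemma lbm2_fst f : lbm f -> lbm2 (fun t _ => f t).
Proof.
move=> [mf bf]; split; first exact: (measurableT_comp mf measurable_fst).
by move=> N; have [C HC] := bf N; exists C => t x tN _; exact: HC.
Qed.

Lemma lbm2_snd f : lbm f -> lbm2 (fun _ x => f x).
Proof.
move=> [mf bf]; split; first exact: (measurableT_comp mf measurable_snd).
by move=> N; have [C HC] := bf N; exists C => t x _; exact: HC.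
Qed.

Lemma lbm2_swap F : lbm2 F -> lbm2 (fun x t => F t x).
Proof.
move=> [mf bf]; split.
  apply: (measurableT_comp mf (_ : measurable_fun setT (fun z : mR * mR => (z.2, z.1)))).
  by apply: measurable_fun_pair; [exact: measurable_snd|exact: measurable_fst].
by move=> N; have [C HC] := bf N; exists C => x t xN tN; exact: HC.
Qed.

Lemma lbm2_sectl F t : lbm2 F -> lbm (F t).
Proof.
move=> [mf bf]; split; first exact: (measurable_fun_pair2 t mf).
move=> N; have [C HC] := bf (Num.max N `|t|); exists C => x xN; apply: HC.
  by rewrite le_max lexx orbT.
by rewrite le_max xN.
Qed.

Lemma lbm2_sectr F x : lbm2 F -> lbm (F ^~ x).
Proof. by move=> /lbm2_swap lF; exact: lbm2_sectl lF. Qed.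

(** Links the topology of the plane to the product sigma-algebra: an open set is the union of the
    countably many squares with rational centre and radius that it contains. *)
Lemma open_measurable2 (A : set (R * R)) : open A -> measurable (A : set (mR * mR)).
Proof.
move=> oA.
pose box (q : rat * rat * rat) : set (mR * mR) :=
  `](ratr q.1.1 - ratr q.2), (ratr q.1.1 + ratr q.2)[ `*`
  `](ratr q.1.2 - ratr q.2), (ratr q.1.2 + ratr q.2)[.
have mbox q : measurable (box q) by apply: measurableX; exact: measurable_itv.
pose B q := if pselect (box q `<=` A) then box q else set0.
have -> : A = \bigcup_q B q.
  apply/seteqP; split => [[x y] Axy|[x y] [q _]]; last first.
    by rewrite /B; case: pselect => [qA /qA|].
  have /nbhs_ballP[e /= e0 He] : nbhs (x, y) A by exact: open_nbhs_nbhs.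
  have [r /itvP hr] := rat_in_itvoo (divr_gt0 e0 (ltr0Sn R 1) : 0 < e / 2).
  have r0 : 0 < ratr r :> R by rewrite hr.
  have re : ratr r < e / 2 :> R by rewrite hr.
  have [p] := @rat_in_itvoo R (x - ratr r) (x + ratr r) ltac:(lra).
  rewrite in_itv/= => /andP[p1 p2].
  have [q] := @rat_in_itvoo R (y - ratr r) (y + ratr r) ltac:(lra).
  rewrite in_itv/= => /andP[q1 q2].
  exists (p, q, r) => //; rewrite /B; case: pselect => [qA|].
    by split; rewrite /= in_itv/=; apply/andP; split; lra.
  case=> -[u v] [/=]; rewrite !in_itv/= => /andP[u1 u2] /andP[v1 v2].
  by apply: He; split; rewrite /ball/= ltr_norml; apply/andP; split; lra.
apply: countable_bigcupT_measurable; first exact: countableP.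
by move=> q; rewrite /B; case: pselect => qA; [exact: mbox|exact: measurable0].
Qed.

Lemma lbm2_continuous F : continuous (fun z : R * R => F z.1 z.2) -> lbm2 F.
Proof.
move=> cF; split.
  apply: (measurability _ (RGenOpens.measurableE R)).
  move=> _ [_ [a [b ->] <-]]; rewrite setTI; apply: open_measurable2.
  by apply: open_comp => // z _; exact: cF.
move=> N; have : compact ((fun z : R * R => F z.1 z.2) @` (`[-N, N] `*` `[-N, N])).
  apply: continuous_compact; first exact: continuous_subspaceT.
  by apply: compact_setX; exact: segment_compact.
move=> /compact_bounded[C0 [_ HC]]; exists (C0 + 1) => t x.
move=> tN xN; apply: (HC (C0 + 1)); first by rewrite ltrDl.
by exists (t, x) => //; split; rewrite /= in_itv/= -ler_norml.
Qed.

(** Not an oriented integral: it vanishes when [b < a]. *)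
Definition RI a b f : R := \int[leb]_(x in `[a, b]) f x.

Lemma lbm_integrable a b f : lbm f -> leb.-integrable `[a, b] (EFin \o f).
Proof.
move=> [mf bf]; have [C HC] := bf (`|a| + `|b|).
apply: measurable_bounded_integrable => //.
- by rewrite /= lebesgue_measure_itv/=; case: ifP => // _; rewrite -EFinB ltry.
- exact: measurable_funS mf.
- exists C; split; first exact: num_real.
  move=> M CM x /=; rewrite in_itv/= => /andP[ax xb].
  apply: le_trans (ltW CM); apply: HC.
  rewrite ler_norml; have := ler_norm b; have := ler_norm (- a); rewrite normrN.
  by have := normr_ge0 a; have := normr_ge0 b; move=> *; apply/andP; split; lra.
Qed.

Lemma RI_D a b f g : lbm f -> lbm g ->
  RI a b (fun x => f x + g x) = RI a b f + RI a b g.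
Proof. by move=> lf lg; apply: RintegralD => //; exact: lbm_integrable. Qed.

Lemma RI_B a b f g : lbm f -> lbm g ->
  RI a b (fun x => f x - g x) = RI a b f - RI a b g.
Proof. by move=> lf lg; apply: RintegralB => //; exact: lbm_integrable. Qed.

Lemma RI_Z a b c f : lbm f -> RI a b (fun x => c * f x) = c * RI a b f.
Proof. by move=> lf; apply: RintegralZl => //; exact: lbm_integrable. Qed.

Lemma RI_N a b f : lbm f -> RI a b (fun x => - f x) = - RI a b f.
Proof.
move=> lf; rewrite -mulN1r -RI_Z//; congr (RI _ _ _).
by apply/funext => x; rewrite mulN1r.
Qed.

Lemma eq_RI a b f g : (forall x, a <= x <= b -> f x = g x) -> RI a b f = RI a b g.
Proof. by move=> H; apply: eq_Rintegral => x; rewrite inE/= in_itv/=; exact: H. Qed.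

Lemma RI_le a b f g : lbm f -> lbm g ->
  (forall x, a <= x <= b -> f x <= g x) -> RI a b f <= RI a b g.
Proof.
move=> lf lg H; apply: le_Rintegral => //; exact: lbm_integrable.
Qed.

Lemma RI_cst a b c : a <= b -> RI a b (fun=> c) = c * (b - a).
Proof.
move=> ab; rewrite /RI Rintegral_cst//= lebesgue_measure_itv/= lte_fin.
by case: ltgtP ab => // -> _; rewrite subrr.
Qed.

Lemma RI_ub a b f C : lbm f -> a <= b -> (forall x, a <= x <= b -> f x <= C) ->
  RI a b f <= C * (b - a).
Proof. by move=> lf ab H; rewrite -RI_cst//; apply: RI_le => //; exact: lbm_cst. Qed.

Lemma RI_ge0 a b f : (forall x, a <= x <= b -> 0 <= f x) -> 0 <= RI a b f.
Proof. by move=> H; apply: Rintegral_ge0 => x /=; rewrite in_itv/=; exact: H. Qed.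

Lemma RI_norm a b f : lbm f -> `|RI a b f| <= RI a b (fun x => `|f x|).
Proof. by move=> lf; apply: le_normr_Rintegral => //; exact: lbm_integrable. Qed.

Lemma RI_norm_ub a b f C : lbm f -> a <= b -> (forall x, a <= x <= b -> `|f x| <= C) ->
  `|RI a b f| <= C * (b - a).
Proof.
move=> lf ab H; apply: le_trans (RI_norm _ _ lf) _; exact: RI_ub (lbm_norm lf) ab H.
Qed.

Lemma RI_split a b c f : lbm f -> a <= b -> b <= c -> RI a c f = RI a b f + RI b c f.
Proof.
move=> lf ab bc; rewrite /RI.
have := @Rintegral_itvB R f (BLeft a) (BRight c) b (lbm_integrable _ _ lf).
rewrite !bnd_simp => /(_ ab bc); rewrite Rintegral_itv_obnd_cbnd.
  by move=> <-; rewrite addrCA subrr addr0.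
by apply: integrableS (lbm_integrable b c lf) => //; exact: subset_itv_oc_cc.
Qed.

Lemma RI_same a f : RI a a f = 0.
Proof. by rewrite /RI set_itv1 Rintegral_set1. Qed.

Lemma derivable_LR P f a b : (forall x, is_derive x 1 P (f x)) ->
  derivable_oo_LRcontinuous P a b.
Proof.
move=> dF; have cF x : {for x, continuous P}.
  by apply/differentiable_continuous/derivable1_diffP; have [] := dF x.
split; first by move=> x _; have [] := dF x.
- by apply: cvg_at_right_filter; exact: cF.
- by apply: cvg_at_left_filter; exact: cF.
Qed.

Lemma RI_FTC P f a b : a <= b -> continuous f ->
  (forall x, is_derive x 1 P (f x)) -> RI a b f = P b - P a.
Proof.
move=> ab cf dF; have [->|ne] := eqVneq a b; first by rewrite RI_same subrr.
have lt : a < b by rewrite lt_neqAle ne.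
rewrite /RI /Rintegral (@continuous_FTC2 R f P a b)//.
- exact: continuous_subspaceT.
- exact: derivable_LR dF.
- by move=> x _; rewrite derive1E; apply: derive_val; exact: dF.
Qed.

Lemma RI_parts P Q f g a b : a <= b -> continuous f -> continuous g ->
  (forall x, is_derive x 1 P (f x)) -> (forall x, is_derive x 1 Q (g x)) ->
  RI a b (fun x => P x * g x) = P b * Q b - P a * Q a - RI a b (fun x => f x * Q x).
Proof.
move=> ab cf cg dF dG; have [->|ne] := eqVneq a b; first by rewrite !RI_same !subrr.
have lt : a < b by rewrite lt_neqAle ne.
apply: Rintegration_by_parts => //.
- exact: continuous_subspaceT.
- exact: derivable_LR dF.
- by move=> x _; rewrite derive1E; apply: derive_val; exact: dF.
- exact: continuous_subspaceT.
- exact: derivable_LR dG.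
- by move=> x _; rewrite derive1E; apply: derive_val; exact: dG.
Qed.

Lemma ae_imp (P Q : R -> Prop) : {ae leb, forall x, P x} ->
  (forall x, P x -> Q x) -> {ae leb, forall x, Q x}.
Proof.
move=> P0 PQ; apply: (@filterS _ _ (ae_filter_ringOfSetsType leb)) P0 => x.
exact: PQ.
Qed.

Lemma RI_cvg0 a b (f : (R -> R)^nat) C : (forall n, lbm (f n)) ->
  (forall n x, a <= x <= b -> `|f n x| <= C) ->
  {ae leb, forall x, a <= x <= b -> f n x @[n --> \oo] --> (0 : R)} ->
  RI a b (f n) @[n --> \oo] --> (0 : R).
Proof.
move=> lf fC f0.
have [|||||/= _ _ H] := @dominated_convergence _ _ _ leb `[a, b] (measurable_itv _)
   (fun n => EFin \o f n) (fun=> 0%E) (fun=> C%:E).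
- move=> n; apply/measurable_EFinP; apply: measurable_funS (lf n).1 => //.
- exact: measurable_cst.
- apply: ae_imp f0 _ => x H /=; rewrite in_itv/= => /H; by move=> fx; apply: cvg_EFin => //; exact: nearW.
- exact: lbm_integrable (lbm_cst C).
- by apply: aeW => x n /=; rewrite in_itv/= lee_fin; exact: fC.
move: H; rewrite integral0 => /fine_cvg /=; exact.
Qed.

Lemma RI_Fubini a b c d F : lbm2 F ->
  RI a b (fun t => RI c d (F t)) = RI c d (fun x => RI a b (F ^~ x)).
Proof.
move=> lF; have [mF bF] := lF.
pose D : set (mR * mR) := `[a, b] `*` `[c, d].
have mD : measurable D by apply: measurableX; exact: measurable_itv.
pose H (z : mR * mR) : \bar R := ((fun z : mR * mR => (F z.1 z.2)%:E) \_ D) z.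
have iH : (leb \x leb)%E.-integrable setT H.
  rewrite /H; apply/integrable_restrict => //; rewrite setTI.
  have [C HC] := bF (Num.max (`|a| + `|b|) (`|c| + `|d|)).
  apply: measurable_bounded_integrable => //.
  - rewrite /D /= product_measure1E; [|exact: measurable_itv|exact: measurable_itv].
    by rewrite /= !lebesgue_measure_itv/=; do 2 case: ifP => _; rewrite ?mule0 ?mul0e -?EFinB -?EFinM ?ltry.
  - exact: measurable_funS mF.
  - exists C; split; first exact: num_real.
    move=> M CM [t x] /= [] /=; rewrite !in_itv/= => /andP[at_ tb] /andP[cx xd].
    apply: le_trans (ltW CM); apply: HC; rewrite le_max; apply/orP; [left|right].
      rewrite ler_norml; have := ler_norm b; have := ler_norm (- a); rewrite normrN.
      by have := normr_ge0 a; have := normr_ge0 b; move=> *; apply/andP; split; lra.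
    rewrite ler_norml; have := ler_norm d; have := ler_norm (- c); rewrite normrN.
    by have := normr_ge0 c; have := normr_ge0 d; move=> *; apply/andP; split; lra.
have fin (p q : R) (h : R -> R) : lbm h ->
    (\int[leb]_(x in `[p, q]) (h x)%:E)%E = (RI p q h)%:E.
  by move=> lh; rewrite /RI /Rintegral fineK// integrable_fin_num//; exact: lbm_integrable.
have E1 : (\int[leb]_x \int[leb]_y H (x, y) = \int[leb]_(x in `[a, b]) (RI c d (F x))%:E)%E.
  rewrite [RHS]integral_mkcond; apply: eq_integral => t _; rewrite patchE.
  case: ifPn => [|] tab.
    rewrite -(fin _ _ _ (lbm2_sectl t lF)) [RHS]integral_mkcond; apply: eq_integral => x _.
    rewrite /H !patchE; congr (if _ then _ else _).
    by apply/idP/idP; rewrite !inE /D/=; [case|split=> //; rewrite inE in tab].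
  apply: integral0_eq => x _; rewrite /H patchE; case: ifPn => //.
  by rewrite inE /D => -[/= h _]; move: tab; rewrite notin_setE.
have E2 : (\int[leb]_y \int[leb]_x H (x, y) = \int[leb]_(y in `[c, d]) (RI a b (F ^~ y))%:E)%E.
  rewrite [RHS]integral_mkcond; apply: eq_integral => t _; rewrite patchE.
  case: ifPn => [|] tab.
    rewrite -(fin _ _ _ (lbm2_sectr t lF)) [RHS]integral_mkcond; apply: eq_integral => x _.
    rewrite /H !patchE; congr (if _ then _ else _).
    by apply/idP/idP; rewrite !inE /D/=; [case|split=> //; rewrite inE in tab].
  apply: integral0_eq => x _; rewrite /H patchE; case: ifPn => //.
  by rewrite inE /D => -[/= _ h]; move: tab; rewrite notin_setE.
by rewrite {1}/RI {2}/RI /Rintegral -E1 -E2 (Fubini iH).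
Qed.

Lemma lbm_RI c d F : c <= d -> lbm2 F -> lbm (fun t => RI c d (F t)).
Proof.
move=> cd lF; have [mF bF] := lF; split; last first.
  move=> N; have [C HC] := bF (Num.max N (`|c| + `|d|)); exists (C * (d - c)) => t tN.
  apply: RI_norm_ub => //; first exact: lbm2_sectl.
  move=> x /andP[cx xd]; apply: HC; rewrite le_max; first by rewrite tN.
  apply/orP; right.
  rewrite ler_norml; have := ler_norm d; have := ler_norm (- c); rewrite normrN.
  by have := normr_ge0 c; have := normr_ge0 d; move=> *; apply/andP; split; lra.
(* Tonelli's theorem gives measurability for nonnegative integrands; the general case follows by
   writing [F] as [(|F| + F) - |F|]. *)
have pos (G : R -> R -> R) : lbm2 G -> (forall t x, 0 <= G t x) ->
    measurable_fun [set: mR] ((fun t => RI c d (G t)) : mR -> mR).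
  move=> [mG _] G0; pose D : set (mR * mR) := setT `*` `[c, d].
  have mD : measurable D by apply: measurableX => //; exact: measurable_itv.
  pose H (z : mR * mR) : \bar R := ((fun z : mR * mR => (G z.1 z.2)%:E) \_ D) z.
  have -> : (fun t => RI c d (G t)) = fine \o (fubini_F leb H).
    apply/funext => t; rewrite /RI /Rintegral /= /fubini_F.
    congr fine; rewrite [LHS]integral_mkcond; apply: eq_integral => x _; rewrite /H !patchE; congr (if _ then _ else _).
    by apply/idP/idP; rewrite !inE /D/=; [split|case].
  apply: measurableT_comp; first exact: fine_measurable.
  apply: measurable_fun_fubini_tonelli_F; last first.
    by move=> z; rewrite /H patchE; case: ifP => // _; rewrite lee_fin.
  apply/(measurable_restrictT _ _).1 => //.
  by apply: measurable_funS (_ : measurable_fun setT _) => //; exact/measurable_EFinP.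
have lp : lbm2 (fun t x => `|F t x| + F t x) by apply: lbm2D => //; exact: lbm2_norm.
have ln : lbm2 (fun t x => `|F t x|) by exact: lbm2_norm.
have -> : (fun t => RI c d (F t)) =
    (fun t => RI c d (fun x => `|F t x| + F t x)) \- (fun t => RI c d (fun x => `|F t x|)).
  apply/funext => t; rewrite /= RI_D; last 2 first.
  - exact: (lbm2_sectl t ln).
  - exact: lbm2_sectl.
  by rewrite addrAC subrr add0r.
apply: measurable_funB; apply: pos => // t x.
by rewrite -lerBlDr sub0r; have := ler_norm (- F t x); rewrite normrN.
Qed.

End locally_bounded.

(** * Integrated identities in time and Gronwall's inequality *)

Section primitives.
Context {R : realType}.
Implicit Types (f g a b : R -> R) (s t r x C K M : R).

Lemma der_continuous f f' : (forall x, is_derive x 1 f (f' x)) -> continuous f.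
Proof.
move=> df x; apply/differentiable_continuous/derivable1_diffP.
by have [] := df x.
Qed.

(** Cutting [[s, t]] into [n] equal cells, the errors add up to [C (t - s) / n] times the total
    increment of time and [alpha], which tends to 0. Since [alpha] is monotone, its jumps do no
    harm. *)
Lemma telescoping (G alpha : R -> R) C : 0 <= C -> {homo alpha : s t / s <= t} ->
  (forall s t, 0 <= s -> s <= t -> t <= 1 ->
     G s - G t <= C * (t - s) * ((t - s) + (alpha t - alpha s))) ->
  forall s t, 0 <= s -> s <= t -> t <= 1 -> G s <= G t.
Proof.
move=> C0 nd H s t s0 st t1.
pose V := (t - s) + (alpha t - alpha s).
have V0 : 0 <= V by rewrite addr_ge0 ?subr_ge0// nd.
pose D := C * (t - s) * V.
have D0 : 0 <= D by rewrite !mulr_ge0 ?subr_ge0.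
have key n : G s - G t <= D / n.+1%:R.
  pose d := (t - s) / n.+1%:R; pose p k := s + k%:R * d.
  have d0 : 0 <= d by rewrite divr_ge0 ?subr_ge0.
  have pS k : p k.+1 = p k + d by rewrite /p -natr1; ring.
  have pn : p n.+1 = t by rewrite /p /d mulrCA mulfV ?mulr1 ?pnatr_eq0//; ring.
  have pm k l : (k <= l)%N -> p k <= p l.
    by move=> kl; rewrite /p lerD2l ler_wpM2r// ler_nat.
  have p0 : p 0%N = s by rewrite /p mul0r addr0.
  have K k : (k <= n.+1)%N -> G s - G (p k) <= C * d * ((p k - s) + (alpha (p k) - alpha s)).
    elim: k => [_|k IH kn]; first by rewrite p0 !subrr addr0 mulr0.
    have := H (p k) (p k.+1); rewrite {1}pS.
    have sp : 0 <= p k by rewrite (le_trans s0)// -p0 pm.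
    have pt : p k.+1 <= 1 by rewrite (le_trans _ t1)// -pn pm.
    move=> /(_ sp); rewrite lerDl => /(_ d0 pt).
    rewrite (_ : p k.+1 - p k = d); last by rewrite pS addrAC subrr add0r.
    have := IH (ltnW kn).
    have -> : p k.+1 - s = (p k - s) + d by rewrite pS; ring.
    lra.
  have := K n.+1 (leqnn _); rewrite pn => /le_trans; apply.
  by rewrite /D /d le_eqVlt; apply/orP; left; apply/eqP; rewrite /V; ring.
rewrite -subr_le0; apply/ler_addgt0Pl => e e0; rewrite addr0.
pose n := Num.truncn (D / e).
apply: le_trans (key n) _; rewrite ler_pdivrMr// mulrC -ler_pdivrMr//.
by have /andP[_ /ltW] := truncn_itv (divr_ge0 D0 (ltW e0)).
Qed.

(** The integrated form of [f' = a], which stays meaningful where [mu[0,t]] jumps and [u] has no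
    time derivative. *)
Definition prim a f := forall s t, 0 <= s -> s <= t -> t <= 1 -> f t - f s = RI s t a.

Lemma prim_lip a f : lbm a -> prim a f ->
  exists C, 0 <= C /\ forall s t, 0 <= s -> s <= t -> t <= 1 -> `|f t - f s| <= C * (t - s).
Proof.
move=> la pf; have [C HC] := la.2 1; exists `|C|; split => // s t s0 st t1.
rewrite pf//; apply: RI_norm_ub => // x /andP[sx xt].
by apply: le_trans (ler_norm C); apply: HC; rewrite ger0_norm; lra.
Qed.

Lemma prim_quadratic a f C : lbm a -> 0 <= C ->
  (forall s t, 0 <= s -> s <= t -> t <= 1 -> `|f t - f s - RI s t a| <= C * (t - s) ^+ 2) ->
  prim a f.
Proof.
move=> la C0 H.
have G s t : 0 <= s -> s <= t -> RI 0 t a - RI 0 s a = RI s t a.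
  by move=> s0 st; rewrite (RI_split la s0 st) addrAC subrr add0r.
have B s t : C * (t - s) * (t - s + (0 - 0)) = C * (t - s) ^+ 2 by ring.
move=> s t s0 st t1; apply/eqP; rewrite eq_le -(G s t s0 st); apply/andP; split.
  suff : RI 0 s a - f s <= RI 0 t a - f t by lra.
  apply: (@telescoping (fun t => RI 0 t a - f t) (fun=> 0) C) => // {}s {}t {}s0 {}st {}t1.
  have := H s t s0 st t1; rewrite -(G s t s0 st) => /ler_normlP[h1 h2].
  by rewrite B; lra.
suff : f s - RI 0 s a <= f t - RI 0 t a by lra.
apply: (@telescoping (fun t => f t - RI 0 t a) (fun=> 0) C) => // {}s {}t {}s0 {}st {}t1.
have := H s t s0 st t1; rewrite -(G s t s0 st) => /ler_normlP[h1 h2].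
by rewrite B; lra.
Qed.

Lemma prim_ext a a' f f' : prim a f -> (forall t, 0 <= t <= 1 -> a t = a' t) ->
  (forall t, 0 <= t <= 1 -> f t = f' t) -> prim a' f'.
Proof.
move=> pf aa ff s t s0 st t1; rewrite -!ff ?s0 ?t1 ?andbT//; last 2 first.
- exact: le_trans st t1.
- exact: le_trans s0 st.
rewrite pf//; apply: eq_RI => x /andP[sx xt]; apply: aa.
by rewrite (le_trans s0 sx) (le_trans xt t1).
Qed.

Lemma primB a b f g : lbm a -> lbm b -> prim a f -> prim b g ->
  prim (fun t => a t - b t) (fun t => f t - g t).
Proof.
move=> la lb pf pg s t s0 st t1; rewrite RI_B// -pf// -pg//; ring.
Qed.

(** A product rule without derivatives: the increment of [f g] is [f s] times that of [g] plus [g t]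
    times that of [f]. Moving [s] and [t] to the running time costs O((t - s)^2), because [f] and
    [g] are Lipschitz. *)
Lemma primM a b f g : lbm a -> lbm b -> lbm f -> lbm g -> prim a f -> prim b g ->
  prim (fun t => a t * g t + f t * b t) (fun t => f t * g t).
Proof.
move=> la lb lf lg pf pg.
have [A [A0 HA]] := prim_lip la pf; have [B [B0 HB]] := prim_lip lb pg.
have lag : lbm (fun t => a t * g t) by exact: lbmM.
have lfb : lbm (fun t => f t * b t) by exact: lbmM.
have bd f' : lbm f' -> exists C, 0 <= C /\ forall t, 0 <= t <= 1 -> `|f' t| <= C.
  move=> lf'; have [C HC] := lf'.2 1; exists `|C|; split=> // t /andP[t0 t1].
  by apply: le_trans (ler_norm C); apply: HC; rewrite ger0_norm.
have [Ca [Ca0 HCa]] := bd _ la; have [Cb [Cb0 HCb]] := bd _ lb.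
apply: (@prim_quadratic _ _ (A * Cb + Ca * B)); first exact: lbmD.
  by rewrite addr_ge0// mulr_ge0.
move=> s t s0 st t1.
have lsb : lbm (fun r => f s * b r) by exact: lbmZ.
have lat : lbm (fun r => g t * a r) by exact: lbmZ.
rewrite (_ : f t * g t - f s * g s = RI s t (fun r => f s * b r + g t * a r)); last first.
  by rewrite RI_D// !RI_Z// -pf// -pg//; ring.
rewrite -RI_B; last 2 first.
- exact: lbmD.
- exact: lbmD.
rewrite (_ : (A * Cb + Ca * B) * _ = (A * Cb + Ca * B) * (t - s) * (t - s)); last by ring.
apply: RI_norm_ub => //; first by apply: lbmB; exact: lbmD.
move=> r /andP[sr rt].
have r0 : 0 <= r by exact: le_trans sr.
have r1 : r <= 1 by exact: le_trans t1.
rewrite (_ : _ - _ = a r * (g t - g r) - (f r - f s) * b r); last by ring.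
apply: le_trans (ler_normB _ _) _; rewrite !normrM addrC mulrDl; apply: lerD.
  rewrite mulrAC; apply: ler_pM => //; last by rewrite HCb// r0.
  by apply: le_trans (HA _ _ s0 sr r1) _; rewrite ler_wpM2l// lerB.
rewrite -mulrA; apply: ler_pM => //; first by rewrite HCa// r0.
by apply: le_trans (HB _ _ r0 rt t1) _; rewrite ler_wpM2l// lerB.
Qed.

(** As [f] is only measurable and locally bounded, the inequality is iterated. Against the weight
    [exp (l (1 - s))] with [l = 2 C + 1] one has [C / l <= 1/2], so every iteration halves the
    excess over [2 A]. *)
Lemma gronwall f A C : 0 <= C -> 0 <= A -> lbm f ->
  (forall s, 0 <= s <= 1 -> f s <= A + C * RI s 1 f) ->
  forall s, 0 <= s <= 1 -> f s <= 2 * A * expR (2 * C + 1).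
Proof.
move=> C0 A0 lf H.
pose l := 2 * C + 1; have l0 : 0 < l by rewrite /l; lra.
have lN0 : l != 0 by rewrite gt_eqF.
pose E r := expR (l * (1 - r)).
have dE0 (r : R) : is_derive r 1 E (- l * E r).
  have d1 := derZ l (derB (der_cst 1 r) (der_id r)).
  apply: is_derive_ext (der_comp (g := fun r => l * (1 - r)) (is_derive_expR _) d1) _ _ => //.
  by rewrite /E; ring.
have dE (r : R) : is_derive r 1 (fun r => - l^-1 * E r) (E r).
  apply: is_derive_ext (derZ (- l^-1) (dE0 r)) _ _ => //.
  by rewrite mulrA mulrNN mulVf// mul1r.
have cE : continuous E := der_continuous dE0.
have [B HB] := lf.2 1.
have B0 : 0 <= B by apply: le_trans (HB 0 _) => //; rewrite normr0.
have key n s : 0 <= s <= 1 -> f s <= (2 * A + B * 2^-1 ^+ n) * E s.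
  elim: n s => [|n IH] s /andP[s0 s1].
    apply: le_trans (_ : _ <= B) _.
      by apply: le_trans (ler_norm _) _; apply: HB; rewrite ger0_norm.
    rewrite expr0 mulr1; have : 1 <= E s by apply: le_trans (expR_ge1Dx _); rewrite lerDl mulr_ge0 ?subr_ge0// ltW.
    by nra.
  set K := 2 * A + B * 2^-1 ^+ n in IH.
  have K0 : 0 <= K by rewrite addr_ge0// mulr_ge0// exprn_ge0.
  have -> : 2 * A + B * 2^-1 ^+ n.+1 = A + K / 2 by rewrite /K exprS; field.
  apply: le_trans (H s _) _; first by rewrite s0.
  have I : RI s 1 f <= K * (l^-1 * (E s - 1)).
    apply: (@le_trans _ _ (RI s 1 (fun r => K * E r))).
      apply: RI_le => //; first by apply: lbmZ; exact: lbm_continuous.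
      by move=> x /andP[sx x1]; apply: IH; rewrite x1 (le_trans s0).
    rewrite RI_Z; last exact: lbm_continuous.
    rewrite (RI_FTC s1 cE dE) ler_wpM2l// /E subrr mulr0 expR0 le_eqVlt; apply/orP; left.
    by apply/eqP; ring.
  have E1 : 1 <= E s by apply: le_trans (expR_ge1Dx _); rewrite lerDl mulr_ge0 ?subr_ge0// ltW.
  have Cl : C * l^-1 <= 2^-1 by rewrite ler_pdivrMr// /l; lra.
  have : C * RI s 1 f <= 2^-1 * (K * (E s - 1)).
    apply: le_trans (ler_wpM2l C0 I) _.
    rewrite (_ : C * (K * (l^-1 * (E s - 1))) = (C * l^-1) * (K * (E s - 1))); last by ring.
    by apply: ler_wpM2r => //; rewrite mulr_ge0// subr_ge0.
  have : A <= A * E s by rewrite ler_peMr.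
  by have : 0 <= K * E s by [rewrite mulr_ge0// ltW// expR_gt0]; lra.
move=> s /[dup] s01 /andP[s0 s1].
have lim : (2 * A + B * 2^-1 ^+ n) * E s @[n --> \oo] --> (2 * A + B * 0) * E s.
  apply: cvgM; last exact: cvg_cst.
  apply: cvgD; first exact: cvg_cst.
  by apply: cvgM; [exact: cvg_cst|apply: cvg_expr; rewrite ger0_norm// invf_lt1// ltr1n].
apply: (@le_trans _ _ ((2 * A + B * 0) * E s)).
  by apply: (ler_cvg_to (cvg_cst (f s)) lim); apply: nearW => n; exact: key.
rewrite mulr0 addr0; apply: ler_wpM2l; first by rewrite mulr_ge0.
rewrite ler_expR -/l -[leRHS]mulr1; apply: ler_wpM2l; first exact: ltW.
by rewrite gerBl.
Qed.

End primitives.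

(** * Data of the equation *)

Section log_cosh.
Context {R : realType}.
Implicit Types (x y : R).

Definition th x : R := (expR x - expR (- x)) / (expR x + expR (- x)).

Let den_gt0 x : 0 < expR x + expR (- x). Proof. by rewrite addr_gt0// expR_gt0. Qed.

Lemma der_expRN x : is_derive x 1 (fun y => expR (- y)) (- expR (- x)).
Proof.
apply: is_derive_ext (der_comp (g := fun y => - y) (is_derive_expR _) (derN (der_id x))) _ _ => //.
by rewrite mulrN1.
Qed.

Lemma der_log_cosh x : is_derive x 1 log_cosh (th x).
Proof.
have d1 : is_derive x 1 (fun y => (expR y + expR (- y)) / 2) ((expR x - expR (- x)) / 2).
  apply: is_derive_ext (derZ 2^-1 (derD (is_derive_expR x) (der_expRN x))) _ _.
    by apply/funext => y; rewrite mulrC.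
  by rewrite mulrC.
have h0 : 0 < (expR x + expR (- x)) / 2 by rewrite divr_gt0.
apply: is_derive_ext (der_comp (g := fun y => (expR y + expR (- y)) / 2) (is_derive1_ln h0) d1) _ _ => //.
by rewrite /th; field; rewrite gt_eqF.
Qed.

Lemma der_th x : is_derive x 1 th (1 - th x ^+ 2).
Proof.
have n0 y : expR y + expR (- y) != 0 by rewrite gt_eqF.
have dD := derD (is_derive_expR x) (der_expRN x).
have dV : is_derive x 1 (fun y => (expR y + expR (- y))^-1)
    (- (expR x + expR (- x)) ^- 2 * (expR x - expR (- x))).
  exact: (is_deriveV (f := fun y => expR y + expR (- y)) (n0 x) dD).
apply: is_derive_ext (derM (derB (is_derive_expR x) (der_expRN x)) dV) _ _ => //.
by rewrite /th; field.
Qed.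

Lemma th_le1 x : `|th x| <= 1.
Proof.
rewrite /th normrM normfV (gtr0_norm (den_gt0 x)) ler_pdivrMr// mul1r.
by rewrite ler_norml; have := expR_gt0 x; have := expR_gt0 (- x); move=> *; apply/andP; split; lra.
Qed.

(** Since [th' = 1 - th^2], all derivatives of log cosh are polynomials in [th], hence bounded. *)
Definition th_poly k : {poly R} := iter k (fun p => p^`() * (1 - 'X^2))%R 'X.

Definition log_cosh_jet k : R -> R :=
  if k is j.+1 then fun x => (th_poly j).[th x] else log_cosh.

Lemma jet_log_cosh : jet log_cosh_jet.
Proof.
case=> [|k] x; first by rewrite /= hornerX; exact: der_log_cosh.
apply: is_derive_ext (der_comp (g := th) (is_derive_poly (th_poly k) (th x)) (der_th x)) _ _ => //.
by rewrite /= hornerM !hornerE.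
Qed.

(** For log cosh the quantity [J 2 + 2 J 1^2] equals [1 + th^2], whose supremum is the constant 2 of
    [inv_jet]. *)
Lemma inv_log_cosh : inv_jet log_cosh_jet.
Proof.
have t2 x : th x ^+ 2 <= 1.
  by have := th_le1 x; rewrite ler_norml => /andP[? ?]; nra.
have e2 x : log_cosh_jet 2 x = 1 - th x ^+ 2 by rewrite /= derivX !hornerE.
split.
- exact: jet_log_cosh.
- by move=> x; rewrite /= hornerX th_le1.
- by move=> x; rewrite e2 subr_ge0.
- by move=> x; rewrite e2 /= hornerX; have := t2 x; lra.
Qed.

Lemma log_cosh_jet_bounded k : exists B, forall x, `|log_cosh_jet k.+1 x| <= B.
Proof.
have [B HB] := (lbm_continuous (der_continuous (is_derive_poly (th_poly k)))).2 1.
by exists B => x; apply: HB; exact: th_le1.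
Qed.

End log_cosh.

Section cdf.
Context {R : realType} (mu : probability (measurableTypeR R) R).
Implicit Types (s t e : R).

Let mfin (i : interval R) : mu [set` i] \is a fin_num.
Proof. exact: fin_num_measure. Qed.

Lemma cdf01_nd : {homo cdf01 mu : s t / s <= t}.
Proof.
move=> s t st; rewrite /cdf01 fine_le// le_measure ?inE//.
by apply: subset_itvl; rewrite bnd_simp.
Qed.

Lemma cdf01_bound t : 0 <= cdf01 mu t <= 1.
Proof.
rewrite /cdf01 fine_ge0//= -lee_fin fineK//.
exact: probability_le1.
Qed.

(** Continuity from above of [mu] along the intervals [[0, t + 1/(n+1)]]. *)
Lemma cdf01_rc t e : 0 < e -> exists2 d, 0 < d & cdf01 mu (t + d) <= cdf01 mu t + e.
Proof.
move=> e0; pose A n : set (measurableTypeR R) := [set` `[0, t + n.+1%:R^-1]].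
have AE : `[0, t]%classic = \bigcap_n A n.
  apply/seteqP; split => x /=; rewrite in_itv/=.
    move=> /andP[x0 xt] n _; rewrite /A/= in_itv/= x0/=.
    by apply: le_trans xt _; rewrite lerDl.
  move=> H; have := H 0%N I; rewrite /A/= in_itv/= => /andP[-> _] /=.
  apply/ler_addgt0Pr => d d0; pose n := Num.truncn d^-1.
  have := H n I; rewrite /A/= in_itv/= => /andP[_ /le_trans]; apply.
  rewrite lerD2l invf_ple ?posrE//.
  have dV : 0 < d^-1 by rewrite invr_gt0.
  by have /andP[_ /ltW] := truncn_itv (ltW dV).
have H : mu (A n) @[n --> \oo] --> mu `[0, t]%classic.
  rewrite AE; apply: nonincreasing_cvg_mu => //.
  - by rewrite ltey_eq /A mfin.
  - by move=> i; exact: measurable_itv.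
  - by rewrite -AE; exact: measurable_itv.
  - move=> n m nm; apply/subsetPset; apply: subset_itvl; rewrite bnd_simp lerD2l.
    by rewrite lef_pV2 ?posrE// ler_nat.
have /fine_cvg : mu (A n) @[n --> \oo] --> (cdf01 mu t)%:E by rewrite /cdf01 fineK.
move=> /cvgrPdist_le /(_ e e0)[N _ /(_ N (leqnn N))] /= h.
exists N.+1%:R^-1; first by rewrite invr_gt0.
by move: h; rewrite ler_norml => /andP[h _]; rewrite -lerBlDl; rewrite /cdf01 in h *; lra.
Qed.

End cdf.

Section clamp.
Context {R : realType}.
Implicit Types (s t : R).

(** Extends data given on [0, 1] by constants, so that continuity and measurability can be stated on
    the whole line. *)
Definition clamp01 t : R := Num.max 0 (Num.min t 1).

Lemma clamp01_itv t : 0 <= clamp01 t <= 1.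
Proof. by rewrite /clamp01 le_max lexx/= ge_max ler01 ge_min lexx orbT. Qed.

Lemma clamp01_id t : 0 <= t <= 1 -> clamp01 t = t.
Proof. by move=> /andP[t0 t1]; rewrite /clamp01 (min_idPl t1) (max_idPr t0). Qed.

Lemma clamp01_nd s t : s <= t -> clamp01 s <= clamp01 t.
Proof. by move=> st; rewrite /clamp01 le_max2// le_min2. Qed.

Lemma clamp01_lip s t : s <= t -> clamp01 t - clamp01 s <= t - s.
Proof.
move=> st; rewrite lerBlDr [clamp01 t]/clamp01 ge_max; apply/andP; split.
  by have /andP[k0 _] := clamp01_itv s; lra.
have : Num.min s 1 <= clamp01 s by rewrite /clamp01 le_max lexx orbT.
by rewrite !minEle; case: (leP s 1) => ?; case: (leP t 1) => ?; lra.
Qed.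

End clamp.

(** * Power series with nonnegative coefficients, and the function [xi] *)

Section power_series.
Context {R : realType}.
Implicit Types (c : R^nat) (z w r : R).

Lemma lip_continuous (f : R -> R) (L : R) :
  (forall s t, s <= t -> `|f t - f s| <= L * (t - s)) -> continuous f.
Proof.
move=> H x; apply/cvgrPdist_le => e e0.
have K0 : 0 < `|L| + 1 by rewrite ltr_wpDl.
have near_x : \forall y \near x, `|x - y| <= e / (`|L| + 1).
  have : (fun y : R => y) y @[y --> x] --> x by exact: cvg_id.
  by move/cvgrPdist_le; apply; rewrite divr_gt0.
near=> y.
have xy : `|x - y| <= e / (`|L| + 1) by near: y.
have {}H s t : `|f t - f s| <= `|L| * `|t - s|.
  wlog st : s t / s <= t.
    move=> W; have [/W//|/ltW/W] := leP s t.
    by rewrite distrC (distrC s).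
  apply: le_trans (H s t st) _; rewrite (ger0_norm (_ : 0 <= t - s)) ?subr_ge0//.
  by rewrite ler_wpM2r ?subr_ge0// ler_norm.
apply: le_trans (H y x) _; move: xy; rewrite ler_pdivlMr// => xy.
by have := normr_ge0 (x - y); lra.
Unshelve. all: by end_near. Qed.

(** Convexity of powers. It bounds [(n+1) z^n] by [w^(n+1) / (w - z)], so the differentiated series
    at [z] is dominated by the original one at a larger [w]. *)
Lemma expr_chord z w n : 0 <= z -> z <= w ->
  n.+1%:R * z ^+ n * (w - z) + z ^+ n.+1 <= w ^+ n.+1.
Proof.
move=> z0 zw; elim: n => [|n IH]; first by rewrite !expr1 expr0; lra.
rewrite (exprS w); apply: le_trans (ler_wpM2l (le_trans z0 zw) IH).
rewrite (exprS z n.+1) (exprS z n) -[in n.+2%:R]natr1.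
have h : 0 <= n.+1%:R * z ^+ n * (w - z) * (w - z).
  by rewrite !mulr_ge0 ?exprn_ge0 ?subr_ge0.
rewrite -subr_ge0; apply: le_trans h _; rewrite le_eqVlt; apply/orP; left; apply/eqP.
by ring.
Qed.

Lemma is_cvg_pseries_diffs c r : (forall n, 0 <= c n) ->
  (forall z, `|z| < r -> cvgn (pseries c z)) ->
  forall z, `|z| < r -> cvgn (pseries (pseries_diffs c) z).
Proof.
move=> c0 H z zr.
pose w := (`|z| + r) / 2.
have zw : `|z| < w by rewrite /w; lra.
have w0 : 0 < w by apply: le_lt_trans zw.
have wz : 0 < w - `|z| by rewrite subr_gt0.
apply: normed_cvg.
apply: (@series_le_cvg _ _ (fun n => (w - `|z|)^-1 * (c n.+1 * w ^+ n.+1))).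
- by move=> n; rewrite normr_ge0.
- by move=> n; rewrite !mulr_ge0 ?invr_ge0 ?exprn_ge0// ltW.
- move=> n; rewrite /= normrM normrX [`|pseries_diffs c n|]ger0_norm ?mulr_ge0//.
  rewrite ler_pdivlMl// /pseries_diffs.
  rewrite [leLHS](_ : _ = c n.+1 * (n.+1%:R * `|z| ^+ n * (w - `|z|))); last by ring.
  apply: ler_wpM2l => //; apply: le_trans (expr_chord n (normr_ge0 z) (ltW zw)).
  by rewrite lerDl exprn_ge0.
apply: is_cvg_seriesZ.
have := H w; rewrite (gtr0_norm w0) => /(_ _)Hw.
have {}Hw : cvgn (pseries c w) by apply: Hw; rewrite /w; lra.
have E : series (fun n => c n.+1 * w ^+ n.+1) = (fun n => pseries c w n.+1 - c 0%N).
  apply/funext => n; rewrite /pseries /series /= big_nat_recl//= expr0 mulr1.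
  by rewrite addrAC subrr add0r.
rewrite E; apply: is_cvgB; last exact: is_cvg_cst.
have : pseries c w @ \oo --> limn (pseries c w) by [].
by rewrite -cvg_shiftS => h; exact: cvgP h.
Qed.

Lemma pseries_diffs_ge0 c : (forall n, 0 <= c n) -> forall n, 0 <= pseries_diffs c n.
Proof. by move=> c0 n; rewrite mulr_ge0. Qed.

Lemma der_pseries c r : (forall n, 0 <= c n) -> (forall z, `|z| < r -> cvgn (pseries c z)) ->
  forall x : R, `|x| < r ->
  is_derive x 1 (fun x => limn (pseries c x)) (limn (pseries (pseries_diffs c) x)).
Proof.
move=> c0 H x xr; pose K := (`|x| + r) / 2.
have K0 : 0 <= K by rewrite /K; have := normr_ge0 x; lra.
have Kr : `|K| < r by rewrite ger0_norm// /K; lra.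
have H1 := is_cvg_pseries_diffs c0 H.
apply: (@pseries_snd_diffs _ c K); [exact: H|exact: H1| |].
- exact: is_cvg_pseries_diffs (pseries_diffs_ge0 c0) H1 _ Kr.
- by rewrite (ger0_norm K0) /K; lra.
Qed.

Lemma pseries_ge0 c z : (forall n, 0 <= c n) -> 0 <= z -> cvgn (pseries c z) ->
  0 <= limn (pseries c z).
Proof.
move=> c0 z0 cv; apply: limr_ge => //; apply: nearW => n.
by apply: sumr_ge0 => i _; rewrite mulr_ge0 ?exprn_ge0.
Qed.

End power_series.

Section xi.
Context {R : realType} (beta : nat -> R).
Implicit Types (s t : R).
Hypothesis xi_fin : exists2 eps : R, 0 < eps &
  (\sum_(1 <= p <oo) (beta p ^+ 2 * (1 + eps) ^+ p)%:E < +oo)%E.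

Let c n : R := if n is 0%N then 0 else beta n ^+ 2.

Let c_ge0 n : 0 <= c n. Proof. by case: n => //= n; exact: sqr_ge0. Qed.

Lemma xiE : xi beta = fun t => limn (pseries c t).
Proof.
apply/funext => t; rewrite /xi (_ : (fun n => \sum_(1 <= p < n) _) = pseries c t)//.
apply/funext => -[|n].
  by rewrite /pseries /series /= !big_geq.
rewrite /pseries /series /= [RHS]big_ltn//= mul0r add0r.
by apply: eq_big_nat => -[|i].
Qed.

Lemma cvg_pseries_xi : exists2 r, 1 < r & forall z, `|z| < r -> cvgn (pseries c z).
Proof.
have [eps eps0 fin] := xi_fin.
exists (1 + eps); first by rewrite ltrDl.
have r0 : 0 < 1 + eps by rewrite addr_gt0.
move=> z zr; apply: (@is_cvg_pseries_inside _ _ (1 + eps)); last by rewrite (gtr0_norm r0).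
apply: nondecreasing_is_cvgn.
  apply/nondecreasing_seqP => n; rewrite /pseries /series /= big_nat_recr//= lerDl.
  by rewrite mulr_ge0 ?exprn_ge0// ltW.
set S := (\big[_/_]_(1 <= p <oo) _)%E in fin.
have S0 n : ((pseries c (1 + eps) n)%:E <= S)%E.
  apply: le_trans (nneseries_lim_ge n _); last first.
    by move=> i _ _; rewrite lee_fin mulr_ge0 ?sqr_ge0 ?exprn_ge0// ltW.
  rewrite /pseries /series /= sumEFin lee_fin; case: n => [|n]; first by rewrite !big_geq.
  rewrite big_ltn//= mul0r add0r le_eqVlt; apply/orP; left; apply/eqP.
  by apply: eq_big_nat => -[|i].
have fS : S \is a fin_num.
  by rewrite ge0_fin_numE// (le_trans _ (S0 0%N))// lee_fin /pseries /series /= big_geq.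
by exists (fine S) => _ [n _ <-]; rewrite -lee_fin fineK.
Qed.

(** [g] and [w] are [xi'] and [xi''] composed with [clamp01], and [L] bounds [xi''] on [0, 1]. The
    clamping may create corners of [g] at 0 and 1, which is why its derivative is asserted only
    inside. *)
Lemma xi_facts : exists g w : R -> R, exists2 L : R, 0 <= L &
  [/\ forall t, 0 <= t <= 1 -> derive1n 2 (xi beta) t = w t,
      continuous w, forall t, 0 <= w t, {homo g : s t / s <= t} &
   [/\ forall s t, s <= t -> g t - g s <= L * (t - s),
       forall t, g 1 - g t <= L,
       forall s t, 0 <= s -> s <= t -> t <= 1 -> RI s t w = g t - g s &
       forall t, 0 < t < 1 -> is_derive t 1 g (w t)]].
Proof.
have [r r1 H0] := cvg_pseries_xi.
pose c1 := pseries_diffs c; pose c2 := pseries_diffs c1; pose c3 := pseries_diffs c2.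
have c10 : forall n, 0 <= c1 n by exact: pseries_diffs_ge0.
have c20 : forall n, 0 <= c2 n by exact: pseries_diffs_ge0.
have H1 := is_cvg_pseries_diffs c_ge0 H0; have H2 := is_cvg_pseries_diffs c10 H1.
pose g0 x := limn (pseries c1 x); pose w0 x := limn (pseries c2 x).
have d0 := der_pseries c_ge0 H0; rewrite -/g0 in d0.
have d1 : forall x : R, `|x| < r -> is_derive x 1 g0 (w0 x) := der_pseries c10 H1.
have d2 := der_pseries c20 H2; rewrite -/w0 in d2.
pose k t : R := clamp01 t.
have kI t : 0 <= k t <= 1 := clamp01_itv t.
have kr t : `|k t| < r.
  by have /andP[k0 k1] := kI t; rewrite ger0_norm// (le_lt_trans k1).
have kE t : 0 <= t <= 1 -> k t = t := @clamp01_id _ t.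
have k_nd s t : s <= t -> k s <= k t := @clamp01_nd _ s t.
have k_lip s t : s <= t -> k t - k s <= t - s := @clamp01_lip _ s t.
have ck : continuous k.
  apply: (@lip_continuous _ _ 1) => s t st.
  by rewrite ger0_norm ?subr_ge0 ?k_nd// mul1r k_lip.
have cw0 x : `|x| < r -> {for x, continuous w0}.
  by move=> xr; apply/differentiable_continuous/derivable1_diffP; have [] := d2 x xr.
pose w t := w0 (k t); pose g t := g0 (k t).
have w_ge0 t : 0 <= w t.
  by have /andP[k0 _] := kI t; apply: pseries_ge0 => //; exact: H2.
have cw : continuous w.
  by move=> t; apply: continuous_comp; [exact: ck|exact: cw0].
have [L HL] := (lbm_continuous cw).2 1.
have L0 : 0 <= L by apply: le_trans (HL 0 _) => //; rewrite normr0.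
have mvt s t : s <= t -> exists2 x, 0 <= x <= 1 & g t - g s = w x * (k t - k s).
  move=> st; have /andP[s0 s1] := kI s; have /andP[t0 t1] := kI t.
  have dk x : k s <= x <= k t -> is_derive x 1 g0 (w0 x).
    move=> /andP[x1 x2]; apply: d1.
    by rewrite (ger0_norm (le_trans s0 x1)) (le_lt_trans x2)// (le_lt_trans t1).
  have [x /andP[x1 x2] E] := MVT_is_derive (k_nd _ _ st) dk.
  exists x; first by rewrite (le_trans s0)//= (le_trans x2).
  by rewrite /g E /w (kE x)// (le_trans s0 x1) (le_trans x2 t1).
have g_lip s t : s <= t -> g t - g s <= L * (t - s).
  move=> st; have [x /andP[x0 x1] ->] := mvt s t st.
  apply: ler_pM => //; first by rewrite subr_ge0 k_nd.
    by apply: le_trans (ler_norm _) _; apply: HL; rewrite ger0_norm.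
  exact: k_lip.
have dg t : 0 < t < 1 -> is_derive t 1 g (w t).
  move=> /andP[t0 t1]; have tr : `|t| < r by rewrite gtr0_norm// (lt_trans t1).
  have [dv dE] := d1 t tr.
  have near_g : \forall x \near t, g0 x = g x.
    near=> x; rewrite /g kE//; apply/andP; split; apply: ltW; near: x.
      exact: lt_nbhsr.
    exact: lt_nbhsl.
  rewrite /w kE ?(ltW t0) ?(ltW t1)//.
  by apply: near_eq_is_derive near_g _; rewrite ?oner_neq0.
have cg : continuous g.
  apply: (@lip_continuous _ _ L) => s t st; rewrite ger0_norm ?g_lip// subr_ge0.
  have [x _ E] := mvt s t st.
  by rewrite -subr_ge0 E mulr_ge0// subr_ge0 k_nd.
exists g, w, L => //; split => //.
- move=> t tI; have tr : `|t| < r by rewrite -(kE t tI).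
  rewrite /w (kE t tI) /= derive1E xiE.
  have near_r : \forall x \near t, `|x| < r.
    have : (fun y : R => `|y|) y @[y --> t] --> `|t| by apply: cvg_norm; exact: cvg_id.
    by move=> h; exact: cvgr_lt h _ tr.
  (* The second derivative of [xi] at [t] depends on the first one near [t]; the radius of
     convergence exceeds 1, so this covers the endpoints too. *)
  have E : \forall x \near t, g0 x = (fun t => limn (pseries c t))^`()%classic x.
    apply: filterS near_r => x xr; rewrite derive1E; apply/esym/derive_val.
    exact: d0.
  have := near_eq_is_derive E (d1 t tr) => h.
  exact: derive_val.
- move=> s t st; have [x _ E] := mvt s t st.
  by rewrite -subr_ge0 E mulr_ge0// subr_ge0 k_nd.
split => //.
- move=> t; have -> : g t = g (k t) by rewrite /g (kE (k t)).
  have /andP[k0 k1] := kI t.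
  by apply: le_trans (g_lip _ _ k1) _; rewrite ler_piMr// gerBl.
- move=> s t s0 st t1; have [->|ne] := eqVneq s t; first by rewrite RI_same subrr.
  have lt : s < t by rewrite lt_neqAle ne.
  have dst x : x \in `]s, t[ -> is_derive x 1 g (w x).
    rewrite in_itv/= => /andP[sx xt]; apply: dg.
    by rewrite (le_lt_trans s0 sx) (lt_le_trans xt t1).
  rewrite /RI /Rintegral (@continuous_FTC2 R w g s t)//.
  + exact: continuous_subspaceT.
  + split; first by move=> x /dst[].
      by apply: cvg_at_right_filter; exact: cg.
    by apply: cvg_at_left_filter; exact: cg.
  + by move=> x /dst dx; rewrite derive1E; exact: derive_val.
Unshelve. all: by end_near. Qed.

End xi.

Lemma lip2_continuous (R : realType) (F : R -> R -> R) (A B : R) : 0 <= A -> 0 <= B ->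
  (forall s t x y, `|F s x - F t y| <= A * `|s - t| + B * `|x - y|) ->
  continuous (fun z : R * R => F z.1 z.2).
Proof.
move=> A0 B0 H [t x]; apply/cvgrPdist_le => e e0.
have K0 : 0 < A + B + 1 by rewrite ltr_wpDl// addr_ge0.
have d0 : 0 < e / (A + B + 1) by rewrite divr_gt0.
have : \forall z \near (t, x), ball (t, x) (e / (A + B + 1)) z by exact: nbhsx_ballx.
apply: filterS => -[s y] [/= h1 h2].
rewrite /ball/= in h1 h2.
apply: le_trans (H _ _ _ _) _.
apply: (@le_trans _ _ (A * (e / (A + B + 1)) + B * (e / (A + B + 1)))).
  by apply: lerD; apply: ler_wpM2l => //; exact: ltW.
rewrite -mulrDl mulrA ler_pdivrMr// mulrC ler_wpM2l//; first exact: ltW.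
by rewrite lerDl.
Qed.

Lemma continuous_pairl (R : realType) (F : R -> R -> R) t :
  continuous (fun z : R * R => F z.1 z.2) -> continuous (F t).
Proof.
move=> cF x; apply: continuous2_cvg; [exact: (cF (t, x))| |].
  exact: cvg_cst.
exact: cvg_id.
Qed.

Lemma continuous_pairr (R : realType) (F : R -> R -> R) x :
  continuous (fun z : R * R => F z.1 z.2) -> continuous (F ^~ x).
Proof.
move=> cF t; apply: continuous2_cvg; [exact: (cF (t, x))| |].
  exact: cvg_id.
exact: cvg_cst.
Qed.

(** * The limit of the scheme is a weak solution *)

Section solution.
Context {R : realType}.
Variables (alpha g w : R -> R) (L : R) (f0 : nat -> R -> R).
Implicit Types (s t x y : R).
Hypothesis alpha_nd : {homo alpha : s t / s <= t}.
Hypothesis alpha01 : forall t, 0 <= alpha t <= 1.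
Hypothesis alpha_rc : forall t e, 0 < e -> exists2 d, 0 < d & alpha (t + d) <= alpha t + e.
Hypothesis L0 : 0 <= L.
Hypothesis g_nd : {homo g : s t / s <= t}.
Hypothesis g_lip : forall s t, s <= t -> g t - g s <= L * (t - s).
Hypothesis g_bd : forall t, g 1 - g t <= L.
Hypothesis w_cont : continuous w.
Hypothesis w_ge0 : forall t, 0 <= w t.
Hypothesis RI_w : forall s t, 0 <= s -> s <= t -> t <= 1 -> RI s t w = g t - g s.
Hypothesis der_g : forall t, 0 < t < 1 -> is_derive t 1 g (w t).
Hypothesis if0 : inv_jet f0.
Hypothesis bf0 : forall k, exists B, forall x, `|f0 k.+1 x| <= B.

Definition U k t x := usol alpha g f0 k (clamp01 t) x.

Let cl1 t : clamp01 t <= 1. Proof. by have /andP[] := clamp01_itv t. Qed.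

Lemma jet_U t : jet (fun k => U k t).
Proof. exact: (jet_usol alpha_nd alpha01 L0 g_nd g_lip g_bd if0 bf0 (cl1 t)). Qed.

Lemma U1_le t x : `|U 1 t x| <= 1.
Proof. exact: (usol1_le alpha_nd alpha01 L0 g_nd g_lip g_bd if0 bf0). Qed.

Lemma U_bounded k : exists M, forall t x, `|U k.+1 t x| <= M.
Proof.
have [M HM] := usol_bounded alpha_nd alpha01 L0 g_nd g_lip g_bd if0 bf0 k.
by exists M => t x; exact: HM.
Qed.

Lemma U_lip k : exists2 C, 0 <= C & forall s t x, `|U k s x - U k t x| <= C * `|t - s|.
Proof.
have [C [C0 HC]] := usol_lip alpha_nd alpha01 L0 g_nd g_lip g_bd if0 bf0 k.
exists C => // s t x; wlog st : s t / s <= t.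
  by move=> W; have [/W//|/ltW/W] := leP s t; rewrite distrC (distrC s).
apply: le_trans (HC _ _ _ (clamp01_nd st) (cl1 t)) _.
by rewrite ger0_norm ?subr_ge0// ler_wpM2l// clamp01_lip.
Qed.

Lemma U_continuous k : continuous (fun z : R * R => U k z.1 z.2).
Proof.
have [C C0 HC] := U_lip k; have [M HM] := U_bounded k.
have M0 : 0 <= M by apply: le_trans (HM 0 0).
apply: (lip2_continuous C0 M0) => s t x y.
rewrite (_ : _ - _ = (U k s x - U k t x) + (U k t x - U k t y)); last by ring.
apply: le_trans (ler_normD _ _) _; apply: lerD; first by rewrite (distrC s).
exact: lipschitz_is_derive (jet_U t k) (HM t).
Qed.

Lemma U_at1 k x : U k 1 x = f0 k x.
Proof.
rewrite /U clamp01_id ?ler01 ?lexx// /usol.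
rewrite (_ : (fun n => _) = (fun=> f0 k x)) ?lim_cst//.
apply/funext => n; rewrite /idx subrr mul0r.
by rewrite (_ : Num.truncn 0 = 0%N)//; exact: truncn0.
Qed.

Definition src t x := U 2 t x + alpha t * U 1 t x ^+ 2.

Lemma U_expansion : exists2 C, 0 <= C & forall s t x, 0 <= s -> s <= t -> t <= 1 ->
  `|U 0 s x - U 0 t x - (g t - g s) / 2 * src t x|
   <= C * (t - s) * ((t - s) + (alpha t - alpha s)).
Proof.
have [C [C0 HC]] := usol_expansion alpha_nd alpha01 alpha_rc L0 g_nd g_lip g_bd if0 bf0.
exists C => // s t x s0 st t1.
have := HC s t x st t1; rewrite /src /U /source !clamp01_id//.
- by rewrite (le_trans s0 st).
- by rewrite s0 (le_trans st t1).
Qed.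

Lemma src_lip : exists2 C, 0 <= C & forall s t x,
  `|src s x - src t x| <= C * `|t - s| + `|alpha t - alpha s|.
Proof.
have [C1 C10 H1] := U_lip 1; have [C2 C20 H2] := U_lip 2.
exists (C2 + 2 * C1); first by rewrite addr_ge0// mulr_ge0.
move=> s t x.
rewrite (_ : _ - _ = (U 2 s x - U 2 t x) + (alpha s * ((U 1 s x - U 1 t x) * (U 1 s x + U 1 t x)) +
   (alpha s - alpha t) * U 1 t x ^+ 2)); last by rewrite /src; ring.
apply: le_trans (ler_normD _ _) _; rewrite [in leRHS]mulrDl -addrA; apply: lerD => //.
apply: le_trans (ler_normD _ _) _; apply: lerD.
  have /andP[a0 a1] := alpha01 s.
  rewrite normrM (ger0_norm a0) -[leRHS]mul1r; apply: ler_pM => //.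
  rewrite normrM -mulrA mulrC; apply: ler_pM => //.
  by apply: le_trans (ler_normD _ _) _; have := U1_le s x; have := U1_le t x; lra.
rewrite normrM -[leRHS]mulr1 distrC; apply: ler_pM => //.
by rewrite normrX; apply: exprn_ile1 => //; exact: U1_le.
Qed.

Lemma lbm_alpha : lbm alpha.
Proof.
split; first exact: nondecreasing_measurable.
by move=> N; exists 1 => x _; have /andP[a0 a1] := alpha01 x; rewrite ger0_norm.
Qed.

Lemma lbm2_U k : lbm2 (U k).
Proof. by apply: lbm2_continuous; exact: U_continuous. Qed.

Lemma lbm2_src : lbm2 src.
Proof.
apply: lbm2D; first exact: lbm2_U.
apply: lbm2M; first by apply: lbm2_fst; exact: lbm_alpha.
by apply: lbm2M; exact: lbm2_U.
Qed.

Lemma lbm_w : lbm w. Proof. exact: lbm_continuous. Qed.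

(** The value that the equation prescribes for the time derivative of [U 0]. *)
Definition rate t x := - (w t / 2 * src t x).

Lemma lbm2_rate : lbm2 rate.
Proof.
apply: lbm2N; apply: lbm2M; last exact: lbm2_src.
apply: (lbm2_fst (f := fun t => w t / 2)); apply: lbmM; [exact: lbm_w|exact: lbm_cst].
Qed.

(** [U 0] minus the integral of [rate] changes over [[s, t]] by at most a constant times
    [(t - s) ((t - s) + alpha t - alpha s)]; [telescoping], applied to this function and to its
    opposite, makes it constant. *)
Lemma prim_U x : prim (rate ^~ x) (U 0 ^~ x).
Proof.
have [C C0 HC] := U_expansion; have [D D0 HD] := src_lip.
have [W HW] := lbm_w.2 1.
have W0 : 0 <= W by apply: le_trans (HW 0 _) => //; rewrite normr0.
have lr : lbm (rate ^~ x) by exact: lbm2_sectr lbm2_rate.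
have E s t : 0 <= s -> s <= t -> t <= 1 ->
   `|(U 0 t x - RI 0 t (rate ^~ x)) - (U 0 s x - RI 0 s (rate ^~ x))| <=
   (C + W * (D + 1)) * (t - s) * ((t - s) + (alpha t - alpha s)).
  move=> s0 st t1.
  have a0 : 0 <= alpha t - alpha s by rewrite subr_ge0 alpha_nd.
  have ts0 : 0 <= t - s by rewrite subr_ge0.
  have lK : lbm (fun r => (w r * (- (src t x) / 2))) by apply: lbmM; [exact: lbm_w|exact: lbm_cst].
  rewrite (RI_split lr s0 st).
  (* With [src] frozen at time [t] the factor [w] integrates exactly to the increment of [g],
     matching the main term of [U_expansion]. *)
  have e1 : RI s t (rate ^~ x) = RI s t (fun r => rate r x - w r * (- (src t x) / 2)) + (g t - g s) * (- (src t x) / 2).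
    rewrite RI_B// -[X in _ = _ + X]mulrC -RI_w// -RI_Z; last exact: lbm_w.
    by rewrite -[LHS]addr0 -addrA; congr (_ + _); rewrite (_ : (fun r => _ * w r) = (fun r => w r * (- src t x / 2))) ?addNr//; apply/funext => r; rewrite mulrC.
  rewrite e1 (_ : _ - _ = - ((U 0 s x - U 0 t x - (g t - g s) / 2 * src t x) +
     RI s t (fun r => rate r x - w r * (- (src t x) / 2)))); last by field.
  rewrite normrN; apply: le_trans (ler_normD _ _) _.
  rewrite [in leRHS]mulrDl [in leRHS]mulrDl; apply: lerD; first exact: HC.
  rewrite [leRHS](_ : _ = W * (D + 1) * ((t - s) + (alpha t - alpha s)) * (t - s)); last by ring.
  apply: RI_norm_ub => //; first exact: lbmB.
  move=> r /andP[sr rt].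
  rewrite (_ : _ - _ = w r / 2 * (src t x - src r x)); last by rewrite /rate; field.
  rewrite normrM -mulrA; apply: ler_pM => //.
    rewrite normrM [`|2^-1|]ger0_norm//; apply: le_trans (_ : _ <= `|w r|) _.
      by rewrite ler_piMr// invf_le1// ler1n.
    by apply: HW; rewrite ger0_norm; lra.
  apply: le_trans (HD _ _ _) _.
  have ar : alpha r <= alpha t by exact: alpha_nd.
  have as_ : alpha s <= alpha r by exact: alpha_nd.
  rewrite distrC ger0_norm ?subr_ge0// distrC ger0_norm ?subr_ge0//.
  have : D * (t - r) <= D * (t - s) by rewrite ler_wpM2l// lerB.
  have : 0 <= D * (alpha t - alpha s) by rewrite mulr_ge0.
  lra.
have C0' : 0 <= C + W * (D + 1) by rewrite addr_ge0// mulr_ge0// addr_ge0.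
move=> s t s0 st t1.
have T1 : U 0 s x - RI 0 s (rate ^~ x) <= U 0 t x - RI 0 t (rate ^~ x).
  apply: (telescoping (G := fun t => U 0 t x - RI 0 t (rate ^~ x)) C0' alpha_nd) => // p q p0 pq q1.
  by have := E p q p0 pq q1; rewrite distrC => /(le_trans (ler_norm _)).
have T2 : - (U 0 s x - RI 0 s (rate ^~ x)) <= - (U 0 t x - RI 0 t (rate ^~ x)).
  apply: (telescoping (G := fun t => - (U 0 t x - RI 0 t (rate ^~ x))) C0' alpha_nd) => // p q p0 pq q1.
  by have := E p q p0 pq q1 => /(le_trans (ler_norm _)); lra.
rewrite (RI_split lr s0 st) in T1 T2; lra.
Qed.

(** The expansion compares [U 0] with an affine function of [g], which is differentiable; the
    remainder [e] is O(|s - t| (|s - t| + |alpha s - alpha t|)), hence o(|s - t|) exactly by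
    continuity of [alpha] at [t]. *)
Lemma derivable_U t x : 0 < t < 1 -> {for t, continuous alpha} -> derivable (U 0 ^~ x) t 1.
Proof.
move=> tI ca; have [C C0 HC] := U_expansion; have [D D0 HD] := src_lip.
have /andP[t0 t1] := tI.
pose e s := U 0 s x - U 0 t x + (g s - g t) / 2 * src t x.
have eP s : 0 <= s <= 1 ->
    `|e s| <= `|s - t| * ((C + L * (D + 1)) * (`|s - t| + `|alpha s - alpha t|)).
  move=> /andP[s0 s1]; have [st|/ltW ts] := leP s t.
    have h := HC s t x s0 st (ltW t1).
    have E : U 0 s x - U 0 t x - (g t - g s) / 2 * src t x = e s by rewrite /e; ring.
    rewrite E in h; apply: le_trans h _.
    rewrite [`|s - t|]distrC [`|alpha s - _|]distrC !ger0_norm ?subr_ge0//; last exact: alpha_nd.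
    rewrite -mulrA mulrCA; apply: ler_wpM2l; first by rewrite subr_ge0.
    apply: ler_wpM2r; first by rewrite addr_ge0// subr_ge0// alpha_nd.
    by rewrite lerDl mulr_ge0// addr_ge0.
  (* For [s > t] the expansion is based at the later time [s]; [src_lip] moves the source back to
     [t]. *)
  have h := HC t s x (ltW t0) ts s1.
  rewrite (_ : e s = - (U 0 t x - U 0 s x - (g s - g t) / 2 * src s x) - (g s - g t) / 2 * (src s x - src t x)); last by rewrite /e; ring.
  apply: le_trans (ler_normB _ _) _; rewrite normrN.
  rewrite [`|s - t|]ger0_norm ?subr_ge0// [`|alpha s - _|]ger0_norm ?subr_ge0 ?alpha_nd//.
  rewrite [leRHS](_ : _ = C * (s - t) * (s - t + (alpha s - alpha t)) +
    (L * (s - t)) * ((D + 1) * (s - t + (alpha s - alpha t)))); last by ring.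
  apply: lerD => //.
  have g0 : 0 <= g s - g t by rewrite subr_ge0 g_nd.
  rewrite normrM ger0_norm ?divr_ge0//.
  apply: ler_pM => //; first by rewrite divr_ge0.
    by have := g_lip ts; lra.
  apply: le_trans (HD _ _ _) _.
  rewrite [`|t - s|]distrC [`|alpha t - _|]distrC !ger0_norm ?subr_ge0 ?alpha_nd//.
  have : 0 <= D * (alpha s - alpha t) by rewrite mulr_ge0 ?subr_ge0 ?alpha_nd.
  by lra.
have K0 : 0 < C + L * (D + 1) + 1 by rewrite ltr_wpDl// addr_ge0// mulr_ge0// addr_ge0.
have de : is_derive t 1 e 0.
  have lim : h^-1 *: (e (h *: 1 + t) - e t) @[h --> (0 : R)^'] --> (0 : R).
    apply/cvgrPdist_le => d d0.
    have d1 : 0 < d / 2 / (C + L * (D + 1) + 1) by rewrite !divr_gt0.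
    have ca' : alpha (h + t) @[h --> (0 : R)] --> alpha t.
      apply: (@cvg_comp _ _ _ (fun h : R => h + t) alpha _ (nbhs t)); last exact: ca.
      rewrite -{2}(add0r t).
      by apply: (@cvgD _ _ _ _ _ id (fun=> t)); [exact: cvg_id|exact: cvg_cst].
    near=> h.
    have h0 : h != 0 by near: h; exact: nbhs_dnbhs_neq.
    have hd : `|h| <= d / 2 / (C + L * (D + 1) + 1) by near: h; exact: dnbhs0_le.
    have ht : `|h| <= Num.min t (1 - t).
      by near: h; apply: dnbhs0_le; rewrite lt_min t0 subr_gt0.
    have ha : `|alpha t - alpha (h + t)| <= d / 2 / (C + L * (D + 1) + 1).
      by near: h; apply: nbhs_dnbhs; move/cvgrPdist_le: ca'; apply.
    have e0 : e t = 0 by rewrite /e !subrr !mul0r addr0.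
    rewrite e0 subr0 sub0r normrN -[h *: 1]/(h * 1) mulr1 -[_ *: _]/(_ * _).
    rewrite normrM normfV ler_pdivrMl ?normr_gt0//.
    have htI : 0 <= h + t <= 1.
      move: ht; rewrite le_min => /andP[/ler_normlP[h1 h2] /ler_normlP[h3 h4]].
      by apply/andP; split; lra.
    apply: le_trans (eP _ htI) _; rewrite addrK; apply: ler_wpM2l => //.
    rewrite (distrC (alpha (h + t))).
    apply: (@le_trans _ _ ((C + L * (D + 1) + 1) * (d / 2 / (C + L * (D + 1) + 1) + d / 2 / (C + L * (D + 1) + 1)))).
      apply: ler_pM; [by rewrite addr_ge0// mulr_ge0// addr_ge0|by rewrite addr_ge0| |exact: lerD].
      by rewrite lerDl.
    by rewrite le_eqVlt; apply/orP; left; apply/eqP; field; rewrite gt_eqF.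
  have dd : derivable e t 1 by apply/cvg_ex; exists 0.
  by split => //; exact: cvg_lim lim.
have dU := derB (derD de (der_cst (U 0 t x) t)) (derM (derZ 2^-1 (derB (der_g tI) (der_cst (g t) t))) (der_cst (src t x) t)).
have [dv _] := dU.
rewrite (_ : U 0 ^~ x = (fun y => e y + U 0 t x - 2^-1 * (g y - g t) * src t x))//.
by apply/funext => s; rewrite /e; field.
Unshelve. all: by end_near. Qed.

Lemma smooth_U t : smooth1 (U 0 t).
Proof.
have E n : derive1n n (U 0 t) = U n t.
  elim: n => //= n ->; apply/funext => x; rewrite derive1E.
  by apply: derive_val; exact: (jet_U t n x).
by move=> n x; rewrite E; have [] := jet_U t n x.
Qed.

End solution.

(** * Supports of test functions *)

Section test_functions.
Context {R : realType}.
Implicit Types (phi : R -> R -> R) (s t x : R).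
Notation leb := (@lebesgue_measure R).

Lemma Rintegral_supp f B : (forall x, B < `|x| -> f x = 0) ->
  \int[leb]_x f x = RI (- B) B f.
Proof.
move=> f0; rewrite /RI [RHS]Rintegral_mkcond; apply: eq_Rintegral => x _.
rewrite patchE; case: ifPn => //; rewrite notin_setE /= in_itv/= => xB.
by apply: f0; rewrite ltNge ler_norml; apply/negP.
Qed.

Lemma smooth2_facts phi : smooth2 phi ->
  [/\ [/\ continuous (fun z : R * R => phi z.1 z.2),
          continuous (fun z : R * R => partial_t phi z.1 z.2),
          continuous (fun z : R * R => partial_x phi z.1 z.2) &
          continuous (fun z : R * R => partial_x (partial_x phi) z.1 z.2)],
      forall t x, is_derive t 1 (phi ^~ x) (partial_t phi t x),
      forall t x, is_derive x 1 (phi t) (partial_x phi t x) &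
      forall t x, is_derive x 1 (partial_x phi t) (partial_x (partial_x phi) t x)].
Proof.
move=> /(_ 2)[c0 [dt dx [ct _] [cx [_ dxx _ [cxx _]]]]].
split; first by split; [exact: c0|exact: ct|exact: cx|exact: cxx].
- by move=> t x; rewrite /partial_t derive1E; apply: derivableP; exact: dt.
- by move=> t x; rewrite /partial_x derive1E; apply: derivableP; exact: dx.
- by move=> t x; rewrite [X in is_derive _ _ _ X]/partial_x derive1E; apply: derivableP; exact: dxx.
Qed.

(** The support conditions speak of times in the open interval; this carries their consequences to
    the endpoints. *)
Lemma vanish_at_boundary (f : R -> R) t d : continuous f -> 0 <= t <= 1 -> 0 < d ->
  (forall s, 0 < s < 1 -> `|s - t| < d -> f s = 0) -> f t = 0.
Proof.
move=> cf /andP[t0 t1] d0 H; apply/eqP; rewrite -normr_le0; apply/ler_addgt0Pl => e e0.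
rewrite addr0.
have near_t : \forall s \near t, `|f t - f s| <= e.
  by have := cf t => /cvgrPdist_le; apply.
have [r /= r0 Hr] := (nbhs_ballP _ _).1 near_t.
pose a := Num.min (d / 2) (Num.min (r / 2) (1 / 2)).
have a0 : 0 < a by rewrite !lt_min !divr_gt0.
have [ad [ar a1]] : a <= d / 2 /\ a <= r / 2 /\ a <= 1 / 2.
  by rewrite !ge_min !lexx ?orbT.
(* Moving from [t] towards 1/2 enters the open interval from either endpoint. *)
pose s := t + a * (1 / 2 - t).
have sI : 0 < s < 1 by rewrite /s; apply/andP; split; nra.
have st : `|s - t| <= a.
  rewrite /s addrAC subrr add0r normrM (gtr0_norm a0); apply: ler_piMr; first exact: ltW.
  by rewrite ler_norml; apply/andP; split; lra.
have /= := Hr s _; rewrite (H s sI) ?subr0; last by lra.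
by apply; rewrite /ball/= distrC; lra.
Qed.

(** Compactness of the support bounds it in [x]. As the support is closed and contained in [D], it
    also keeps away from each point [(0, x)], which forces [phi] to vanish at time 0. *)
Lemma test_support (D : set (R * R)) phi :
  (forall t x, 0 < t < 1 -> D (t, x)) -> (forall x, ~ D (0, x)) ->
  continuous (fun z : R * R => phi z.1 z.2) -> test_function D phi ->
  exists2 B, 0 < B & (forall t x, 0 <= t <= 1 -> B < `|x| -> phi t x = 0) /\
    forall x, phi 0 x = 0.
Proof.
move=> D1 D0 cphi [_ cK KD].
set K := closure _ in cK KD.
have inK t x : 0 < t < 1 -> ~ K (t, x) -> phi t x = 0.
  move=> tI nK; apply/eqP; apply: contra_notT nK => p0.
  by apply: subset_closure; split => //; exact: D1.
have [B0 [_ HB]] := compact_bounded cK.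
pose B := `|B0| + 1.
have B0B : B0 < B by rewrite /B (le_lt_trans (ler_norm _))// ltrDl.
have KB t x : K (t, x) -> `|x| <= B.
  move=> Kx; have /= := HB B B0B (t, x) Kx.
  by rewrite prod_normE /= ge_max => /andP[].
exists B; first by rewrite /B ltr_wpDl.
split.
  move=> t x tI xB; apply: (@vanish_at_boundary (phi ^~ x) t 1) => //.
    exact: continuous_pairr.
  move=> s sI _; apply: inK => // /KB; rewrite leNgt => /negP; exact.
move=> x; have nK : (~` K) (0, x) by move=> /KD; exact: D0.
have oK : open (~` K) by apply: closed_openC; exact: closed_closure.
have /nbhs_ballP[e /= e0 He] : nbhs (0, x) (~` K) by exact: open_nbhs_nbhs.
apply: (@vanish_at_boundary (phi ^~ x) 0 e) => //.
- exact: continuous_pairr.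
- by rewrite lexx ler01.
move=> s sI se; apply: inK => //; apply: He; split; rewrite /ball/=.
  by rewrite distrC.
by rewrite subrr normr0.
Qed.

Lemma partial_x_supp phi B t : (forall x, B < `|x| -> phi t x = 0) ->
  forall x, B < `|x| -> partial_x phi t x = 0.
Proof.
move=> H x xB; rewrite /partial_x derive1E.
have nx : \forall y \near x, (fun=> 0) y = phi t y.
  have : (fun y : R => `|y|) y @[y --> x] --> `|x| by apply: cvg_norm; exact: cvg_id.
  move=> /cvgr_gt /(_ B xB); apply: filterS => y yB; by rewrite H.
have := near_eq_is_derive nx (der_cst 0 x) => h.
exact: derive_val.
Qed.

End test_functions.

Section weak_solution.
Context {R : realType}.
Variables (alpha g w : R -> R) (L : R).
Implicit Types (s t x y : R) (phi : R -> R -> R).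
Notation leb := (@lebesgue_measure R).
Hypothesis alpha_nd : {homo alpha : s t / s <= t}.
Hypothesis alpha01 : forall t, 0 <= alpha t <= 1.
Hypothesis alpha_rc : forall t e, 0 < e -> exists2 d, 0 < d & alpha (t + d) <= alpha t + e.
Hypothesis L0 : 0 <= L.
Hypothesis g_nd : {homo g : s t / s <= t}.
Hypothesis g_lip : forall s t, s <= t -> g t - g s <= L * (t - s).
Hypothesis g_bd : forall t, g 1 - g t <= L.
Hypothesis w_cont : continuous w.
Hypothesis w_ge0 : forall t, 0 <= w t.
Hypothesis RI_w : forall s t, 0 <= s -> s <= t -> t <= 1 -> RI s t w = g t - g s.

Local Notation f0 := (@log_cosh_jet R).
Local Notation U := (U alpha g f0).
Let if0 := @inv_log_cosh R.
Let bf0 := @log_cosh_jet_bounded R.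
Let jU t : jet (fun k => U k t) := jet_U alpha_nd alpha01 L0 g_nd g_lip g_bd if0 bf0 t.
Let cU k : continuous (fun z : R * R => U k z.1 z.2) :=
  @U_continuous _ _ _ _ _ alpha_nd alpha01 L0 g_nd g_lip g_bd if0 bf0 k.

Let cUx k t : continuous (U k t).
Proof. exact: (@continuous_pairl _ (U k) t (@cU k)). Qed.

(** The segment extends 1 beyond [B] because [G] is known to vanish only where [B < |x|], and the
    boundary terms must lie there. *)
Lemma RI_parts_supp (F G f h : R -> R) B : 0 < B -> continuous f -> continuous h ->
  (forall x, is_derive x 1 F (f x)) -> (forall x, is_derive x 1 G (h x)) ->
  (forall x, B < `|x| -> G x = 0) ->
  RI (- (B + 1)) (B + 1) (fun x => F x * h x) = - RI (- (B + 1)) (B + 1) (fun x => f x * G x).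
Proof.
move=> B0 cf ch dF dG G0.
rewrite (RI_parts _ cf ch dF dG); last lra.
rewrite !G0 ?mulr0 ?subrr ?sub0r// ?normrN ger0_norm ?ltrDl//; lra.
Qed.

Lemma U_weak_partial_x : weak_partial_x (U 0) (U 1).
Proof.
move=> phi tphi; have [sphi _ _] := tphi.
have [[cphi _ cdphi _] _ dphi _] := smooth2_facts sphi.
have [||B B0 [Hphi _]] := test_support _ _ cphi tphi.
- by move=> t x tI; split; rewrite //= in_itv.
- by move=> x [/=]; rewrite in_itv/= ltxx.
have Bn x : B + 1 < `|x| -> B < `|x| by apply: lt_trans; rewrite ltrDl.
have l2 : lbm2 (fun t x => U 1 t x * phi t x).
  by apply: lbm2M; apply: lbm2_continuous; [exact: cU|exact: cphi].
have BB : - (B + 1) <= B + 1 by lra.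
have E1 t : 0 <= t <= 1 ->
    \int[leb]_x (U 1 t x * phi t x) = RI (- (B + 1)) (B + 1) (fun x => U 1 t x * phi t x).
  by move=> tI; apply: Rintegral_supp => x /Bn xB; rewrite Hphi// mulr0.
have E2 t : 0 <= t <= 1 ->
    \int[leb]_x (U 0 t x * partial_x phi t x) = - RI (- (B + 1)) (B + 1) (fun x => U 1 t x * phi t x).
  move=> tI; have phi0 x : B < `|x| -> phi t x = 0 by exact: Hphi.
  rewrite (@Rintegral_supp _ _ (B + 1)); last first.
    by move=> x /Bn xB; rewrite (partial_x_supp phi0)// mulr0.
  apply: (@RI_parts_supp (U 0 t) (phi t) (U 1 t) (partial_x phi t) B) => //.
  - exact: (@continuous_pairl _ (partial_x phi) t cdphi).
  - exact: jU.
rewrite -[LHS]/(RI 0 1 _) -[in RHS]/(RI 0 1 _) (eq_RI E2) (eq_RI E1) RI_N//.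
exact: lbm_RI.
Qed.

Lemma U1_ess_bounded : ess_bounded (U 1).
Proof.
have [m _] := lbm2_U alpha_nd alpha01 L0 g_nd g_lip g_bd if0 bf0 1.
split.
  apply: measurable_funS m => //.
exists 1; apply: aeW => -[t x] _ /=.
exact: (U1_le alpha_nd alpha01 L0 g_nd g_lip g_bd if0 bf0).
Qed.

Let lbm2c (F : R -> R -> R) : continuous (fun z : R * R => F z.1 z.2) -> lbm2 F.
Proof. exact: lbm2_continuous. Qed.

(** Two integrations by parts in [x] turn the inner integral into minus that of
    [rate * phi + U 0 * partial_t phi]. After Fubini, [primM] integrates this in time at fixed [x];
    as [phi] vanishes at time 0, only the terminal term is left. *)
Lemma U_weak_equation phi : test_function (`]0, 1] `*` setT) phi ->
  0 = \int[leb]_(t in `[0, 1]) (\int[leb]_x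
        (- U 0 t x * partial_t phi t x +
         w t / 2 * (U 0 t x * partial_x (partial_x phi) t x +
                    alpha t * U 1 t x ^+ 2 * phi t x)))
      + \int[leb]_x (phi 1 x * log_cosh x).
Proof.
move=> tphi; have [sphi _ _] := tphi.
have [[cphi ctphi cxphi cxxphi] dt dx dxx] := smooth2_facts sphi.
have [||B B0 [Hphi phi0]] := test_support _ _ cphi tphi.
- by move=> t x /andP[t0 t1]; split; rewrite //= in_itv/= t0 ltW.
- by move=> x [/=]; rewrite in_itv/= ltxx.
have Bn x : B + 1 < `|x| -> B < `|x| by apply: lt_trans; rewrite ltrDl.
have BB : - (B + 1) <= B + 1 by lra.
pose b := B + 1.
have lrate : lbm2 (rate alpha g w f0) := lbm2_rate alpha_nd alpha01 L0 g_nd g_lip g_bd w_cont if0 bf0.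
pose A t x := rate alpha g w f0 t x * phi t x + U 0 t x * partial_t phi t x.
have lA : lbm2 A.
  by apply: lbm2D; apply: lbm2M => //; apply: lbm2c => //; exact: cU.
(* At times 0 and 1 the derivative sees values outside [0, 1], about which nothing is known, so it
   is obtained by continuity from inside. *)
have ptphi t x : 0 <= t <= 1 -> B < `|x| -> partial_t phi t x = 0.
  move=> tI xB.
  apply: (@vanish_at_boundary _ (partial_t phi ^~ x) t 1) => //.
    exact: (@continuous_pairr _ (partial_t phi) x).
  move=> s /andP[s0 s1] _; rewrite /partial_t derive1E.
  have ns : \forall r \near s, (fun=> 0) r = phi r x.
    near=> r; rewrite Hphi//; apply/andP; split; apply: ltW; near: r.
      exact: lt_nbhsr.
    exact: lt_nbhsl.
  have := near_eq_is_derive ns (der_cst 0 s) => h.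
  exact: derive_val.
have inner t : 0 <= t <= 1 -> \int[leb]_x
        (- U 0 t x * partial_t phi t x +
         w t / 2 * (U 0 t x * partial_x (partial_x phi) t x +
                    alpha t * U 1 t x ^+ 2 * phi t x)) = - RI (- b) b (A t).
  move=> tI; have pt0 x : B < `|x| -> phi t x = 0 by exact: Hphi.
  have px0 := partial_x_supp pt0; have pxx0 := partial_x_supp px0.
  rewrite (@Rintegral_supp _ _ b); last first.
    by move=> x /Bn xB; rewrite pt0// pxx0// ptphi//; ring.
  have lU k : lbm (U k t) by apply: lbm_continuous; exact: cUx.
  have lp : lbm (phi t) by apply: lbm_continuous; exact: continuous_pairl.
  have lpt : lbm (partial_t phi t).
    by apply: lbm_continuous; exact: (@continuous_pairl _ (partial_t phi)).
  have lpxx : lbm (partial_x (partial_x phi) t).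
    by apply: lbm_continuous; exact: (@continuous_pairl _ (partial_x (partial_x phi))).
  have IBP : RI (- b) b (fun x => U 0 t x * partial_x (partial_x phi) t x) =
             RI (- b) b (fun x => U 2 t x * phi t x).
    transitivity (- RI (- b) b (fun x => U 1 t x * partial_x phi t x)).
      apply: (@RI_parts_supp (U 0 t) (partial_x phi t) (U 1 t) _ B) => //.
      - exact: (@continuous_pairl _ (partial_x (partial_x phi))).
      - exact: jU.
    rewrite -[RHS]opprK; congr (- _).
    apply: (@RI_parts_supp (U 1 t) (phi t) (U 2 t) (partial_x phi t) B) => //.
    - exact: (@continuous_pairl _ (partial_x phi)).
    - exact: jU.
  have l1 : lbm (fun x => - U 0 t x * partial_t phi t x) by apply: lbmM => //; exact: lbmN.
  have l2 : lbm (fun x => U 0 t x * partial_x (partial_x phi) t x) by exact: lbmM.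
  have l3 : lbm (fun x => alpha t * U 1 t x ^+ 2 * phi t x).
    by apply: lbmM => //; apply: lbmZ; apply: lbmM.
  have l4 : lbm (fun x => U 2 t x * phi t x) by exact: lbmM.
  rewrite RI_D//; last by apply: lbmZ; exact: lbmD.
  rewrite RI_Z; last exact: lbmD.
  rewrite RI_D// IBP -RI_D// -RI_Z; last exact: lbmD.
  rewrite -RI_D//; last by apply: lbmZ; exact: lbmD.
  rewrite -RI_N; last exact: lbm2_sectl lA.
  by apply: eq_RI => x _; rewrite /A /rate /src; ring.
rewrite -[X in X + _]/(RI 0 1 _) (eq_RI inner) RI_N; last exact: lbm_RI.
rewrite RI_Fubini//.
have P x : RI 0 1 (A ^~ x) = log_cosh x * phi 1 x.
  have lphi : lbm (phi ^~ x) by apply: lbm_continuous; exact: continuous_pairr.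
  have lU : lbm (U 0 ^~ x) by apply: lbm_continuous; exact: (@continuous_pairr _ (U 0) x (@cU 0%N)).
  have lt : lbm (partial_t phi ^~ x).
    by apply: lbm_continuous; exact: (@continuous_pairr _ (partial_t phi)).
  have pphi : prim (partial_t phi ^~ x) (phi ^~ x).
    move=> s t _ st _; rewrite (RI_FTC st _ (fun t => dt t x))//.
    exact: (@continuous_pairr _ (partial_t phi)).
  have pU := prim_U alpha_nd alpha01 alpha_rc L0 g_nd g_lip g_bd w_cont RI_w if0 bf0 x.
  have /(_ 0 1) <- := primM (lbm2_sectr x lrate) lt lU lphi pU pphi => //.
  by rewrite phi0 mulr0 subr0 U_at1.
rewrite (eq_RI (fun x _ => P x)) (@Rintegral_supp _ _ b); last first.
  by move=> x /Bn xB; rewrite Hphi ?mul0r// ler01 lexx.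
rewrite -/b addrC; apply/esym/eqP; rewrite subr_eq0; apply/eqP.
by apply: eq_RI => x _; rewrite mulrC.
Unshelve. all: by end_near. Qed.

End weak_solution.

(** * Testing weak solutions *)

Section bump.
Context {R : realType}.
Implicit Types (p q : {poly R}) (x y h : R).

Lemma expr_le_expR n y : 0 <= y -> y ^+ n <= n%:R ^+ n * expR y.
Proof.
case: n => [|n] y0.
  by rewrite !expr0 mul1r; apply: le_trans (expR_ge1Dx y); rewrite lerDl.
have -> : expR y = expR (y / n.+1%:R) ^+ n.+1.
  by rewrite -expRM_natl mulrC divfK// pnatr_eq0.
rewrite -exprMn; apply: lerXn2r; rewrite ?nnegrE ?mulr_ge0 ?expR_ge0//.
rewrite mulrC -ler_pdivrMr//; apply: le_trans (expR_ge1Dx _).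
by rewrite lerDr.
Qed.

Lemma horner_le p y : 1 <= y -> `|p.[y]| <= (\sum_(i < size p) `|p`_i|) * y ^+ size p.
Proof.
move=> y1; rewrite horner_coef mulr_suml; apply: le_trans (ler_norm_sum _ _ _) _.
apply: ler_sum => i _; rewrite normrM ler_wpM2l// ger0_norm ?exprn_ge0 ?(le_trans _ y1)//.
by apply: ler_weXn2l => //; exact: ltnW.
Qed.

(** The derivatives of [exp (- 1/x)] all have this shape; [flat_der] records how the polynomial in
    [1/x] changes. *)
Definition flat p x : R := if 0 < x then p.[x^-1] * expR (- x^-1) else 0.

Definition flat_der p : {poly R} := ('X^2 * (p - p^`()))%R.

(** The exponential beats every power of [1/h], so a factor [h^2] can be split off; with
    [der_quadratic] this gives the derivative 0 at the origin. *)
Lemma flat_quadratic p : exists M, forall h, `|h| <= 1 -> `|flat p h| <= M * h ^+ 2.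
Proof.
pose q := ('X^2 * p)%R; pose S := \sum_(i < size q) `|q`_i|.
have S0 : 0 <= S by apply: sumr_ge0.
exists (S * (size q)%:R ^+ size q) => h h1; rewrite /flat; case: ifPn => h0; last first.
  by rewrite normr0; apply: mulr_ge0; rewrite ?sqr_ge0//; apply: mulr_ge0; rewrite ?exprn_ge0.
have y1 : 1 <= h^-1 by rewrite invf_ge1// (le_trans (ler_norm h)).
have hq : p.[h^-1] = q.[h^-1] * h ^+ 2.
  by rewrite /q hornerM hornerXn exprVn mulrAC mulVf ?mul1r// expf_eq0 gt_eqF.
rewrite hq mulrAC normrM [`|h ^+ 2|]ger0_norm ?sqr_ge0// ler_wpM2r ?sqr_ge0//.
rewrite normrM [`|expR _|]ger0_norm ?expR_ge0// expRN ler_pdivrMr ?expR_gt0//.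
apply: le_trans (horner_le q y1) _; rewrite -mulrA; apply: ler_wpM2l => //.
by apply: expr_le_expR; rewrite (le_trans _ y1).
Qed.

Lemma der_flat p x : is_derive x 1 (flat p) (flat (flat_der p) x).
Proof.
have [x0|x0|<-] := ltgtP 0 x.
- have xN0 : x != 0 by rewrite gt_eqF.
  have near_x : \forall y \near x, p.[y^-1] * expR (- y^-1) = flat p y.
    near=> y; rewrite /flat ifT//; near: y; exact: lt_nbhsr.
  apply: near_eq_is_derive near_x _; rewrite ?oner_neq0//.
  have dV := is_deriveV (f := fun y => y) xN0 (der_id x).
  have d1 := der_comp (g := fun y : R => y^-1) (is_derive_poly p x^-1) dV.
  have d2 := der_comp (g := fun y : R => - y^-1) (is_derive_expR (- x^-1)) (derN dV).
  apply: is_derive_ext (derM d1 d2) _ _ => //.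
  have e1 : - x ^- 2 *: (1 : R) = - x ^- 2 by rewrite -[LHS]/(- x ^- 2 * 1) mulr1.
  rewrite /flat x0 /flat_der hornerM hornerXn hornerD hornerN exprVn e1.
  ring.
- have near_x : \forall y \near x, (fun=> 0) y = flat p y.
    near=> y; rewrite /flat ifF//; apply/negbTE; rewrite -leNgt ltW//; near: y; exact: lt_nbhsl.
  rewrite [flat _ x]/flat ifF; last by apply/negbTE; rewrite -leNgt ltW.
  by apply: near_eq_is_derive near_x _; exact: der_cst.
- have [M HM] := flat_quadratic p; rewrite [flat (flat_der p) 0]/flat ltxx.
  apply: (@der_quadratic _ _ _ _ M) => h h1.
  by rewrite add0r mulr0 subr0 [flat p 0]/flat ltxx subr0 HM.
Unshelve. all: by end_near. Qed.

Definition flat_jet k := flat (iter k flat_der 1%R).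

Lemma jet_flat : jet flat_jet. Proof. by move=> k x; exact: der_flat. Qed.

Lemma flat_jet_le0 k x : x <= 0 -> flat_jet k x = 0.
Proof. by move=> x0; rewrite /flat_jet /flat ltNge x0. Qed.

Lemma flat_jet_ge0 x : 0 <= flat_jet 0 x.
Proof. by rewrite /flat_jet /flat /= hornerC; case: ifP => // _; rewrite mul1r expR_ge0. Qed.

Lemma jet_affine (J : nat -> R -> R) a b : jet J -> jet (fun k x => a ^+ k * J k (a * x + b)).
Proof.
move=> jJ k x.
have d := derD (derZ a (der_id x)) (der_cst b x).
apply: is_derive_ext (derZ (a ^+ k) (der_comp (g := fun x => a * x + b) (jJ k (a * x + b)) d)) _ _ => //.
by rewrite exprS; ring.
Qed.

Lemma jetZ (J : nat -> R -> R) c : jet J -> jet (fun k x => c * J k x).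
Proof. by move=> jJ k x; exact: derZ (jJ k x). Qed.

Lemma jet_shift (J : nat -> R -> R) : jet J -> jet (fun k => J k.+1).
Proof. by move=> jJ k x; exact: jJ. Qed.

Lemma jet_continuous (J : nat -> R -> R) k : jet J -> continuous (J k).
Proof. by move=> jJ; apply: der_continuous (jJ k). Qed.

(** The jet of [flat_jet 0 (1 + x) * flat_jet 0 (1 - x)], in the form produced by [jet_affine] and
    [jet_leibniz]. *)
Definition bump : nat -> R -> R :=
  leibniz (fun k x => 1 ^+ k * flat_jet k (1 * x + 1)) (fun k x => (-1) ^+ k * flat_jet k (- 1 * x + 1)).

Lemma jet_bump : jet bump.
Proof. by apply: jet_leibniz; apply: jet_affine; exact: jet_flat. Qed.

Lemma bump_supp k x : 1 <= `|x| -> bump k x = 0.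
Proof.
move=> x1; rewrite /bump /leibniz; apply: big1 => i _.
have [x0|/ltW x0] := leP 0 x; last first.
  rewrite ler0_norm// in x1.
  by rewrite (@flat_jet_le0 i (1 * x + 1)) ?mulr0 ?mul0r ?mulr0//; lra.
rewrite ger0_norm// in x1.
by rewrite (@flat_jet_le0 (k - i)%N (- 1 * x + 1)) ?mulr0 ?mulr0//; lra.
Qed.

Lemma bumpE x : bump 0 x = flat_jet 0 (1 + x) * flat_jet 0 (1 - x).
Proof.
rewrite /bump /leibniz big_ord_recl big_ord0 /= bin0 !expr0 !mul1r addr0 mulN1r.
by rewrite (addrC x) (addrC (- x)).
Qed.

Lemma bump_ge0 x : 0 <= bump 0 x.
Proof. by rewrite bumpE mulr_ge0// flat_jet_ge0. Qed.

Lemma lbm_jet (J : nat -> R -> R) k : jet J -> lbm (J k).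
Proof. by move=> jJ; apply: lbm_continuous; exact: jet_continuous. Qed.

Lemma bump_mass_gt0 : 0 < RI (-1) 1 (bump 0).
Proof.
have lb : lbm (bump 0) by exact: lbm_jet jet_bump.
(* On [-1/2, 1/2] both arguments [1 + x] and [1 - x] are at least 1/2, so each factor is at least
   [exp (- 2)]. *)
have h1 : expR (- 2) ^+ 2 * (2^-1 - - 2^-1) <= RI (- 2^-1) 2^-1 (bump 0).
  rewrite -RI_cst; last lra.
  apply: RI_le => //; first exact: lbm_cst.
  move=> x /andP[x1 x2]; rewrite bumpE expr2.
  have fl y : 2^-1 <= y -> expR (- 2) <= flat_jet 0 y.
    move=> y2; have y0 : 0 < y by apply: lt_le_trans y2; rewrite invr_gt0.
    rewrite /flat_jet /flat y0 /= hornerC mul1r ler_expR lerN2 invf_ple ?posrE//.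
  by apply: ler_pM; rewrite ?expR_ge0// fl//; lra.
apply: lt_le_trans (_ : 0 < expR (- 2) ^+ 2 * (2^-1 - - 2^-1)) _.
  by rewrite mulr_gt0 ?exprn_gt0 ?expR_gt0//; lra.
apply: le_trans h1 _.
have s1 : RI (-1) 1 (bump 0) = RI (-1) (- 2^-1) (bump 0) + RI (- 2^-1) 1 (bump 0).
  by apply: RI_split => //; lra.
have s2 : RI (- 2^-1) 1 (bump 0) = RI (- 2^-1) 2^-1 (bump 0) + RI 2^-1 1 (bump 0).
  by apply: RI_split => //; lra.
rewrite s1 s2.
have a1 := @RI_ge0 _ (-1) (- 2^-1) (bump 0) (fun x _ => bump_ge0 x).
have a2 := @RI_ge0 _ 2^-1 1 (bump 0) (fun x _ => bump_ge0 x).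
by rewrite addrCA lerDl addr_ge0.
Qed.

Definition eta k x : R := (RI (-1) 1 (bump 0))^-1 * bump k x.

Lemma jet_eta : jet eta. Proof. exact: jetZ jet_bump. Qed.

Lemma eta_supp k x : 1 <= `|x| -> eta k x = 0.
Proof. by move=> x1; rewrite /eta bump_supp ?mulr0. Qed.

Lemma eta_ge0 x : 0 <= eta 0 x.
Proof. by rewrite mulr_ge0 ?bump_ge0// invr_ge0 ltW// bump_mass_gt0. Qed.

Lemma eta_mass : RI (-1) 1 (eta 0) = 1.
Proof.
rewrite /eta RI_Z; last exact: lbm_jet jet_bump.
by rewrite mulVf// gt_eqF// bump_mass_gt0.
Qed.

Lemma eta_bounded k : exists2 M, 0 <= M & forall x, `|eta k x| <= M.
Proof.
have [M HM] := (lbm_jet k jet_eta).2 1; exists `|M| => // x.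
have [x1|/ltW x1] := leP `|x| 1; first by apply: le_trans (ler_norm M); exact: HM.
by rewrite eta_supp// normr0.
Qed.

(** A cutoff rising from 0 to 1 on [-1, 1] whose derivative is the mollifier; it serves both for
    ramps in time and as a primitive of the kernel. *)
Definition smooth_step : nat -> R -> R :=
  fun k => if k is j.+1 then eta j else fun x => RI (-1) x (eta 0).

Lemma lbm_eta k : lbm (eta k). Proof. exact: lbm_jet jet_eta. Qed.

Lemma RI_void a b (f : R -> R) : b <= a -> RI a b f = 0.
Proof.
rewrite le_eqVlt => /predU1P[->|ba]; first exact: RI_same.
by rewrite /RI set_itv_ge ?Rintegral_set0// bnd_simp -ltNge.
Qed.

Lemma RI_eta_supp a b : a <= b -> (b <= -1) || (1 <= a) -> RI a b (eta 0) = 0.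
Proof.
move=> ab H; rewrite (@eq_RI _ _ _ _ (fun=> 0)) ?RI_cst ?mul0r//.
move=> x /andP[ax xb]; apply: eta_supp; case/orP: H => H.
  by rewrite ler0_norm; lra.
by rewrite ger0_norm; lra.
Qed.

(** Below -1 the unoriented integral is 0 and [eta 0] has no mass, so the formula persists there. *)
Lemma smooth_step_sub x y : x <= y -> smooth_step 0 y - smooth_step 0 x = RI x y (eta 0).
Proof.
move=> xy /=; have [y1|/ltW y1] := leP y (-1).
  by rewrite (RI_void _ y1) (RI_void _ (le_trans xy y1)) RI_eta_supp ?y1// subrr.
have [x1|/ltW x1] := leP x (-1).
  rewrite (@RI_void _ x)// subr0 (RI_split (lbm_eta 0) x1 y1).
  by rewrite (@RI_eta_supp x (-1)) ?lexx// add0r.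
by rewrite (RI_split (lbm_eta 0) x1 xy) addrAC subrr add0r.
Qed.

Lemma jet_smooth_step : jet smooth_step.
Proof.
case=> [|k] x; last exact: jet_eta.
have [M M0 HM] := eta_bounded 1.
apply: (@der_quadratic _ _ _ _ M) => h _.
have key a b c : a <= c -> c <= b -> `|RI a b (eta 0) - (b - a) * eta 0 c| <= M * (b - a) ^+ 2.
  move=> ac cb; have ab := le_trans ac cb.
  have -> : RI a b (eta 0) - (b - a) * eta 0 c = RI a b (fun y => eta 0 y - eta 0 c).
    by rewrite RI_B ?RI_cst 1?[eta 0 c * _]mulrC//; [exact: lbm_eta|exact: lbm_cst].
  rewrite expr2 mulrA; apply: RI_norm_ub => //.
    by apply: lbmB; [exact: lbm_eta|exact: lbm_cst].
  move=> y /andP[y1 y2]; apply: le_trans (lipschitz_is_derive c y (jet_eta 0) HM) _.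
  by rewrite ler_wpM2l// ler_norml; apply/andP; split; lra.
have [h0|/ltW h0] := leP 0 h.
  rewrite smooth_step_sub ?lerDl//.
  by have := key x (x + h) x; rewrite addrAC subrr add0r; apply; rewrite ?lerDl.
have xh : x + h <= x by rewrite gerDl.
have := key (x + h) x x xh (lexx x).
have -> : RI (x + h) x (eta 0) - (x - (x + h)) * eta 0 x = - (smooth_step 0 (x + h) - smooth_step 0 x - h * eta 0 x).
  by rewrite -smooth_step_sub//; ring.
by rewrite normrN (_ : (x - (x + h)) ^+ 2 = h ^+ 2)//; ring.
Qed.

Lemma smooth_step_le0 x : x <= -1 -> smooth_step 0 x = 0.
Proof. exact: RI_void. Qed.

Lemma smooth_step_ge1 x : 1 <= x -> smooth_step 0 x = 1.
Proof.
move=> x1; have le11 : (-1 : R) <= 1 by lra.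
by rewrite /= (RI_split (lbm_eta 0) le11 x1) eta_mass RI_eta_supp ?addr0// lexx orbT.
Qed.

Lemma smooth_step_itv x : 0 <= smooth_step 0 x <= 1.
Proof.
have nd y z : y <= z -> smooth_step 0 y <= smooth_step 0 z.
  by move=> yz; rewrite -subr_ge0 smooth_step_sub// RI_ge0// => r _; exact: eta_ge0.
apply/andP; split.
  have [x1|/ltW x1] := leP x (-1); first by rewrite smooth_step_le0.
  by rewrite -(@smooth_step_le0 (-1))// nd.
have [x1|/ltW x1] := leP x 1; last by rewrite smooth_step_ge1.
by rewrite -(@smooth_step_ge1 1)// nd.
Qed.

End bump.

(** * Test functions with separated variables *)

Section product_test_functions.
Context {R : realType}.
Implicit Types (A B : nat -> R -> R).

Lemma partial_t_prod A B : jet A ->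
  partial_t (fun t x => A 0%N t * B 0%N x) = (fun t x => A 1%N t * B 0%N x).
Proof.
move=> jA; apply/funext => t; apply/funext => x; rewrite /partial_t derive1E.
apply: derive_val; apply: is_derive_ext (derM (jA 0%N t) (der_cst (B 0%N x) t)) _ _ => //.
by rewrite mulr0 addr0.
Qed.

Lemma partial_x_prod A B : jet B ->
  partial_x (fun t x => A 0%N t * B 0%N x) = (fun t x => A 0%N t * B 1%N x).
Proof.
move=> jB; apply/funext => t; apply/funext => x; rewrite /partial_x derive1E.
by apply: derive_val; exact: derZ (jB 0%N x).
Qed.

Lemma class_C_prod n A B : jet A -> jet B -> class_C n (fun t x => A 0%N t * B 0%N x).
Proof.
elim: n A B => [|n IH] A B jA jB.
  split => // z; apply: cvgM.
    by apply: (continuous_comp (@cvg_fst _ _ _ _ _)); exact: jet_continuous.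
  by apply: (continuous_comp (@cvg_snd _ _ _ _ _)); exact: jet_continuous.
have c0 : continuous (fun z : R * R => A 0%N z.1 * B 0%N z.2).
  by move: (IH A B jA jB); case: n {IH} => [|n] [].
split=> //; split.
- by move=> t x; have [] := derM (jA 0%N t) (der_cst (B 0%N x) t).
- by move=> t x; have [] := derZ (A 0%N t) (jB 0%N x).
- by rewrite partial_t_prod//; apply: (IH (fun k => A k.+1)) => //; exact: jet_shift.
- by rewrite partial_x_prod//; apply: (IH A (fun k => B k.+1)) => //; exact: jet_shift.
Qed.

(** The time factor is constrained only at points of [D]; for [D = (0, 1] x R] it may be nonzero at
    time 1 and beyond. *)
Lemma test_function_prod (D : set (R * R)) A B a b N : jet A -> jet B ->
  (forall t x, a <= t <= b -> D (t, x)) ->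
  (forall t x, D (t, x) -> A 0%N t != 0 -> a <= t <= b) ->
  (forall x, N < `|x| -> B 0%N x = 0) ->
  test_function D (fun t x => A 0%N t * B 0%N x).
Proof.
move=> jA jB abD At Bx.
pose Q : set (R * R) := `[a, b] `*` `[-N, N].
have cQ : compact Q by apply: compact_setX; exact: segment_compact.
have clQ : closed Q by apply: compact_closed => //; exact: norm_hausdorff.
have KQ : closure [set z : R * R | D z /\ A 0%N z.1 * B 0%N z.2 != 0] `<=` Q.
  rewrite [X in _ `<=` X](closure_id _).1//; apply: closure_subset => -[t x] /= [Dtx].
  rewrite mulf_eq0 negb_or => /andP[At0 Bx0]; split; rewrite /= in_itv/=; first exact: At Dtx At0.
  by rewrite -ler_norml leNgt; apply: contra_neqN Bx0 => /Bx.
split.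
- by move=> n; exact: class_C_prod.
- by apply: subclosed_compact cQ KQ; exact: closed_closure.
- move=> z /KQ; case: z => t x [/= + _]; rewrite in_itv/=; exact: abD.
Qed.

End product_test_functions.

(** * Iterated integrals and null sets of the strip *)

Section iterated.
Context {R : realType}.
Notation mR := (measurableTypeR R).
Notation leb := (@lebesgue_measure R).
Implicit Types (F G : R -> R -> R) (s t x y : R).
Local Notation strip := (@strip R : set (mR * mR)).
Local Notation meas_strip F := (measurable_fun strip (fun z : mR * mR => F z.1 z.2 : mR)).

Lemma measurable_strip : measurable strip.
Proof. by apply: measurableX => //; exact: measurable_itv. Qed.

Lemma stripE t x : strip (t, x) = (0 <= t <= 1) :> Prop.
Proof.
apply/propext; rewrite /strip/=; split; first by case; rewrite in_itv.
by split => //; rewrite /= in_itv.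
Qed.

(** No integrability is assumed: the inner integral is the finite part of a difference of two
    Tonelli functions, for the positive and the negative part, and remains measurable when these are
    infinite. *)
Lemma measurable_iterated F : meas_strip F ->
  measurable_fun [set t : mR | 0 <= t <= 1] (fun t : mR => (\int[leb]_x F t x)%:E).
Proof.
move=> mF; pose H (z : mR * mR) : \bar R := ((fun z : mR * mR => (F z.1 z.2)%:E) \_ strip) z.
have mH : measurable_fun setT H.
  have /measurable_EFinP mF' := mF.
  exact: (measurable_restrictT _ measurable_strip).1 mF'.
have mD : measurable [set t : mR | 0 <= t <= 1].
  by rewrite (_ : [set _ | _] = `[0, 1]%classic)//; apply/seteqP; split => t /=; rewrite in_itv.
have E t : 0 <= t <= 1 -> (\int[leb]_x F t x)%:E =
    (fine ((fubini_F leb H^\+ t) - (fubini_F leb H^\- t)))%:E.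
  move=> tI; congr EFin; rewrite /Rintegral; congr fine; rewrite [LHS]integralE /fubini_F.
  have HE x : H (t, x) = (F t x)%:E by rewrite /H patchE mem_set// stripE.
  by congr (_ - _)%E; apply: eq_integral => x _; rewrite ?funeposE ?funenegE HE.
apply: (eq_measurable_fun (fun t => (fine ((fubini_F leb H^\+ t) - (fubini_F leb H^\- t)))%:E)).
  by move=> t; rewrite inE => /E.
have mE : measurable_fun setT (fun t : mR => fine (fubini_F leb H^\+ t - fubini_F leb H^\- t)%E).
  apply: measurableT_comp; first exact: fine_measurable.
  apply: emeasurable_funB; apply: measurable_fun_fubini_tonelli_F => //.
  - exact: measurable_funepos.
  - exact: measurable_funeneg.
have /measurable_EFinP mE' := mE.
exact: measurable_funS mE'.
Qed.

Lemma ae_eq_iterated F G : meas_strip F -> meas_strip G ->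
  {ae leb, forall t, 0 <= t <= 1 -> {ae leb, forall x, F t x = G t x}} ->
  \int[leb]_(t in `[0, 1]) (\int[leb]_x F t x) = \int[leb]_(t in `[0, 1]) (\int[leb]_x G t x).
Proof.
move=> mF mG FG; rewrite /Rintegral; congr fine.
have e : `[0, 1]%classic = [set t : mR | 0 <= t <= 1] by apply/seteqP; split => t /=; rewrite in_itv.
apply: ae_eq_integral.
- exact: measurable_itv.
- by rewrite e; exact: measurable_iterated.
- by rewrite e; exact: measurable_iterated.
- apply: ae_imp FG _ => t H /=; rewrite in_itv/= => tI; congr (_%:E); rewrite /Rintegral; congr fine.
  have mS F' : meas_strip F' -> measurable_fun setT (fun x : mR => (F' t x)%:E).
    move=> mF'; apply/measurable_EFinP.
    have := (measurable_restrictT (fun z : mR * mR => F' z.1 z.2 : mR) measurable_strip).1 mF'.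
    move=> /(measurable_fun_pair2 t); apply: eq_measurable_fun => x _.
    by rewrite patchE mem_set// stripE.
  apply: ae_eq_integral => //; [exact: mS|exact: mS|].
  by apply: ae_imp (H tI) _ => x Hx _; rewrite Hx.
Qed.

(** The measure of a null set of the plane is the integral of the measures of its sections, almost
    all of which are therefore null. *)
Lemma ae_section (A : set (mR * mR)) : (leb \x leb)%E.-negligible (~` A) ->
  {ae leb, forall t, {ae leb, forall x, A (t, x)}}.
Proof.
move=> [N [mN N0 AN]].
have I0 : (\int[leb]_t `|leb (xsection N t)| = 0)%E.
  by rewrite -[RHS]N0; apply: eq_integral => t _; rewrite gee0_abs.
have mX : measurable_fun setT (fun t : mR => leb (xsection N t)).
  exact: measurable_fun_xsection.
have /(ae_eq_integral_abs leb measurableT mX).1 H := I0.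
apply: ae_imp H _ => t /(_ I) h.
exists (xsection N t); split => //.
  exact: measurable_xsection.
by move=> x /= nA; rewrite /xsection/= inE; apply: AN.
Qed.

End iterated.

(** * The weak formulation against product test functions *)

Section tested_equation.
Context {R : realType}.
Notation mR := (measurableTypeR R).
Notation leb := (@lebesgue_measure R).
Implicit Types (A B : nat -> R -> R) (s t x z : R).
Local Notation strip := (@strip R).
Local Notation meas_strip F := (measurable_fun (strip : set (mR * mR)) (fun z : mR * mR => F z.1 z.2 : mR)).

Lemma clamped_continuous (y : R -> R -> R) :
  {within strip, continuous (fun z : R * R => y z.1 z.2)} ->
  continuous (fun z : R * R => y (clamp01 z.1) z.2).
Proof.
move=> /subspace_continuousP cy [t x].
have st : strip (clamp01 t, x) by rewrite stripE clamp01_itv.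
have := cy _ st => /= H.
apply: (cvg_comp (fun z : R * R => (clamp01 z.1, z.2)) (fun z : R * R => y z.1 z.2) _ H).
move=> P HP.
have /nbhs_ballP[e /= e0 He] : nbhs (clamp01 t, x) [set z | strip z -> P z] := HP.
suff : nbhs (t, x) [set z : R * R | P (clamp01 z.1, z.2)] by [].
apply/nbhs_ballP; exists e => // -[s z] [/= ts xz].
apply: He; last by rewrite stripE clamp01_itv.
split => //=; apply: le_lt_trans ts.
have [le_st|/ltW le_ts] := leP s t.
  by rewrite !ger0_norm ?subr_ge0 ?clamp01_nd// clamp01_lip.
by rewrite distrC (distrC t) !ger0_norm ?subr_ge0 ?clamp01_nd// clamp01_lip.
Qed.

(** Truncating at the essential bound, and extending by 0 off the strip, changes [v] only on a null
    set of the strip and gives a function bounded everywhere, fit for [lbm2]. *)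
Lemma truncated_representative (v : R -> R -> R) : ess_bounded v ->
  exists V M, [/\ lbm2 V, 0 <= M, forall t x, `|V t x| <= M &
    {ae leb, forall t, 0 <= t <= 1 -> {ae leb, forall x, v t x = V t x}}].
Proof.
move=> [mv [M0 HM0]].
pose M := `|M0|.
pose V0 (z : mR * mR) : mR := ((fun z : mR * mR => Num.max (- M) (Num.min (v z.1 z.2) M)) \_ (strip : set (mR * mR))) z.
have mV0 : measurable_fun setT V0.
  apply: (measurable_restrictT _ measurable_strip).1.
  by apply: measurable_maxr => //; apply: measurable_minr.
have V0M p : `|V0 p| <= M.
  rewrite /V0 patchE; case: ifPn => _; last by rewrite normr0 normr_ge0.
  rewrite ler_norml le_max lexx/= ge_max ge_min lexx orbT andbT.
  by have := normr_ge0 M0; rewrite -/M; lra.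
exists (fun t x => V0 (t, x)), M; split => //.
- split; last by move=> N; exists M => t x _ _; exact: V0M.
  by apply: eq_measurable_fun mV0 => -[t x].
- exact: normr_ge0.
apply: ae_imp (ae_section HM0) _ => t H tI.
apply: ae_imp H _ => x /=; rewrite stripE => /(_ tI) /= vM.
rewrite /V0 patchE mem_set ?stripE//=.
have : `|v t x| <= M by apply: le_trans vM _; exact: ler_norm.
by rewrite ler_norml => /andP[v1 v2]; rewrite (min_idPl v2) (max_idPr v1).
Qed.

Variables (alpha w xi2 : R -> R) (y v V : R -> R -> R).
Hypothesis lalpha : lbm alpha.
Hypothesis cw : continuous w.
Hypothesis xi2E : forall t, 0 <= t <= 1 -> xi2 t = w t.
Hypothesis cy : {within strip, continuous (fun z : R * R => y z.1 z.2)}.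
Hypothesis wv : weak_partial_x y v.
Hypothesis mv : meas_strip v.
Hypothesis lV : lbm2 V.
Hypothesis vV : {ae leb, forall t, 0 <= t <= 1 -> {ae leb, forall x, v t x = V t x}}.
Hypothesis eqv : forall phi, test_function (`]0, 1] `*` setT) phi ->
  0 = \int[leb]_(t in `[0, 1]) (\int[leb]_x
        (- y t x * partial_t phi t x +
         xi2 t / 2 * (y t x * partial_x (partial_x phi) t x +
                      alpha t * v t x ^+ 2 * phi t x)))
      + \int[leb]_x (phi 1 x * log_cosh x).

Definition clamped t x := y (clamp01 t) x.
Local Notation Y := clamped.

Lemma lbm2_Y : lbm2 Y.
Proof. by apply: lbm2_continuous; exact: clamped_continuous. Qed.

Let Y_strip t x : 0 <= t <= 1 -> y t x = Y t x.
Proof. by move=> tI; rewrite /clamped clamp01_id. Qed.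

Let meas_lbm2 F : lbm2 F -> meas_strip F.
Proof. by move=> [mF _]; apply: measurable_funS mF. Qed.

Lemma weak_partial_x_tested A B N a b : jet A -> jet B -> 0 < a -> b < 1 -> 0 <= N ->
  (forall t, A 0%N t != 0 -> a <= t <= b) ->
  (forall k x, N < `|x| -> B k x = 0) ->
  RI 0 1 (fun t => A 0%N t * (RI (- N) N (fun z => Y t z * B 1%N z) + RI (- N) N (fun z => V t z * B 0%N z))) = 0.
Proof.
move=> jA jB a0 b1 N0 HA HB.
have T : test_function (`]0, 1[ `*` setT) (fun t x => A 0%N t * B 0%N x).
  apply: (@test_function_prod _ _ A B a b N) => //.
  - by move=> t x /andP[t1 t2]; split => //; rewrite /= in_itv/=; apply/andP; split; lra.
  - by move=> t x _; exact: HA.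
  - by move=> x; exact: HB.
have lA k : lbm (A k) by exact: lbm_jet.
have lB k : lbm (B k) by exact: lbm_jet.
have NN : - N <= N by lra.
have lAB : lbm2 (fun t x => A 0%N t * B 0%N x).
  exact: (lbm2M (lbm2_fst (lA 0%N)) (lbm2_snd (lB 0%N))).
have := wv T; rewrite partial_x_prod// (@ae_eq_iterated _ (fun t x => v t x * (A 0%N t * B 0%N x)) (fun t x => V t x * (A 0%N t * B 0%N x))); last 3 first.
- by apply: measurable_funM => //; exact: meas_lbm2 lAB.
- exact: (meas_lbm2 (lbm2M lV lAB)).
- by apply: ae_imp vV _ => t H tI; apply: ae_imp (H tI) _ => x ->.
have lYB : lbm2 (fun t z => Y t z * B 1%N z) by apply: lbm2M; [exact: lbm2_Y|exact: lbm2_snd].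
have lVB : lbm2 (fun t z => V t z * B 0%N z) by apply: lbm2M => //; exact: lbm2_snd.
have -> : \int[leb]_(t in `[0, 1]) \int[leb]_x (y t x * (A 0%N t * B 1%N x)) =
   RI 0 1 (fun t => A 0%N t * RI (- N) N (fun z => Y t z * B 1%N z)).
  rewrite -[LHS]/(RI 0 1 _); apply: eq_RI => t tI.
  rewrite (@Rintegral_supp _ _ N); last by move=> x xN; rewrite HB// !mulr0.
  rewrite -RI_Z; last exact: lbm2_sectl lYB.
  by apply: eq_RI => x _; rewrite Y_strip//; ring.
have -> : \int[leb]_(t in `[0, 1]) \int[leb]_x (V t x * (A 0%N t * B 0%N x)) =
   RI 0 1 (fun t => A 0%N t * RI (- N) N (fun z => V t z * B 0%N z)).
  rewrite -[LHS]/(RI 0 1 _); apply: eq_RI => t tI.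
  rewrite (@Rintegral_supp _ _ N); last by move=> x xN; rewrite HB// !mulr0.
  rewrite -RI_Z; last exact: lbm2_sectl lVB.
  by apply: eq_RI => x _; ring.
have l1 : lbm (fun t => A 0%N t * RI (- N) N (fun z => Y t z * B 1%N z)) by apply: lbmM => //; exact: lbm_RI.
have l2 : lbm (fun t => A 0%N t * RI (- N) N (fun z => V t z * B 0%N z)) by apply: lbmM => //; exact: lbm_RI.
move=> E; rewrite (_ : (fun t => _) = (fun t => A 0%N t * RI (- N) N (fun z => Y t z * B 1%N z) +
   A 0%N t * RI (- N) N (fun z => V t z * B 0%N z))); last by apply/funext => t; rewrite mulrDr.
by rewrite RI_D// E addNr.
Qed.

Lemma weak_equation_tested A B N a : jet A -> jet B -> 0 < a -> 0 <= N ->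
  (forall t, A 0%N t != 0 -> a <= t) ->
  (forall k x, N < `|x| -> B k x = 0) ->
  RI 0 1 (fun t => A 0%N t * (w t / 2 * (RI (- N) N (fun z => Y t z * B 2 z) +
           alpha t * RI (- N) N (fun z => V t z ^+ 2 * B 0%N z)))
         - A 1%N t * RI (- N) N (fun z => Y t z * B 0%N z))
  + A 0%N 1 * RI (- N) N (fun z => B 0%N z * log_cosh z) = 0.
Proof.
move=> jA jB a0 N0 HA HB.
have T : test_function (`]0, 1] `*` setT) (fun t x => A 0%N t * B 0%N x).
  apply: (@test_function_prod _ _ A B a 1 N) => //.
  - by move=> t x /andP[t1 t2]; split => //; rewrite /= in_itv/=; apply/andP; split; lra.
  - by move=> t x [/= + _] At; rewrite in_itv/= => /andP[_ ->]; rewrite andbT; exact: HA.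
  - by move=> x; exact: HB.
have lA k : lbm (A k) by exact: lbm_jet.
have lB k : lbm (B k) by exact: lbm_jet.
have lw : lbm w by exact: lbm_continuous.
have lY := lbm2_Y.
have NN : - N <= N by lra.
pose F (V : R -> R -> R) t x := - Y t x * (A 1%N t * B 0%N x) +
   w t / 2 * (Y t x * (A 0%N t * B 2 x) + alpha t * V t x ^+ 2 * (A 0%N t * B 0%N x)).
have lc1 : lbm2 (fun t x => - Y t x * (A 1%N t * B 0%N x)).
  by apply: lbm2M; [exact: lbm2N|apply: lbm2M; [exact: lbm2_fst|exact: lbm2_snd]].
have lc2 : lbm2 (fun t x : R => w t / 2).
  by apply: (lbm2_fst (f := fun t => w t / 2)); apply: lbmM => //; exact: lbm_cst.
have lc3 : lbm2 (fun t x => Y t x * (A 0%N t * B 2 x)).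
  by apply: lbm2M => //; apply: lbm2M; [exact: lbm2_fst|exact: lbm2_snd].
have lc4 : lbm2 (fun t x => A 0%N t * B 0%N x) by apply: lbm2M; [exact: lbm2_fst|exact: lbm2_snd].
have mF W : meas_strip W -> meas_strip (F W).
  move=> mW; apply: measurable_funD; first exact: meas_lbm2 lc1.
  apply: measurable_funM; first exact: meas_lbm2 lc2.
  apply: measurable_funD; first exact: meas_lbm2 lc3.
  apply: measurable_funM; last exact: meas_lbm2 lc4.
  apply: measurable_funM; first by apply: (meas_lbm2 (F := fun t _ => alpha t)); exact: lbm2_fst.
  exact: measurable_funX.
have := eqv T; rewrite partial_t_prod// partial_x_prod//.
rewrite (partial_x_prod A (jet_shift jB)).
have -> : \int[leb]_(t in `[0, 1]) (\int[leb]_x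
        (- y t x * (A 1%N t * B 0%N x) +
         xi2 t / 2 * (y t x * (A 0%N t * B 2 x) +
                      alpha t * v t x ^+ 2 * (A 0%N t * B 0%N x)))) =
   \int[leb]_(t in `[0, 1]) (\int[leb]_x F v t x).
  rewrite -[LHS]/(RI 0 1 _) -[RHS]/(RI 0 1 _); apply: eq_RI => t tI.
  by apply: eq_Rintegral => x _; rewrite /F xi2E// !Y_strip.
rewrite (@ae_eq_iterated _ (F v) (F V)); last 3 first.
- exact: mF.
- by apply: mF; exact: meas_lbm2.
- by apply: ae_imp vV _ => t H tI; apply: ae_imp (H tI) _ => x; rewrite /F => ->.
have lYB k : lbm2 (fun t z => Y t z * B k z) by apply: lbm2M => //; exact: lbm2_snd.
have lV2 : lbm2 (fun t z => V t z ^+ 2) by apply: lbm2M.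
have lVB : lbm2 (fun t z => V t z ^+ 2 * B 0%N z) by apply: lbm2M => //; exact: lbm2_snd.
have -> : \int[leb]_(t in `[0, 1]) (\int[leb]_x F V t x) =
  RI 0 1 (fun t => A 0%N t * (w t / 2 * (RI (- N) N (fun z => Y t z * B 2 z) +
           alpha t * RI (- N) N (fun z => V t z ^+ 2 * B 0%N z)))
         - A 1%N t * RI (- N) N (fun z => Y t z * B 0%N z)).
  rewrite -[LHS]/(RI 0 1 _); apply: eq_RI => t tI.
  rewrite (@Rintegral_supp _ _ N); last by move=> x xN; rewrite /F !HB// !mulr0 addr0 mulr0 addr0.
  have m1 := lbm2_sectl t (lYB 2); have m0 := lbm2_sectl t (lYB 0%N); have m2 := lbm2_sectl t lVB.
  have m3 : lbm (fun z => alpha t * (V t z ^+ 2 * B 0%N z)) by exact: lbmZ.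
  have m4 : lbm (fun z => Y t z * B 2 z + alpha t * (V t z ^+ 2 * B 0%N z)) by exact: lbmD.
  have m5 : lbm (fun z => w t / 2 * (Y t z * B 2 z + alpha t * (V t z ^+ 2 * B 0%N z))) by exact: lbmZ.
  rewrite -(RI_Z _ _ (alpha t) m2) -RI_D// -(RI_Z _ _ (w t / 2) m4).
  rewrite -(RI_Z _ _ (A 0%N t) m5) -(RI_Z _ _ (A 1%N t) m0) -RI_B; [|exact: lbmZ|exact: lbmZ].
  by apply: eq_RI => x _; rewrite /F; ring.
rewrite (@Rintegral_supp _ _ N); last by move=> x xN; rewrite !HB// mulr0 mul0r.
have llc : lbm (fun z => B 0%N z * log_cosh z).
  by apply: lbmM => //; exact: (lbm_jet 0 (@jet_log_cosh R)).
rewrite -(RI_Z _ _ (A 0%N 1) llc) => E.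
by rewrite [RHS]E; congr (_ + _); apply: eq_RI => x _; rewrite mulrA.
Qed.

End tested_equation.

(** * From time test functions to integrated identities *)

Section steps_in_time.
Context {R : realType}.
Implicit Types (A : nat -> R -> R) (f h : R -> R) (s t r c d : R).

Lemma continuous_sub f h : continuous f -> continuous h -> continuous (fun x => f x - h x).
Proof. by move=> cf ch x; apply: cvgB; [exact: cf|exact: ch]. Qed.

Lemma continuous_const c : continuous (fun _ : R => c).
Proof. by move=> x; exact: cvg_cst. Qed.

Definition ramp d t k r : R := d^-1 ^+ k * smooth_step k (d^-1 * r + - (d^-1 * t)).

Lemma jet_ramp d t : jet (ramp d t).
Proof. exact: jet_affine (@jet_smooth_step R). Qed.

Lemma rampE d t k r : ramp d t k r = d^-1 ^+ k * smooth_step k ((r - t) / d).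
Proof. by rewrite /ramp; congr (_ * smooth_step k _); ring. Qed.

Lemma ramp_left d t r : 0 < d -> r <= t - d -> ramp d t 0 r = 0.
Proof.
move=> d0 rt; rewrite rampE expr0 mul1r smooth_step_le0//.
by rewrite ler_pdivrMr// mulN1r; lra.
Qed.

Lemma ramp_right d t r : 0 < d -> t + d <= r -> ramp d t 0 r = 1.
Proof.
move=> d0 rt; rewrite rampE expr0 mul1r smooth_step_ge1//.
by rewrite ler_pdivlMr// mul1r; lra.
Qed.

Lemma ramp_itv d t r : 0 <= ramp d t 0 r <= 1.
Proof. by rewrite rampE expr0 mul1r smooth_step_itv. Qed.

Lemma ramp1_ge0 d t r : 0 < d -> 0 <= ramp d t 1 r.
Proof.
move=> d0; rewrite rampE; apply: mulr_ge0; last exact: eta_ge0.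
by rewrite exprn_ge0// invr_ge0 ltW.
Qed.

Lemma ramp1_supp d t r : 0 < d -> d <= `|r - t| -> ramp d t 1 r = 0.
Proof.
move=> d0 rt; rewrite rampE /= eta_supp ?mulr0//.
by rewrite normrM normfV (gtr0_norm d0) ler_pdivlMr// mul1r.
Qed.

Lemma lbm_bounded01 f : lbm f -> exists2 C, 0 <= C & forall t, 0 <= t <= 1 -> `|f t| <= C.
Proof.
move=> lf; have [C HC] := lf.2 1; exists `|C| => // t /andP[t0 t1].
by apply: le_trans (ler_norm C); apply: HC; rewrite ger0_norm.
Qed.

Lemma RI_clamp_continuous f : lbm f -> continuous (fun t => RI 0 (clamp01 t) f).
Proof.
move=> lf; have [C C0 HC] := lbm_bounded01 lf.
apply: (@lip_continuous _ _ C) => s t st.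
have /andP[s0 s1] := clamp01_itv s; have /andP[t0 t1] := clamp01_itv t.
have st' := clamp01_nd st.
rewrite (RI_split lf s0 st') addrAC subrr add0r.
apply: le_trans (_ : _ <= C * (clamp01 t - clamp01 s)) _.
  apply: RI_norm_ub => // x /andP[x1 x2]; apply: HC.
  by rewrite (le_trans s0 x1) (le_trans x2 t1).
by rewrite ler_wpM2l// clamp01_lip.
Qed.

(** Ramps of width [d] at [t] tend to the indicator of [[t, 1]] and their derivatives to a point
    mass at [t]. This settles interior times; the endpoints follow by continuity. *)
Lemma integrate_tested_equation (Yf Nf : R -> R) c : lbm Yf -> lbm Nf -> continuous Yf ->
  (forall A a, jet A -> 0 < a -> (forall t, A 0%N t != 0 -> a <= t) ->
    RI 0 1 (fun t => A 0%N t * Nf t - A 1%N t * Yf t) + A 0%N 1 * c = 0) ->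
  forall t, 0 <= t <= 1 -> Yf t = c + RI t 1 Nf.
Proof.
move=> lY lN cY H.
have [C C0 HC] := lbm_bounded01 lN.
have inside t : 0 < t < 1 -> Yf t = c + RI t 1 Nf.
  move=> /andP[t0 t1]; apply/eqP; rewrite -subr_eq0 -normr_le0; apply/ler_addgt0Pl => e e0.
  rewrite addr0.
  have [r0 /= r0P Hr] : exists2 r, 0 < r & forall s, `|t - s| < r -> `|Yf t - Yf s| <= e / 2.
    have : \forall s \near t, `|Yf t - Yf s| <= e / 2.
      by have := cY t => /cvgrPdist_le; apply; rewrite divr_gt0.
    by move=> /nbhs_ballP[r /= r0 Hr]; exists r => // s sr; apply: Hr.
  (* The bounds serve, in order, the continuity of [Yf] at [t], the inclusion of [[t - d, t + d]] in
     (0, 1), and [3 d C <= e/2]: [2 d C] for the ramp zone and [d C] for the integral over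
     [[t, t + d]]. *)
  pose d := Num.min (r0 / 2) (Num.min (t / 2) (Num.min ((1 - t) / 2) (e / (6 * (C + 1))))).
  have C1 : 0 < C + 1 by rewrite ltr_wpDl.
  have d0 : 0 < d by rewrite !lt_min !divr_gt0 ?subr_gt0// mulr_gt0.
  have [dr [dt [dt1 dC]]] : d <= r0 / 2 /\ d <= t / 2 /\ d <= (1 - t) / 2 /\ d <= e / (6 * (C + 1)).
    by rewrite !ge_min !lexx ?orbT.
  have {}dC : 3 * d * C <= e / 2.
    move: dC; rewrite ler_pdivlMr ?mulr_gt0// => dC.
    have : 0 <= d by exact: ltW.
    lra.
  have := H (ramp d t) (t - d) (jet_ramp d t).
  have -> : ramp d t 0 1 = 1 by rewrite ramp_right//; lra.
  move=> /(_ _ _)E.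
  have {}E : RI 0 1 (fun r => ramp d t 0 r * Nf r - ramp d t 1 r * Yf r) + 1 * c = 0.
    apply: E; first lra.
    by move=> r; apply: contra_neqT; rewrite -ltNge => /ltW; exact: ramp_left.
  have la k : lbm (ramp d t k) by apply: lbm_jet; exact: jet_ramp.
  have mass : RI 0 1 (ramp d t 1) = 1.
    rewrite (RI_FTC ler01 (@jet_continuous _ _ 1%N (jet_ramp d t)) (jet_ramp d t 0)).
    by rewrite ramp_right ?ramp_left ?subr0//; lra.
  have lN0 : lbm (fun r => ramp d t 0 r * Nf r) by exact: lbmM.
  have lY1 : lbm (fun r => ramp d t 1 r * Yf r) by exact: lbmM.
  have EY : `|RI 0 1 (fun r => ramp d t 1 r * Yf r) - Yf t| <= e / 2.
    have -> : RI 0 1 (fun r => ramp d t 1 r * Yf r) - Yf t =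
        RI 0 1 (fun r => ramp d t 1 r * Yf r) - RI 0 1 (fun r => Yf t * ramp d t 1 r).
      by rewrite RI_Z// mass mulr1.
    rewrite -RI_B//; last exact: lbmZ.
    rewrite (@eq_RI _ _ _ _ (fun r => ramp d t 1 r * (Yf r - Yf t))); last by move=> r _; ring.
    have lD : lbm (fun r => ramp d t 1 r * (Yf r - Yf t)).
      by apply: lbmM => //; apply: lbmB => //; exact: lbm_cst.
    apply: le_trans (RI_norm _ _ lD) _.
    have -> : e / 2 = RI 0 1 (fun r => e / 2 * ramp d t 1 r) by rewrite RI_Z// mass mulr1.
    apply: RI_le; [exact: lbm_norm|exact: lbmZ|].
    move=> r _; rewrite normrM (ger0_norm (ramp1_ge0 _ _ d0)) mulrC.
    have [rd|rd] := leP d `|r - t|; first by rewrite ramp1_supp// !mulr0.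
    by apply: ler_wpM2r; [exact: ramp1_ge0|rewrite distrC; apply: Hr; rewrite distrC; lra].
  have EN : `|RI 0 1 (fun r => ramp d t 0 r * Nf r) - RI t 1 Nf| <= e / 2.
    have s1 : 0 <= t - d by lra.
    have s2 : t - d <= t + d by lra.
    have s3 : t + d <= 1 by lra.
    have s4 : t <= t + d by lra.
    rewrite (RI_split lN0 s1 (le_trans s2 s3)) (RI_split lN0 s2 s3) (RI_split lN s4 s3).
    rewrite (@eq_RI _ 0 (t - d) _ (fun=> 0)); last by move=> r /andP[_ rt]; rewrite ramp_left// mul0r.
    rewrite (@eq_RI _ (t + d) 1 (fun r => ramp d t 0 r * Nf r) Nf); last first.
      by move=> r /andP[rt _]; rewrite ramp_right// mul1r.
    rewrite RI_cst// mul0r add0r.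
    have b1 : `|RI (t - d) (t + d) (fun r => ramp d t 0 r * Nf r)| <= C * (t + d - (t - d)).
      apply: RI_norm_ub => // r /andP[r1 r2]; rewrite normrM -[leRHS]mul1r.
      have /andP[a1 a2] := ramp_itv d t r.
      by apply: ler_pM => //; [rewrite ger0_norm|apply: HC; apply/andP; split; lra].
    have b2 : `|RI t (t + d) Nf| <= C * (t + d - t).
      by apply: RI_norm_ub => // r /andP[r1 r2]; apply: HC; apply/andP; split; lra.
    rewrite (_ : _ - _ = RI (t - d) (t + d) (fun r => ramp d t 0 r * Nf r) - RI t (t + d) Nf); last by ring.
    by apply: le_trans (ler_normB _ _) _; lra.
  rewrite RI_B// mul1r in E.
  rewrite (_ : Yf t - _ = (RI 0 1 (fun r => ramp d t 0 r * Nf r) - RI t 1 Nf)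
     - (RI 0 1 (fun r => ramp d t 1 r * Yf r) - Yf t)); last by lra.
  by apply: le_trans (ler_normB _ _) _; lra.
pose G t := Yf t - c - (RI 0 1 Nf - RI 0 (clamp01 t) Nf).
have GE t : 0 <= t <= 1 -> G t = Yf t - (c + RI t 1 Nf).
  move=> /andP[t0 t1]; rewrite /G clamp01_id ?t0// (RI_split lN t0 t1); ring.
have cG : continuous G.
  apply: continuous_sub; apply: continuous_sub => //; try exact: continuous_const.
  exact: RI_clamp_continuous.
move=> t tI; apply/eqP; rewrite -subr_eq0 -GE//; apply/eqP.
apply: (@vanish_at_boundary _ G t 1) => // s /[dup] sI /andP[s0 s1] _.
by rewrite GE ?(ltW s0) ?(ltW s1)// inside// subrr.
Qed.

(** Here the time factor must vanish near both 0 and 1; a rising ramp at [s] times a falling one at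
    [t] approximates the indicator of [[s, t]], with an error of at most [6 d C]. *)
Lemma integral_of_tested_zero h : lbm h ->
  (forall A a b, jet A -> 0 < a -> b < 1 -> (forall t, A 0%N t != 0 -> a <= t <= b) ->
    RI 0 1 (fun t => A 0%N t * h t) = 0) ->
  forall s t, 0 <= s -> s <= t -> t <= 1 -> RI s t h = 0.
Proof.
move=> lh H.
have [C C0 HC] := lbm_bounded01 lh.
have inside s t : 0 < s -> s < t -> t < 1 -> RI s t h = 0.
  move=> s0 st t1; apply/eqP; rewrite -normr_le0; apply/ler_addgt0Pl => e e0; rewrite addr0.
  pose d := Num.min (s / 2) (Num.min ((1 - t) / 2) (Num.min ((t - s) / 2) (e / (6 * (C + 1))))).
  have C1 : 0 < C + 1 by rewrite ltr_wpDl.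
  have d0 : 0 < d by rewrite !lt_min !divr_gt0 ?subr_gt0// mulr_gt0.
  have [ds [dt [dst dC]]] : d <= s / 2 /\ d <= (1 - t) / 2 /\ d <= (t - s) / 2 /\ d <= e / (6 * (C + 1)).
    by rewrite !ge_min !lexx ?orbT.
  have {}dC : 6 * d * C <= e.
    move: dC; rewrite ler_pdivlMr ?mulr_gt0// => dC.
    have : 0 <= d by exact: ltW.
    lra.
  pose L := ramp d s; pose Q k r := (-1) ^+ k * ramp d (- t) k (-1 * r + 0).
  have jL : jet L := jet_ramp d s.
  have jQ : jet Q by apply: jet_affine; exact: jet_ramp.
  pose A := leibniz L Q.
  have AE r : A 0%N r = ramp d s 0 r * ramp d (- t) 0 (- r).
    by rewrite /A /leibniz big_ord_recl big_ord0 /= bin0 mul1r addr0 /L /Q expr0 mul1r mulN1r addr0.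
  have jA : jet A by exact: jet_leibniz.
  have lA : lbm (fun r => A 0%N r * h r) by apply: lbmM => //; exact: lbm_jet.
  have A01 r : 0 <= A 0%N r <= 1.
    have /andP[a1 a2] := ramp_itv d s r; have /andP[b1 b2] := ramp_itv d (- t) (- r).
    by rewrite AE mulr_ge0//= mulr_ile1.
  have Al r : r <= s - d -> A 0%N r = 0 by move=> rs; rewrite AE ramp_left// mul0r.
  have Ar r : t + d <= r -> A 0%N r = 0.
    by move=> rt; rewrite AE (@ramp_left _ (- t))// ?mulr0//; lra.
  have Am r : s + d <= r <= t - d -> A 0%N r = 1.
    by move=> /andP[r1 r2]; rewrite AE !ramp_right ?mul1r//; lra.
  have E : RI 0 1 (fun r => A 0%N r * h r) = 0.
    apply: (H A (s - d) (t + d)) => //; [lra|lra|].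
    move=> r Ar0; apply/andP; split; rewrite leNgt; apply: contra_neqN Ar0 => /ltW; [exact: Al|exact: Ar].
  have q1 : 0 <= s - d by lra.
  have q2 : s - d <= s + d by lra.
  have q3 : s + d <= t - d by lra.
  have q4 : t - d <= t + d by lra.
  have q5 : t + d <= 1 by lra.
  have q6 : s <= s + d by lra.
  have q7 : t - d <= t by lra.
  have p45 := le_trans q4 q5; have p35 := le_trans q3 p45; have p25 := le_trans q2 p35.
  rewrite (RI_split lA q1 p25) (RI_split lA q2 p35) (RI_split lA q3 p45) (RI_split lA q4 q5) in E.
  rewrite (@eq_RI _ 0 (s - d) _ (fun=> 0)) in E; last by move=> r /andP[_ rs]; rewrite Al// mul0r.
  rewrite (@eq_RI _ (t + d) 1 _ (fun=> 0)) in E; last by move=> r /andP[rt _]; rewrite Ar// mul0r.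
  rewrite (@eq_RI _ (s + d) (t - d) _ h) in E; last by move=> r rI; rewrite Am// mul1r.
  rewrite !RI_cst// !mul0r add0r addr0 in E.
  rewrite (RI_split lh q6 (le_trans q3 q7)) (RI_split lh q3 q7).
  have b1 p q : p <= q -> 0 <= p -> q <= 1 -> `|RI p q (fun r => A 0%N r * h r)| <= C * (q - p).
    move=> pq p0 q1'; apply: RI_norm_ub => // r /andP[r1 r2]; rewrite normrM -[leRHS]mul1r.
    have /andP[a1 a2] := A01 r.
    by apply: ler_pM => //; [rewrite ger0_norm|apply: HC; apply/andP; split; lra].
  have b2 p q : p <= q -> 0 <= p -> q <= 1 -> `|RI p q h| <= C * (q - p).
    by move=> pq p0 q1'; apply: RI_norm_ub => // r /andP[r1 r2]; apply: HC; apply/andP; split; lra.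
  have := b1 _ _ q2 q1 ltac:(lra); have := b1 _ _ q4 ltac:(lra) q5.
  have := b2 _ _ q6 ltac:(lra) ltac:(lra); have := b2 _ _ q7 ltac:(lra) ltac:(lra).
  rewrite !ler_norml => /andP[? ?] /andP[? ?] /andP[? ?] /andP[? ?].
  by apply/andP; split; lra.
have half0 : 0 < 1 / 2 :> R by lra.
have half1 : 1 / 2 < 1 :> R by lra.
have Z t : 0 <= t <= 1 -> RI 0 (clamp01 t) h - RI 0 (clamp01 (1 / 2)) h = 0.
  move=> tI; apply: (@vanish_at_boundary _ (fun t => RI 0 (clamp01 t) h - RI 0 (clamp01 (1 / 2)) h) t 1) => //.
    by apply: continuous_sub; [exact: RI_clamp_continuous|exact: continuous_const].
  move=> s /andP[s0 s1] _; rewrite !clamp01_id; [|apply/andP; split; lra|by rewrite !ltW].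
  have [sh|hs|->] := ltgtP s (1 / 2); last by rewrite subrr.
  - rewrite (RI_split lh (ltW s0) (ltW sh)) (inside _ _ s0 sh half1).
    by rewrite opprD addrA subrr sub0r oppr0.
  - by rewrite (RI_split lh (ltW half0) (ltW hs)) (inside _ _ half0 hs s1) addr0 subrr.
move=> s t s0 st t1.
have := Z s; have := Z t; rewrite s0 t1 (le_trans s0 st) (le_trans st t1) => /(_ isT) Zt /(_ isT) Zs.
rewrite !(clamp01_id (t := t)) ?t1 ?(le_trans s0 st)// in Zt.
rewrite !(clamp01_id (t := s)) ?s0 ?(le_trans st t1)// in Zs.
by have := RI_split lh s0 st; lra.
Qed.

End steps_in_time.

(** * Mollification *)

Section mollifier.
Context {R : realType}.
Notation mR := (measurableTypeR R).
Notation leb := (@lebesgue_measure R).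
Implicit Types (f : R -> R) (F : R -> R -> R) (a b c x z h e K : R).

Lemma Rintegral_itv a b f : (forall z, ~~ (a <= z <= b) -> f z = 0) ->
  \int[leb]_z f z = RI a b f.
Proof.
move=> H; rewrite /RI [RHS]Rintegral_mkcond; apply: eq_Rintegral => z _.
rewrite patchE; case: ifPn => // zab; apply: H; apply: contra zab => zab.
by rewrite inE /= in_itv.
Qed.

Lemma measurable_Rintegral d (T : measurableType d) (F : T -> R -> R) :
  measurable_fun setT (fun z : T * mR => F z.1 z.2 : mR) ->
  measurable_fun setT (fun t => \int[leb]_x F t x : mR).
Proof.
move=> mF; pose H (z : T * mR) : \bar R := (F z.1 z.2)%:E.
have mH : measurable_fun setT H by exact/measurable_EFinP.
have -> : (fun t => \int[leb]_x F t x) =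
    (fun t => fine ((fubini_F leb H^\+ t) - (fubini_F leb H^\- t))%E).
  apply/funext => t; rewrite /Rintegral; congr fine; rewrite [LHS]integralE /fubini_F.
  by congr (_ - _)%E; apply: eq_integral => x _; rewrite ?funeposE ?funenegE.
apply: measurableT_comp; first exact: fine_measurable.
apply: emeasurable_funB; apply: measurable_fun_fubini_tonelli_F => //.
- exact: measurable_funepos.
- exact: measurable_funeneg.
Qed.

(** The rescaled mollifier with its derivatives, written as [jetZ] and [jet_affine] produce it. *)
Definition kern e k x : R := e^-1 * (e^-1 ^+ k * eta k (e^-1 * x + 0)).

Lemma jet_kern e : jet (kern e).
Proof. apply: jetZ; apply: jet_affine; exact: jet_eta. Qed.

Lemma kern_supp e k x : 0 < e -> e <= `|x| -> kern e k x = 0.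
Proof.
move=> e0 ex; rewrite /kern eta_supp ?mulr0// addr0 normrM normfV (gtr0_norm e0).
by rewrite mulrC ler_pdivlMr// mul1r.
Qed.

Lemma kern_ge0 e x : 0 < e -> 0 <= kern e 0 x.
Proof.
move=> e0; have i0 : 0 <= e^-1 by rewrite invr_ge0 ltW.
by rewrite /kern expr0 mul1r mulr_ge0 ?eta_ge0.
Qed.

Lemma kern_bounded e k : exists2 M, 0 <= M & forall x, `|kern e k x| <= M.
Proof.
have [M M0 HM] := @eta_bounded R k.
exists (`|e^-1| * (`|e^-1 ^+ k| * M)) => [|x]; first by rewrite !mulr_ge0.
by rewrite 2!normrM; apply: ler_wpM2l => //; apply: ler_wpM2l => //; exact: HM.
Qed.

(** All derivatives fall on the kernel, so [moll e f k] is the derivative of order [k] of the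
    mollification of [f]. *)
Definition moll e f k x : R := \int[leb]_z (f z * kern e k (x - z)).

Lemma lbm_kern e k x : lbm (fun z => kern e k (x - z)).
Proof.
have j := jet_affine (-1) x (jet_kern e).
have := lbm_jet k j.
rewrite (_ : (fun z => kern e k (x - z)) = fun z => (-1) ^+ k * ((-1) ^+ k * kern e k (-1 * z + x))).
  exact: lbmZ.
by apply/funext => z; rewrite mulrA -exprMn mulrNN mulr1 expr1n mul1r mulN1r addrC.
Qed.

Lemma lbm_fkern e f k x : lbm f -> lbm (fun z => f z * kern e k (x - z)).
Proof. by move=> lf; apply: lbmM => //; exact: lbm_kern. Qed.

Lemma moll_itv e f k x a b : 0 < e -> a <= x - e -> x + e <= b ->
  moll e f k x = RI a b (fun z => f z * kern e k (x - z)).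
Proof.
move=> e0 ax xb; apply: Rintegral_itv => z; rewrite negb_and -!ltNge => zab.
rewrite kern_supp ?mulr0//; case/orP: zab => zab.
  by rewrite ger0_norm; lra.
by rewrite ler0_norm; lra.
Qed.

Lemma jet_moll e f : 0 < e -> e <= 1 -> lbm f -> jet (moll e f).
Proof.
move=> e0 e1 lf k x.
have [M M0 HM] := kern_bounded e k.+2.
have [C HC] := lf.2 (`|x| + 2).
have C0 : 0 <= C by apply: le_trans (HC x _); rewrite ?lerDl.
apply: (@der_quadratic _ _ _ _ (C * M * (x + 2 - (x - 2)))) => h.
rewrite ler_norml => /andP[h1 h2].
(* Since [e <= 1], one segment around [x] carries all the kernels centred within distance 1, and
   Taylor's estimate for the kernel can be integrated over it. *)
have i y j : x - 1 <= y -> y <= x + 1 ->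
    moll e f j y = RI (x - 2) (x + 2) (fun z => f z * kern e j (y - z)).
  by move=> y1 y2; apply: moll_itv => //; lra.
rewrite !i; try lra.
have l j y := lbm_fkern e j y lf.
rewrite -RI_B// -RI_Z// -RI_B; [|exact: lbmB|exact: lbmZ].
rewrite -[C * M * _ * _]mulrAC.
apply: RI_norm_ub.
- by apply: lbmB; [exact: lbmB|exact: lbmZ].
- lra.
move=> z /andP[z1 z2].
have -> : f z * kern e k (x + h - z) - f z * kern e k (x - z) - h * (f z * kern e k.+1 (x - z)) =
  f z * (kern e k ((x - z) + h) - kern e k (x - z) - h * kern e k.+1 (x - z)).
  by rewrite (_ : x + h - z = x - z + h); ring.
rewrite normrM -mulrA; apply: ler_pM => //.
  apply: HC; have := ler_norm x; have := ler_norm (- x); rewrite normrN ler_norml => ? ?.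
  by apply/andP; split; lra.
exact: taylor1 (jet_kern e k) (jet_kern e k.+1) HM.
Qed.

Lemma moll_cst e c x : 0 < e -> moll e (fun=> c) 0 x = c.
Proof.
move=> e0; rewrite (@moll_itv _ _ _ _ (x - e) (x + e))// RI_Z; last exact: lbm_kern.
have eN0 : e != 0 by rewrite gt_eqF.
pose S z : R := - smooth_step 0 (- e^-1 * z + x / e).
have dS z : is_derive z 1 S (kern e 0 (x - z)).
  have d1 := derD (derZ (- e^-1) (der_id z)) (der_cst (x / e) z).
  apply: is_derive_ext (derN (der_comp (g := fun z => - e^-1 * z + x / e) (@jet_smooth_step R 0 _) d1)) _ _ => //.
  rewrite /kern expr0 mul1r !addr0 (_ : - e^-1 * z + x / e = e^-1 * (x - z)); last by ring.
  by rewrite -[smooth_step 1 _]/(eta 0 _); ring.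
have cS : continuous (fun z => kern e 0 (x - z)).
  move=> z; have j := jet_affine (-1) x (jet_kern e).
  have := @jet_continuous _ _ 0 j z.
  rewrite (_ : (fun z0 => _ * kern _ _ _) = (fun z => kern e 0 (x - z)))//.
  by apply/funext => y; rewrite expr0 mul1r mulN1r addrC.
have le : x - e <= x + e by lra.
rewrite (RI_FTC le cS dS) /S.
rewrite (smooth_step_le0 (x := - e^-1 * (x + e) + x / e)).
  rewrite (smooth_step_ge1 (x := - e^-1 * (x - e) + x / e)); first ring.
  by rewrite le_eqVlt; apply/orP; left; apply/eqP; field.
by rewrite le_eqVlt; apply/orP; left; apply/eqP; field.
Qed.

Lemma moll_cst_der e c k x : 0 < e -> e <= 1 -> moll e (fun=> c) k.+1 x = 0.
Proof.
move=> e0 e1; have j := jet_moll e0 e1 (@lbm_cst R c).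
elim: k x => [|k IH] x.
  have := j 0%N x; rewrite (_ : moll e (fun=> c) 0 = fun=> c); last by apply/funext => z; exact: moll_cst.
  move=> d; have [_ <-] := d; exact: derive_cst.
have := j k.+1 x; rewrite (_ : moll e (fun=> c) k.+1 = fun=> 0); last by apply/funext => z; exact: IH.
move=> d; have [_ <-] := d; exact: derive_cst.
Qed.

Lemma mollB e f g k x : 0 < e -> lbm f -> lbm g ->
  moll e (fun z => f z - g z) k x = moll e f k x - moll e g k x.
Proof.
move=> e0 lf lg; rewrite !(@moll_itv _ _ _ _ (x - e) (x + e))//.
rewrite -RI_B; [|exact: lbm_fkern|exact: lbm_fkern].
by apply: eq_RI => z _; rewrite mulrBl.
Qed.

Lemma moll_le e f x c K : 0 < e -> lbm f ->
  (forall z, `|z - x| <= e -> `|f z - c| <= K) -> `|moll e f 0 x - c| <= K.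
Proof.
move=> e0 lf H; have lc := @lbm_cst R c.
rewrite -{1}(moll_cst c x e0) -mollB// (@moll_itv _ _ _ _ (x - e) (x + e))//.
have lfc := lbmB lf lc.
have lfk := lbm_fkern e 0 x lfc.
apply: le_trans (RI_norm _ _ lfk) _; rewrite -[leRHS](moll_cst K x e0).
rewrite (@moll_itv _ _ _ _ (x - e) (x + e))//; apply: RI_le.
- exact: lbm_norm.
- exact: lbm_fkern (lbm_cst K).
move=> z /andP[z1 z2]; rewrite normrM (ger0_norm (kern_ge0 _ e0)).
apply: ler_wpM2r; first exact: kern_ge0.
by apply: H; rewrite ler_norml; apply/andP; split; lra.
Qed.

(** Derivatives of a mollified constant vanish, so only the oscillation of [f] near [x] counts. A
    weak solution may grow in [x], and this still bounds its mollified derivatives uniformly. *)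
Lemma moll_der_le e k : 0 < e -> e <= 1 -> exists2 C, 0 <= C & forall f x c K, lbm f ->
  (forall z, `|z - x| <= e -> `|f z - c| <= K) -> `|moll e f k.+1 x| <= K * C.
Proof.
move=> e0 e1; have [M M0 HM] := kern_bounded e k.+1.
exists (M * (e + e)) => [|f x c K lf H]; first by rewrite mulr_ge0//; lra.
have lc := @lbm_cst R c; have lfc := lbmB lf lc.
rewrite -[moll _ _ _ _]subr0 -{1}(moll_cst_der c k x e0 e1) -mollB//.
rewrite (@moll_itv _ _ _ _ (x - e) (x + e))// mulrA.
rewrite (_ : e + e = x + e - (x - e)); last by ring.
apply: RI_norm_ub; first exact: lbm_fkern lfc.
- lra.
move=> z /andP[z1 z2]; rewrite normrM; apply: ler_pM => //.
by apply: H; rewrite ler_norml; apply/andP; split; lra.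
Qed.

Lemma lbm2_moll e F k : 0 < e -> lbm2 F -> lbm2 (fun t x => moll e (F t) k x).
Proof.
move=> e0 [mF bF]; have [M M0 HM] := kern_bounded e k; split.
  pose G (p : mR * mR) z := F p.1 z * kern e k (p.2 - z).
  have -> : (fun z : mR * mR => moll e (F z.1) k z.2) = (fun p => \int[leb]_z G p z) by [].
  apply: measurable_Rintegral; apply: measurable_funM.
    apply: (measurableT_comp mF (_ : measurable_fun setT (fun q : (mR * mR) * mR => (q.1.1, q.2)))).
    apply: measurable_fun_pair; last exact: measurable_snd.
    exact: (measurableT_comp measurable_fst measurable_fst).
  have lk := (lbm_jet k (jet_kern e)).1.
  apply: (measurableT_comp lk (_ : measurable_fun setT (fun q : (mR * mR) * mR => q.1.2 - q.2))).
  apply: measurable_funB; last exact: measurable_snd.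
  exact: (measurableT_comp measurable_snd measurable_fst).
move=> N; have [C HC] := bF (N + e); exists (C * M * (e + e)) => t x tN xN.
rewrite (@moll_itv _ _ _ _ (x - e) (x + e))// (_ : e + e = x + e - (x - e)); last by ring.
apply: RI_norm_ub; first by apply: lbm_fkern; apply: (@lbm2_sectl _ F t); split.
- lra.
move: xN; rewrite ler_norml => /andP[x1 x2] z /andP[z1 z2]; rewrite normrM; apply: ler_pM => //.
apply: HC; first lra.
by rewrite ler_norml; apply/andP; split; lra.
Qed.

End mollifier.

(** * Mollification at vanishing scale *)

Section mollifier_limits.
Context {R : realType}.
Notation mR := (measurableTypeR R).
Notation leb := (@lebesgue_measure R).
Implicit Types (f : R -> R) (F : R -> R -> R) (a b c x z h e K : R).

Lemma RI_param_continuous a b F : continuous (fun z : R * R => F z.1 z.2) ->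
  continuous (fun t => RI a b (F t)).
Proof.
move=> cF t; have lF := lbm2_continuous cF.
have [C HC] := lF.2 (`|t| + 1 + (`|a| + `|b|)).
apply: (@continuity_under_integral _ _ mR leb F `[a, b] (measurable_itv _) (t - 1) (t + 1) _ _ (fun=> C)).
- by move=> s _; apply: lbm_integrable; exact: lbm2_sectl.
- by apply: aeW => y _ s _; exact: continuous_pairr.
- exact: (lbm_integrable _ _ (lbm_cst C)).
- move=> s; rewrite /= in_itv/= => /andP[s1 s2]; apply: aeW => y; rewrite /= in_itv/= => /andP[y1 y2].
  have := normr_ge0 a; have := normr_ge0 b; have := normr_ge0 t.
  have := ler_norm t; have := ler_norm (- t); have := ler_norm b; have := ler_norm (- a).
  rewrite !normrN => *; apply: HC; rewrite ler_norml; apply/andP; split; lra.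
- by rewrite inE /= in_itv/=; apply/andP; split; lra.
Qed.

Lemma moll_continuous e F k x : 0 < e -> continuous (fun z : R * R => F z.1 z.2) ->
  continuous (fun t => moll e (F t) k x).
Proof.
move=> e0 cF; rewrite (_ : (fun t => _) = fun t => RI (x - e) (x + e) (fun z => F t z * kern e k (x - z))); last first.
  by apply/funext => t; apply: moll_itv.
apply: (@RI_param_continuous _ _ (fun t z => F t z * kern e k (x - z))) => z.
apply: cvgM; first exact: cF.
have ck := @jet_continuous _ _ k (jet_kern e).
apply: (@continuous_comp _ _ _ (fun z : R * R => x - z.2) (kern e k)); last exact: ck.
by apply: cvgB; [exact: cvg_cst|exact: cvg_snd].
Qed.

(** The kernel is at most [E / e] on an interval of length [2 e], so the error is at most [2 E]
    times the mean deviation of [f] from [f x]. *)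
Lemma lebesgue_pt_moll f x : lbm f -> lebesgue_pt f x ->
  moll n.+1%:R^-1 f 0 x @[n --> \oo] --> f x.
Proof.
move=> lf /cvge_at_rightP H.
have [E E0 HE] := @eta_bounded R 0.
have n0 (n : nat) : 0 < n.+1%:R^-1 :> R by rewrite invr_gt0.
have /fine_cvgP[_ D0] : davg f x n.+1%:R^-1 @[n --> \oo] --> (0 : R)%:E.
  by apply: H; split => //; exact: cvg_harmonic.
have key n : `|moll n.+1%:R^-1 f 0 x - f x| <= 2 * E * fine (davg f x n.+1%:R^-1).
  set e := n.+1%:R^-1; have e0 : 0 < e by exact: n0.
  pose I := RI (x - e) (x + e) (fun z => `|f z - f x|).
  have lc := lbm_cst (f x); have lfc := lbmB lf lc.
  have lfn := lbm_norm lfc.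
  have -> : fine (davg f x e) = (e *+ 2)^-1 * I.
    rewrite /davg /iavg ball_itv -ball_itv lebesgue_measure_ball ?ltW// ball_itv.
    have -> : (\int[leb]_(y in `](x - e)%R, (x + e)%R[) `|((center (f x) \o f) y)%:E| = I%:E)%E.
      rewrite -[LHS]/(\int[leb]_(y in `](x - e)%R, (x + e)%R[) (`|f y - f x|)%:E)%E.
      have i1 := lbm_integrable (x - e) (x + e) lfn.
      rewrite integral_itv_bndo_bndc; last by apply: (measurable_int leb); apply: integrableS i1 => //; exact: subset_itv_oo_cc.
      rewrite integral_itv_obnd_cbnd; last by apply: (measurable_int leb); apply: integrableS i1 => //; exact: subset_itv_oc_cc.
      by rewrite /I /RI /Rintegral fineK//; exact: integrable_fin_num.
    by rewrite inver gt_eqF ?pmulrn_lgt0//.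
  rewrite -{1}(moll_cst (f x) x e0) -mollB// (@moll_itv _ _ _ _ _ (x - e) (x + e))//.
  apply: le_trans (RI_norm _ _ (lbm_fkern e 0 x lfc)) _.
  have -> : 2 * E * ((e *+ 2)^-1 * I) = (e^-1 * E) * I.
    by rewrite -[e *+ 2]mulr_natl; field; rewrite gt_eqF.
  rewrite -RI_Z//; apply: RI_le.
  - by apply: lbm_norm; exact: lbm_fkern.
  - exact: lbmZ.
  move=> z _; rewrite normrM mulrC; apply: ler_wpM2r => //.
  rewrite /kern expr0 mul1r normrM gtr0_norm ?invr_gt0//.
  by apply: ler_wpM2l (HE _); rewrite invr_ge0 ltW.
apply/cvgrPdist_le => d d0.
have K0 : 0 < 2 * E + 1 by rewrite ltr_wpDl// mulr_ge0.
have dK : 0 < d / (2 * E + 1) by rewrite divr_gt0.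
have /cvgrPdist_le/(_ _ dK) Dd := D0.
near=> n; rewrite distrC; apply: le_trans (key n) _.
have : `|0 - fine (davg f x n.+1%:R^-1)| <= d / (2 * E + 1) by near: n.
rewrite sub0r normrN ger0_norm ?fine_ge0 ?davg_ge0// ler_pdivlMr// mulrC.
apply: le_trans; apply: ler_wpM2r; first by rewrite fine_ge0// davg_ge0.
by rewrite lerDl.
Unshelve. all: by end_near. Qed.

Lemma lbm_locally_integrable f : lbm f -> locally_integrable setT f.
Proof.
move=> lf; split; [exact: lf.1|exact: openT|].
move=> K _ cK; have /compact_bounded[C0 [_ HC]] := cK.
have KI : K `<=` `[- (C0 + 1), C0 + 1].
  by move=> z Kz; rewrite /= in_itv/= -ler_norml; apply: (HC (C0 + 1)) => //; rewrite ltrDl.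
have mK : measurable (K : set mR) by exact: compact_measurable.
have : leb.-integrable K (EFin \o f).
  by apply: integrableS (lbm_integrable (- (C0 + 1)) (C0 + 1) lf) => //; exact: measurable_itv.
by move=> /integrableP[].
Qed.

Lemma ae_moll_cvg f : lbm f ->
  {ae leb, forall x, moll n.+1%:R^-1 f 0 x @[n --> \oo] --> f x}.
Proof.
move=> lf; apply: ae_imp (lebesgue_differentiation (lbm_locally_integrable lf)) _ => x.
exact: lebesgue_pt_moll.
Qed.

End mollifier_limits.

(** * From averages to pointwise statements *)

Section averages.
Context {R : realType}.
Notation mR := (measurableTypeR R).
Notation leb := (@lebesgue_measure R).
Implicit Types (f g h : R -> R) (F : R -> R -> R) (a b c s t x z e K M : R).

Lemma eq_RI_ae a b f g : lbm f -> lbm g ->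
  {ae leb, forall x, a < x < b -> f x = g x} -> RI a b f = RI a b g.
Proof.
move=> lf lg fg.
have oo u : lbm u -> RI a b u = \int[leb]_(x in `]a, b[) u x.
  move=> lu; have iu := lbm_integrable a b lu.
  rewrite [RHS]Rintegral_itv_bndo_bndc; last first.
    by apply: integrableS iu => //; exact: subset_itv_oo_cc.
  rewrite Rintegral_itv_obnd_cbnd//.
  by apply: integrableS iu => //; exact: subset_itv_oc_cc.
rewrite !oo// /Rintegral; congr fine; apply: ae_eq_integral => //.
- by apply/measurable_EFinP; apply: measurable_funS lf.1.
- by apply/measurable_EFinP; apply: measurable_funS lg.1.
- by apply: ae_imp fg _ => x H /=; rewrite in_itv/= => /H ->.
Qed.

Lemma ae_zero_of_RI h : lbm h ->
  (forall s t, 0 <= s -> s <= t -> t <= 1 -> RI s t h = 0) ->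
  {ae leb, forall t, 0 < t < 1 -> h t = 0}.
Proof.
move=> lh H; apply: ae_imp (lebesgue_differentiation (lbm_locally_integrable lh)) _ => t ht /andP[t0 t1].
have := @FTC1_lebesgue_pt _ h (BLeft 0) t 1 t1 (lbm_integrable 0 1 lh).
move=> /(_ _ ht)[|_ <-]; first by rewrite lte_fin.
have E : \forall y \near t, (fun=> 0) y = \int[leb]_(r in `[0, y]) h r.
  near=> y; rewrite -/(RI 0 y h) H//; apply: ltW; first by near: y; exact: lt_nbhsr.
  by near: y; exact: lt_nbhsl.
have d : is_derive t 1 (fun y => \int[leb]_(r in `[0, y]) h r) 0.
  by apply: near_eq_is_derive E _; rewrite ?oner_neq0//; exact: der_cst.
rewrite derive1E; have [_] := d; exact.
Unshelve. all: by end_near. Qed.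

(** [f] and [h] share their averages on all subintervals, and a continuous function is the limit of
    its averages. One-sided intervals reach the endpoints: to the right of [t] if [t = 0], to the
    left otherwise. *)
Lemma continuous_avg_le f h M : continuous f -> lbm h -> (forall t, `|h t| <= M) ->
  (forall s t, 0 <= s -> s <= t -> t <= 1 -> RI s t (fun r => h r - f r) = 0) ->
  forall t, 0 <= t <= 1 -> `|f t| <= M.
Proof.
move=> cf lh hM H t /andP[t0 t1]; apply/ler_addgt0Pr => d d0.
have lf := lbm_continuous cf.
have /cvgrPdist_le/(_ _ d0)/nbhs_ballP[r /= r0 Hr] := cf t.
have [a [b [a0 ab b1 abt]]] : exists a b, [/\ 0 <= a, a < b, b <= 1 & forall z, a <= z <= b -> ball t r z].
  have [te|tn] := eqVneq t 0.
    exists 0, (Num.min 1 (r / 2)); split => //.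
    - by rewrite lt_min ltr01 divr_gt0.
    - by rewrite ge_min lexx.
    - move=> z /andP[z0]; rewrite le_min => /andP[z1 zr].
      by rewrite te /ball/= sub0r normrN ger0_norm//; lra.
  exists (Num.max 0 (t - r / 2)), t; split => //.
  - by rewrite le_max lexx.
  - by rewrite gt_max lt_neqAle eq_sym tn t0/=; lra.
  - move=> z /andP[]; rewrite ge_max => /andP[z0 zr] zt.
    by rewrite /ball/= ger0_norm; lra.
have abl := ltW ab.
have E : RI a b h = RI a b f.
  by apply/eqP; rewrite -subr_eq0 -RI_B// H.
have lft : lbm (fun z => f t - f z) by apply: lbmB => //; exact: lbm_cst.
have E2 : f t * (b - a) = RI a b (fun z => f t - f z) + RI a b h.
  by rewrite RI_B//; [rewrite RI_cst// E subrK|exact: lbm_cst].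
have n1 : `|RI a b (fun z => f t - f z)| <= d * (b - a).
  by apply: RI_norm_ub => // z /abt; exact: Hr.
have n2 : `|RI a b h| <= M * (b - a) by apply: RI_norm_ub.
have ba : 0 < b - a by rewrite subr_gt0.
rewrite -(ler_pM2r ba).
have -> : `|f t| * (b - a) = `|f t * (b - a)| by rewrite normrM (gtr0_norm ba).
by rewrite E2; apply: le_trans (ler_normD _ _) _; rewrite mulrDl addrC lerD.
Qed.

(** The kernel as a function of the integration variable [z]; the sign comes from differentiating in
    [z] instead of [x]. *)
Definition test_jet e x k z := (-1) ^+ k * kern e k (-1 * z + x).

Lemma jet_test_jet e x : jet (test_jet e x).
Proof. exact: jet_affine (jet_kern e). Qed.

Lemma test_jet_supp e x N k z : 0 < e -> `|x| + e <= N -> N < `|z| -> test_jet e x k z = 0.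
Proof.
move=> e0 xN zN; rewrite /test_jet kern_supp ?mulr0// mulN1r addrC.
have : `|z| <= `|x - z| + `|x|.
  by rewrite -[z in leLHS](subKr x) (le_trans (ler_normB _ _))// addrC.
by lra.
Qed.

Lemma RI_test_jet e x N k f : lbm f -> 0 < e -> `|x| + e <= N ->
  RI (- N) N (fun z => f z * test_jet e x k z) = (-1) ^+ k * moll e f k x.
Proof.
move=> lf e0 xN; have := ler_norm x; have := ler_norm (- x); rewrite normrN => x1 x2.
rewrite (@moll_itv _ _ _ _ _ (- N) N)//; try lra.
rewrite -RI_Z; last exact: lbm_fkern.
by apply: eq_RI => z _; rewrite /test_jet mulrCA mulN1r addrC.
Qed.

Lemma moll_near f x d : continuous f -> 0 < d ->
  exists2 e0, 0 < e0 & forall e, 0 < e -> e <= e0 -> `|moll e f 0 x - f x| <= d.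
Proof.
move=> cf d0; have /cvgrPdist_le/(_ _ d0)/nbhs_ballP[r /= r0 Hr] := cf x.
exists (r / 2); first by rewrite divr_gt0.
move=> e e0 er; apply: moll_le => //; first exact: lbm_continuous.
by move=> z zx; rewrite distrC; apply: Hr; rewrite /ball/= distrC; lra.
Qed.

Lemma moll_lipschitz f M : continuous f -> 
  (forall e, 0 < e -> e <= 1 -> forall x, `|moll e f 1 x| <= M) ->
  forall x y, `|f x - f y| <= M * `|x - y|.
Proof.
move=> cf H x y; apply/ler_addgt0Pr => d d0; have d2 : 0 < d / 2 by rewrite divr_gt0.
have [e1 e10 H1] := moll_near x cf d2; have [e2 e20 H2] := moll_near y cf d2.
pose e := Num.min 1 (Num.min e1 e2).
have e0 : 0 < e by rewrite !lt_min ltr01 e10.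
have e1' : e <= 1 by rewrite ge_min lexx.
have k1 : `|moll e f 0 x - f x| <= d / 2 by apply: H1 => //; rewrite !ge_min lexx/= orbT.
have k2 : `|moll e f 0 y - f y| <= d / 2 by apply: H2 => //; rewrite !ge_min lexx/= !orbT.
have k3 := lipschitz_is_derive y x (jet_moll e0 e1' (lbm_continuous cf) 0) (H e e0 e1').
move: (moll e f 0 x) (moll e f 0 y) k1 k2 k3 => a b k1 k2 k3.
have -> : f x - f y = (a - b) - (a - f x) + (b - f y) by ring.
apply: le_trans (ler_normD _ _) _; apply: le_trans (lerD (ler_normB _ _) (lexx _)) _.
by lra.
Qed.

End averages.

(** * Energy estimate and uniqueness *)

Section energy.
Context {R : realType}.
Implicit Types (s t x N : R).

Definition weight x : R := (1 + x ^+ 2)^-1.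
Definition weight_der x : R := - (2 * x) * weight x ^+ 2.

Lemma weight_den_gt0 x : 0 < 1 + x ^+ 2.
Proof. by rewrite ltr_pwDl// sqr_ge0. Qed.

Lemma weight_gt0 x : 0 < weight x.
Proof. by rewrite invr_gt0 weight_den_gt0. Qed.

Lemma weight_le1 x : weight x <= 1.
Proof. by rewrite invf_le1 ?weight_den_gt0// lerDl sqr_ge0. Qed.

Lemma der_weight x : is_derive x 1 weight (weight_der x).
Proof.
have n0 : 1 + x ^+ 2 != 0 by rewrite gt_eqF// weight_den_gt0.
have d := derD (der_cst 1 x) (derM (der_id x) (der_id x)).
have e : (fun y : R => 1 + y * y) = (fun y => 1 + y ^+ 2) by apply/funext => y; rewrite expr2.
rewrite e in d; apply: is_derive_ext (is_deriveV (f := fun y => 1 + y ^+ 2) n0 d) _ _ => //.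
rewrite /weight_der /weight -[_ *: _]/(_ * _) exprVn; ring.
Qed.

Lemma weight_der_le x : `|weight_der x| <= weight x.
Proof.
rewrite /weight_der normrM normrN [`|weight x ^+ 2|]ger0_norm ?sqr_ge0// expr2 mulrA.
apply: ler_piMl; first exact/ltW/weight_gt0.
rewrite /weight ler_pdivrMr ?weight_den_gt0// mul1r.
by rewrite ler_norml; apply/andP; split; have := sqr_ge0 (x - 1); have := sqr_ge0 (x + 1); rewrite !expr2; lra.
Qed.

Lemma weight_continuous : continuous weight.
Proof. exact: der_continuous der_weight. Qed.

Lemma weight_der_continuous : continuous weight_der.
Proof.
move=> x; apply: cvgM.
  by apply: cvgN; apply: cvgM; [exact: cvg_cst|exact: cvg_id].
by rewrite (_ : (fun x => _) = (fun x => weight x * weight x))//; apply: cvgM; exact: weight_continuous.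
Qed.

Lemma weight_decreasing x y : `|x| <= `|y| -> weight y <= weight x.
Proof.
move=> xy; rewrite lef_pV2 ?posrE ?weight_den_gt0// lerD2l.
by rewrite -(real_normK (num_real x)) -(real_normK (num_real y)) lerXn2r.
Qed.

(* Young's inequality absorbs the first-order terms into the dissipation [q * d1 ^+ 2]. *)
Lemma energy_pointwise (q q' d d1 p a r A K : R) : 0 <= q -> q <= 1 -> `|q'| <= q -> 0 <= a -> a <= 1 ->
  `|p| <= A -> `|d| <= K ->
  - ((q' * d + q * d1) * d1) + q * (d * (a * (d1 * p + r))) <= (A + 1) ^+ 2 / 4 * (q * d ^+ 2) + K * `|r|.
Proof.
move=> q0 q1 q'q a0 a1 pA dK.
pose X := `|d|; pose Z := `|d1|.
have X0 : 0 <= X by exact: normr_ge0.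
have Z0 : 0 <= Z by exact: normr_ge0.
have A0 : 0 <= A by exact: le_trans pA.
have dX : d ^+ 2 = X ^+ 2 by rewrite real_normK// num_real.
have dZ : d1 ^+ 2 = Z ^+ 2 by rewrite real_normK// num_real.
have t1 : - (q' * d * d1) <= q * (X * Z).
  by apply: le_trans (ler_norm _) _; rewrite normrN 2!normrM -mulrA; apply: ler_wpM2r => //; exact: mulr_ge0.
have t2 : q * (d * (a * (d1 * p))) <= q * (A * (X * Z)).
  apply: ler_wpM2l => //; apply: le_trans (ler_norm _) _; rewrite 3!normrM (ger0_norm a0) -/X -/Z.
  have -> : A * (X * Z) = X * (1 * (Z * A)) by ring.
  apply: ler_wpM2l => //; apply: ler_pM => //; first by rewrite mulr_ge0.
  exact: ler_wpM2l.
have t3 : q * (d * (a * r)) <= K * `|r|.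
  apply: le_trans (ler_norm _) _; rewrite 3!normrM (ger0_norm a0) (ger0_norm q0).
  have -> : K * `|r| = 1 * (K * (1 * `|r|)) by ring.
  apply: ler_pM => //; first by rewrite !mulr_ge0.
  apply: ler_pM => //; first by rewrite !mulr_ge0.
  exact: ler_wpM2r.
have t4 : q * ((1 + A) * (X * Z) - Z ^+ 2) <= q * ((A + 1) ^+ 2 / 4 * X ^+ 2).
  apply: ler_wpM2l => //; have := sqr_ge0 ((A + 1) / 2 * X - Z).
  have -> : ((A + 1) / 2 * X - Z) ^+ 2 = (A + 1) ^+ 2 / 4 * X ^+ 2 - ((1 + A) * (X * Z) - Z ^+ 2) by field.
  by rewrite subr_ge0.
have -> : - ((q' * d + q * d1) * d1) + q * (d * (a * (d1 * p + r))) =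
  - (q' * d * d1) - q * d1 ^+ 2 + q * (d * (a * (d1 * p))) + q * (d * (a * r)) by ring.
rewrite dX dZ.
have e4 : q * ((1 + A) * (X * Z) - Z ^+ 2) = q * (X * Z) + q * (A * (X * Z)) - q * Z ^+ 2 by ring.
have e5 : q * ((A + 1) ^+ 2 / 4 * X ^+ 2) = (A + 1) ^+ 2 / 4 * (q * X ^+ 2) by ring.
by rewrite e4 e5 in t4; lra.
Qed.

(** [D] stands for [y_eps - u], with its derivatives [D1] and [D2] in [x], [p] for the sum of the
    two first derivatives, and [r] for the residual; then [D1 p + r] is [(v^2)_eps - u_x^2]. *)
Variables (alpha w : R -> R) (D D1 D2 p r : R -> R -> R) (A K W N : R).
Hypothesis alpha01 : forall t, 0 <= alpha t <= 1.
Hypothesis la : lbm alpha.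
Hypothesis lw : lbm w.
Hypothesis w0 : forall t, 0 <= w t.
Hypothesis wW : forall t, 0 <= t <= 1 -> w t <= W.
Hypothesis lD : lbm2 D.
Hypothesis lD1 : lbm2 D1.
Hypothesis lD2 : lbm2 D2.
Hypothesis lp : lbm2 p.
Hypothesis lr : lbm2 r.
Hypothesis dD : forall t x, is_derive x 1 (D t) (D1 t x).
Hypothesis dD1 : forall t x, is_derive x 1 (D1 t) (D2 t x).
Hypothesis cD2 : forall t, continuous (D2 t).
Hypothesis pA : forall t x, 0 <= t <= 1 -> `|p t x| <= A.
Hypothesis D1A : forall t x, 0 <= t <= 1 -> `|D1 t x| <= A.
Hypothesis DK : forall t x, 0 <= t <= 1 -> `|D t x| <= K.
Hypothesis N0 : 0 <= N.
Hypothesis primD : forall x,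
  prim (fun t => - (w t / 2 * (D2 t x + alpha t * (D1 t x * p t x + r t x)))) (D ^~ x).

Let NN : - N <= N. Proof. by rewrite -subr_ge0 opprK addr_ge0. Qed.
Let lq : lbm weight. Proof. exact: lbm_continuous weight_continuous. Qed.
Let tI01 : 0 <= (0 : R) <= 1. Proof. by rewrite lexx ler01. Qed.
Let A0 : 0 <= A. Proof. exact: le_trans (pA 0 tI01). Qed.
Let K0 : 0 <= K. Proof. exact: le_trans (DK 0 tI01). Qed.
Let W0 : 0 <= W. Proof. exact: le_trans (wW tI01). Qed.

Definition energy t := RI (- N) N (fun x => weight x * D t x ^+ 2).

Let G t x := alpha t * (D1 t x * p t x + r t x).

Let lG : lbm2 G.
Proof. by apply: lbm2M; [exact: lbm2_fst|apply: lbm2D => //; exact: lbm2M]. Qed.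

Let lD22 : lbm2 (fun t x => D t x ^+ 2).
Proof. exact: (lbm2M lD lD). Qed.

Let lqD2 : lbm2 (fun t x => weight x * D t x ^+ 2).
Proof. exact: (lbm2M (lbm2_snd lq) lD22). Qed.

Lemma lbm_energy : lbm energy.
Proof. exact: lbm_RI lqD2. Qed.

(** One integration by parts produces the dissipation used by [energy_pointwise]; each of the two
    boundary terms at [-N] and [N] is at most [weight N * K * A]. *)
Lemma energy_rate t : 0 <= t <= 1 ->
  RI (- N) N (fun x => weight x * (D t x * (D2 t x + G t x))) <=
  2 * weight N * K * A + (A + 1) ^+ 2 / 4 * energy t + K * RI (- N) N (fun x => `|r t x|).
Proof.
move=> tI; have lDt := lbm2_sectl t lD; have lD1t := lbm2_sectl t lD1; have lD2t := lbm2_sectl t lD2.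
have lGt := lbm2_sectl t lG; have lrt := lbm2_sectl t lr.
have cD := der_continuous (dD t); have cD1 := der_continuous (dD1 t).
pose P x := weight x * D t x; pose P' x := weight_der x * D t x + weight x * D1 t x.
have dP x : is_derive x 1 P (P' x) by exact: derM (der_weight x) (dD t x).
have cP' : continuous P'.
  move=> x; apply: cvgD; apply: cvgM; [exact: weight_der_continuous|exact: cD|exact: weight_continuous|exact: cD1].
have lP : lbm P by exact: lbmM.
have lP' : lbm P' by exact: lbm_continuous.
have bd x : `|x| = N -> `|P x * D1 t x| <= weight N * (K * A).
  move=> xN; rewrite normrM normrM -mulrA (gtr0_norm (weight_gt0 x)).
  have -> : weight x = weight N by rewrite /weight -(real_normK (num_real x)) xN.
  by apply: ler_wpM2l; [exact/ltW/weight_gt0|apply: ler_pM => //; [exact: DK|exact: D1A]].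
have parts := RI_parts NN cP' (@cD2 t) dP (dD1 t).
have lPD2 : lbm (fun x => P x * D2 t x) by exact: lbmM.
have lPG : lbm (fun x => weight x * (D t x * G t x)) by apply: lbmM => //; exact: lbmM.
have lP'D : lbm (fun x => P' x * D1 t x) by exact: lbmM.
have -> : RI (- N) N (fun x => weight x * (D t x * (D2 t x + G t x))) =
   P N * D1 t N - P (- N) * D1 t (- N) + RI (- N) N (fun x => - (P' x * D1 t x) + weight x * (D t x * G t x)).
  rewrite RI_D// ?RI_N//; last exact: lbmN.
  rewrite addrA -parts -RI_D//; apply: eq_RI => x _; rewrite /P; ring.
have b1 := bd N (ger0_norm N0).
have b2 : `|P (- N) * D1 t (- N)| <= weight N * (K * A) by apply: bd; rewrite normrN ger0_norm.
have b3 := ler_normB (P N * D1 t N) (P (- N) * D1 t (- N)).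
have b4 := ler_norm (P N * D1 t N - P (- N) * D1 t (- N)).
have l1 : lbm (fun x => (A + 1) ^+ 2 / 4 * (weight x * D t x ^+ 2)) by apply: lbmZ; exact: lbm2_sectl lqD2.
have l2 : lbm (fun x => K * `|r t x|) by apply: lbmZ; exact: lbm_norm.
have b5 : RI (- N) N (fun x => - (P' x * D1 t x) + weight x * (D t x * G t x)) <=
  (A + 1) ^+ 2 / 4 * energy t + K * RI (- N) N (fun x => `|r t x|).
  rewrite /energy -RI_Z; last exact: lbm2_sectl lqD2.
  rewrite -RI_Z; last exact: lbm_norm.
  rewrite -RI_D//; apply: RI_le.
  - by apply: lbmD => //; exact: lbmN.
  - exact: lbmD.
  move=> x _; have /andP[a0 a1] := alpha01 t; apply: energy_pointwise => //.
  - exact/ltW/weight_gt0.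
  - exact: weight_le1.
  - exact: weight_der_le.
  - exact: pA.
  - exact: DK.
move: b1 b2 b3 b4 b5.
move: (P N * D1 t N) (P (- N) * D1 t (- N)) (RI _ _ _) (RI _ _ _) (energy t) => a b c d E b1 b2 b3 b4 b5.
have -> : 2 * weight N * K * A = weight N * (K * A) + weight N * (K * A) by ring.
by move: (weight N * (K * A)) ((A + 1) ^+ 2 / 4 * E) (K * d) b1 b2 b5 => *; lra.
Qed.

(** [primM] is applied to the square of [D] at each fixed [x], and Fubini's theorem then integrates
    over [x]. *)
Lemma energy_identity s : 0 <= s <= 1 ->
  energy s = energy 1 + RI s 1 (fun t => w t * RI (- N) N (fun x => weight x * (D t x * (D2 t x + G t x)))).
Proof.
move=> /andP[s0 s1].
have lR : lbm2 (fun t x => w t / 2 * (D2 t x + G t x)).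
  apply: lbm2M; last exact: lbm2D.
  by apply: (lbm2_fst (f := fun t => w t / 2)); apply: lbmM => //; exact: lbm_cst.
pose S t x := w t * (weight x * (D t x * (D2 t x + G t x))).
have lS : lbm2 S.
  apply: lbm2M; first exact: lbm2_fst.
  by apply: lbm2M; [exact: lbm2_snd|apply: lbm2M => //; exact: lbm2D].
have l1 t := lbm2_sectl t lqD2.
have point x : weight x * D s x ^+ 2 = weight x * D 1 x ^+ 2 + RI s 1 (S ^~ x).
  have lDx := lbm2_sectr x lD; have lRx := lbmN (lbm2_sectr x lR).
  have p2 := primM lRx lRx lDx lDx (primD x) (primD x).
  have := p2 s 1 s0 s1 (lexx 1).
  rewrite -!expr2 => e.
  have -> : D s x ^+ 2 = D 1 x ^+ 2 - (D 1 x ^+ 2 - D s x ^+ 2) by ring.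
  rewrite e mulrBr -mulrN; congr (_ + _).
  rewrite -RI_N; last by apply: lbmD; apply: lbmM.
  rewrite -RI_Z; last by apply: lbmN; apply: lbmD; apply: lbmM.
  by apply: eq_RI => t _; rewrite /S /G; field.
have -> : energy s = RI (- N) N (fun x => weight x * D 1 x ^+ 2 + RI s 1 (S ^~ x)).
  by apply: eq_RI => x _.
have lRS : lbm (fun x => RI s 1 (S ^~ x)) by exact: (@lbm_RI _ s 1 (fun x t => S t x) s1 (lbm2_swap lS)).
rewrite RI_D//; congr (_ + _).
rewrite -(RI_Fubini s 1 (- N) N lS); apply: eq_RI => t _; rewrite /S RI_Z//.
apply: lbmM => //; apply: lbmM; first exact: lbm2_sectl lD.
by apply: lbmD; [exact: lbm2_sectl lD2|exact: lbm2_sectl lG].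
Qed.

Lemma energy_bound s : 0 <= s <= 1 ->
  energy s <= 2 * (energy 1 + W * (2 * weight N * K * A + K * RI 0 1 (fun t => RI (- N) N (fun x => `|r t x|))))
    * expR (2 * (W * ((A + 1) ^+ 2 / 4)) + 1).
Proof.
have en0 t : 0 <= energy t.
  by apply: RI_ge0 => x _; rewrite mulr_ge0 ?sqr_ge0//; exact/ltW/weight_gt0.
have lrr : lbm (fun t => RI (- N) N (fun x => `|r t x|)) by exact: lbm_RI (lbm2_norm lr).
have r0 t : 0 <= RI (- N) N (fun x => `|r t x|) by exact: RI_ge0.
have lE := lbm_energy.
have c0 : 0 <= 2 * weight N * K * A by rewrite !mulr_ge0//; exact/ltW/weight_gt0.
apply: gronwall => //.
- by rewrite mulr_ge0// divr_ge0// sqr_ge0.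
- rewrite addr_ge0// mulr_ge0// addr_ge0// mulr_ge0//.
  by apply: RI_ge0.
move=> t tI; have /andP[t0 t1] := tI; rewrite (energy_identity tI) -addrA lerD2l.
pose rhs u := W * (2 * weight N * K * A) + W * K * RI (- N) N (fun x => `|r u x|) + W * ((A + 1) ^+ 2 / 4) * energy u.
have lc : lbm (fun _ : R => W * (2 * weight N * K * A)) by exact: lbm_cst.
have l1 : lbm (fun u => W * K * RI (- N) N (fun x => `|r u x|)) by exact: lbmZ.
have l2 : lbm (fun u => W * ((A + 1) ^+ 2 / 4) * energy u) by exact: lbmZ.
have lrhs : lbm rhs by apply: lbmD => //; exact: lbmD.
apply: le_trans (_ : _ <= RI t 1 rhs) _.
  apply: RI_le => //.
    apply: lbmM => //; apply: (@lbm_RI _ (- N) N (fun t x => weight x * (D t x * (D2 t x + G t x)))) => //.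
    by apply: lbm2M; [exact: lbm2_snd|apply: lbm2M => //; exact: lbm2D].
  move=> u /andP[u0 u1]; have uI : 0 <= u <= 1 by rewrite u1 (le_trans t0 u0).
  have := energy_rate uI.
  set Z := RI _ _ _; set B := 2 * weight N * K * A; set Q := RI _ _ _ => H.
  have B0 : 0 <= B + (A + 1) ^+ 2 / 4 * energy u + K * Q.
    apply: addr_ge0; last exact: (mulr_ge0 K0 (r0 u)).
    by apply: addr_ge0 => //; apply: mulr_ge0 => //; rewrite divr_ge0// sqr_ge0.
  have -> : rhs u = W * (B + (A + 1) ^+ 2 / 4 * energy u + K * Q) by rewrite /rhs -/B -/Q; ring.
  apply: le_trans (ler_wpM2l (w0 u) H) _.
  by apply: ler_wpM2r => //; exact: wW.
rewrite /rhs RI_D//; last exact: lbmD.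
rewrite RI_D// (RI_Z _ _ _ lrr) (RI_Z _ _ _ lE) RI_cst// lerD2r [leRHS]mulrDr.
have WB : 0 <= W * (2 * weight N * K * A) by exact: mulr_ge0.
apply: lerD.
  by rewrite -[leRHS]mulr1; apply: ler_wpM2l => //; lra.
rewrite mulrA; apply: ler_wpM2l; first exact: mulr_ge0.
by rewrite (RI_split lrr t0 t1) lerDr RI_ge0.
Qed.

End energy.

(** * Comparison of a mollified weak solution with [U] *)

Section uniqueness.
Context {R : realType}.
Notation mR := (measurableTypeR R).
Notation leb := (@lebesgue_measure R).
Implicit Types (A B : nat -> R -> R) (s t x z e : R).

Variables (alpha w : R -> R) (U : nat -> R -> R -> R) (Y V : R -> R -> R) (M : R).
Hypothesis alpha01 : forall t, 0 <= alpha t <= 1.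
Hypothesis la : lbm alpha.
Hypothesis cw : continuous w.
Hypothesis w0 : forall t, 0 <= w t.
Hypothesis cU : forall k, continuous (fun z : R * R => U k z.1 z.2).
Hypothesis jU : forall t, jet (fun k => U k t).
Hypothesis U1 : forall t x, `|U 1 t x| <= 1.
Hypothesis U2 : exists C2, forall t x, `|U 2 t x| <= C2.
Hypothesis pU : forall x, prim (fun t => - (w t / 2 * (U 2 t x + alpha t * U 1 t x ^+ 2))) (U 0 ^~ x).
Hypothesis cY : continuous (fun z : R * R => Y z.1 z.2).
Hypothesis lV : lbm2 V.
Hypothesis M0 : 0 <= M.
Hypothesis VM : forall t x, `|V t x| <= M.
Hypothesis weak_x : forall A B N a b, jet A -> jet B -> 0 < a -> b < 1 -> 0 <= N ->
  (forall t, A 0%N t != 0 -> a <= t <= b) ->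
  (forall k x, N < `|x| -> B k x = 0) ->
  RI 0 1 (fun t => A 0%N t * (RI (- N) N (fun z => Y t z * B 1%N z) + RI (- N) N (fun z => V t z * B 0%N z))) = 0.
Hypothesis weak_eq : forall A B N a, jet A -> jet B -> 0 < a -> 0 <= N ->
  (forall t, A 0%N t != 0 -> a <= t) ->
  (forall k x, N < `|x| -> B k x = 0) ->
  RI 0 1 (fun t => A 0%N t * (w t / 2 * (RI (- N) N (fun z => Y t z * B 2 z) +
           alpha t * RI (- N) N (fun z => V t z ^+ 2 * B 0%N z)))
         - A 1%N t * RI (- N) N (fun z => Y t z * B 0%N z))
  + A 0%N 1 * RI (- N) N (fun z => B 0%N z * U 0 1 z) = 0.

Let lY : lbm2 Y. Proof. exact: lbm2_continuous. Qed.
Let lV2 : lbm2 (fun t z => V t z ^+ 2). Proof. exact: lbm2M. Qed.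
Let lw : lbm w. Proof. exact: lbm_continuous. Qed.
Let lU k : lbm2 (U k). Proof. exact: lbm2_continuous. Qed.

Let N_ge0 e x : 0 < e -> 0 <= `|x| + e. Proof. by move=> e0; rewrite addr_ge0// ltW. Qed.

Lemma mollified_equation e x t : 0 < e -> 0 <= t <= 1 ->
  moll e (Y t) 0 x = moll e (U 0 1) 0 x +
    RI t 1 (fun r => w r / 2 * (moll e (Y r) 2 x + alpha r * moll e (fun z => V r z ^+ 2) 0 x)).
Proof.
move=> e0; have lm k := lbm2_sectr x (lbm2_moll k e0 lY).
apply: (integrate_tested_equation (Yf := fun t => moll e (Y t) 0 x)
  (Nf := fun r => w r / 2 * (moll e (Y r) 2 x + alpha r * moll e (fun z => V r z ^+ 2) 0 x))).
- exact: lm.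
- apply: lbmM; first by apply: lbmM => //; exact: lbm_cst.
  apply: lbmD; first exact: lm.
  by apply: lbmM => //; exact: (lbm2_sectr x (lbm2_moll 0 e0 lV2)).
- exact: moll_continuous.
move=> A a jA a0 HA.
have := weak_eq jA (jet_test_jet e x) a0 (N_ge0 x e0) HA (fun k z => @test_jet_supp R e x (`|x| + e) k z e0 (lexx _)).
have rU : RI (- (`|x| + e)) (`|x| + e) (fun z => test_jet e x 0 z * U 0 1 z) = moll e (U 0 1) 0 x.
  have := @RI_test_jet R e x (`|x| + e) 0 (U 0 1) (lbm2_sectl 1 (lU 0)) e0 (lexx _).
  rewrite expr0 mul1r => <-; apply: eq_RI => z _; exact: mulrC.
move=> H; apply: etrans H; apply: f_equal2; last by rewrite rU.
apply: eq_RI => r _.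
have rY k := @RI_test_jet R e x (`|x| + e) k (Y r) (lbm2_sectl r lY) e0 (lexx _).
have rV := @RI_test_jet R e x (`|x| + e) 0 _ (lbm2_sectl r lV2) e0 (lexx _).
by rewrite (rY 2) (rY 0) rV expr0 !mul1r sqrrN expr1n mul1r.
Qed.

Let lh e x : 0 < e -> lbm (fun t => moll e (V t) 0 x - moll e (Y t) 1 x).
Proof.
move=> e0; apply: lbmB; first exact: (lbm2_sectr x (lbm2_moll 0 e0 lV)).
exact: (lbm2_sectr x (lbm2_moll 1 e0 lY)).
Qed.

Lemma RI_mollified_derivative e x s t : 0 < e -> 0 <= s -> s <= t -> t <= 1 ->
  RI s t (fun r => moll e (V r) 0 x - moll e (Y r) 1 x) = 0.
Proof.
move=> e0; apply: integral_of_tested_zero; first exact: lh.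
move=> A a b jA a0 b1 HA.
have := weak_x jA (jet_test_jet e x) a0 b1 (N_ge0 x e0) HA (fun k z => @test_jet_supp R e x (`|x| + e) k z e0 (lexx _)).
move=> H; rewrite -[RHS]H; apply: eq_RI => r _.
have rY := @RI_test_jet R e x (`|x| + e) 1 (Y r) (lbm2_sectl r lY) e0 (lexx _).
have rV := @RI_test_jet R e x (`|x| + e) 0 (V r) (lbm2_sectl r lV) e0 (lexx _).
by rewrite rY rV expr0 mul1r expr1 mulN1r addrC.
Qed.

Lemma moll_V_le e x t : 0 < e -> `|moll e (V t) 0 x| <= M.
Proof.
move=> e0; rewrite -[moll _ _ _ _]subr0; apply: moll_le => //; first exact: lbm2_sectl lV.
by move=> z _; rewrite subr0.
Qed.

Lemma moll_V2_le e x t : 0 < e -> `|moll e (fun z => V t z ^+ 2) 0 x| <= M ^+ 2.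
Proof.
move=> e0; rewrite -[moll _ _ _ _]subr0; apply: moll_le => //; first exact: lbm2_sectl lV2.
by move=> z _; rewrite subr0 normrX lerXn2r// nnegrE.
Qed.

Lemma moll_Y1_le e x t : 0 < e -> 0 <= t <= 1 -> `|moll e (Y t) 1 x| <= M.
Proof.
move=> e0; apply: (@continuous_avg_le _ (fun t => moll e (Y t) 1 x) (fun t => moll e (V t) 0 x)).
- exact: moll_continuous.
- exact: (lbm2_sectr x (lbm2_moll 0 e0 lV)).
- by move=> r; exact: moll_V_le.
- by move=> a b a0 ab b1; exact: RI_mollified_derivative.
Qed.

(** The exceptional null set of times depends on [x], hence the use of Fubini's theorem in
    [residual_cvg0]. *)
Lemma ae_moll_Y1 e x : 0 < e ->
  {ae leb, forall t, 0 < t < 1 -> moll e (Y t) 1 x = moll e (V t) 0 x}.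
Proof.
move=> e0; have H := ae_zero_of_RI (lh x e0) (fun s t hs st ht => RI_mollified_derivative x e0 hs st ht).
by apply: ae_imp H _ => t H /H /eqP; rewrite subr_eq0 => /eqP.
Qed.

Lemma Y_lipschitz t x z : 0 <= t <= 1 -> `|Y t x - Y t z| <= M * `|x - z|.
Proof.
move=> tI; apply: moll_lipschitz; first exact: continuous_pairl.
by move=> e e0 _ y; exact: moll_Y1_le.
Qed.

Lemma moll_Y_le e x t : 0 < e -> 0 <= t <= 1 -> `|moll e (Y t) 0 x - Y t x| <= M * e.
Proof.
move=> e0 tI; apply: moll_le => //; first exact: lbm2_sectl lY.
move=> z zx; apply: le_trans (Y_lipschitz z x tI) _.
by apply: ler_wpM2l.
Qed.

Lemma U_terminal_lipschitz x z : `|U 0 1 x - U 0 1 z| <= 1 * `|x - z|.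
Proof. exact: (lipschitz_is_derive z x (jU 1 0%N) (U1 1)). Qed.

Lemma moll_terminal_le e x : 0 < e -> `|moll e (U 0 1) 0 x - U 0 1 x| <= e.
Proof.
move=> e0; apply: moll_le => //; first exact: lbm2_sectl (lU 0).
by move=> z zx; apply: le_trans (U_terminal_lipschitz z x) _; rewrite mul1r.
Qed.

Lemma RI_norm_ub01 (f : R -> R) C t : lbm f -> 0 <= C -> 0 <= t <= 1 ->
  (forall r, 0 <= r <= 1 -> `|f r| <= C) -> `|RI t 1 f| <= C.
Proof.
move=> lf C0 /andP[t0 t1] H; apply: le_trans (_ : _ <= C * (1 - t)) _.
  by apply: RI_norm_ub => // r /andP[tr r1]; apply: H; rewrite r1 (le_trans t0).
by rewrite -[leRHS]mulr1; apply: ler_wpM2l => //; rewrite gerBl.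
Qed.

(** Mollification at scale 1: [Y] is near its mollification by the Lipschitz bound, and the latter
    moves in time at a bounded rate, since its second derivative sees only the oscillation of [Y].
    So [Y], like [U 0], stays at bounded distance from the terminal datum. *)
Lemma bounded_difference : exists2 K, 0 <= K & forall t x, 0 <= t <= 1 -> `|Y t x - U 0 t x| <= K.
Proof.
have [W W0 HW] := lbm_bounded01 lw; have [C2 HC2] := U2.
have C20 : 0 <= C2 by exact: le_trans (HC2 0 0).
have [C C0 HC] := @moll_der_le R 1 1 ltr01 (lexx _).
pose K1 := W / 2 * (M * C + M ^+ 2); pose K2 := W / 2 * (C2 + 1).
have K10 : 0 <= K1 by rewrite mulr_ge0 ?divr_ge0// addr_ge0 ?sqr_ge0// mulr_ge0.
have K20 : 0 <= K2 by rewrite mulr_ge0 ?divr_ge0// addr_ge0.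
have a1 t : `|alpha t| <= 1 by have /andP[? ?] := alpha01 t; rewrite ger0_norm.
have w2 t : 0 <= t <= 1 -> `|w t / 2| <= W / 2.
  by move=> tI; rewrite normrM [`|2^-1|]ger0_norm// ler_wpM2r// HW.
exists (M * 1 + K1 + 1 + K2) => [|t x tI]; first by rewrite !addr_ge0// mulr_ge0.
have h1 := moll_Y_le x ltr01 tI; have h2 := moll_terminal_le x ltr01.
have h3 : `|moll 1 (Y t) 0 x - moll 1 (U 0 1) 0 x| <= K1.
  rewrite (mollified_equation x ltr01 tI) addrAC subrr add0r; apply: RI_norm_ub01 => //.
    apply: lbmM; first by apply: lbmM => //; exact: lbm_cst.
    apply: lbmD; first exact: (lbm2_sectr x (lbm2_moll 2 ltr01 lY)).
    by apply: lbmM => //; exact: (lbm2_sectr x (lbm2_moll 0 ltr01 lV2)).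
  move=> r rI; rewrite normrM; apply: ler_pM => //; first exact: w2.
  apply: le_trans (ler_normD _ _) _; apply: lerD.
    apply: (HC _ x (Y r x)); first exact: lbm2_sectl lY.
    by move=> z zx; apply: le_trans (Y_lipschitz z x rI) _; rewrite ler_piMr.
  by rewrite normrM -[M ^+ 2]mul1r; apply: ler_pM => //; exact: moll_V2_le.
have h4 : `|U 0 1 x - U 0 t x| <= K2.
  have /andP[t0 t1] := tI.
  have lr : lbm (fun t => - (w t / 2 * (U 2 t x + alpha t * U 1 t x ^+ 2))).
    apply: lbmN; apply: lbmM; first by apply: lbmM => //; exact: lbm_cst.
    apply: lbmD; first exact: lbm2_sectr (lU 2).
    by apply: lbmM => //; exact: lbm2_sectr (lbm2M (lU 1) (lU 1)).
  rewrite (pU x t0 t1 (lexx 1)); apply: RI_norm_ub01 => //.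
  move=> r rI; rewrite normrN normrM; apply: ler_pM => //; first exact: w2.
  apply: le_trans (ler_normD _ _) _; apply: lerD => //.
  by rewrite normrM normrX; apply: mulr_ile1 => //; exact: exprn_ile1.
move: (moll 1 (Y t) 0 x) (moll 1 (U 0 1) 0 x) h1 h2 h3 => a b h1 h2 h3.
have -> : Y t x - U 0 t x = - (a - Y t x) + (a - b) + (b - U 0 1 x) + (U 0 1 x - U 0 t x) by ring.
apply: le_trans (ler_normD _ _) _; apply: lerD => //.
apply: le_trans (ler_normD _ _) _; apply: lerD => //.
apply: le_trans (ler_normD _ _) _; apply: lerD => //.
by rewrite normrN.
Qed.

Let residual e t x := moll e (fun z => V t z ^+ 2) 0 x - moll e (Y t) 1 x ^+ 2.

Let lbm2_residual e : 0 < e -> lbm2 (residual e).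
Proof.
move=> e0; apply: lbm2B; first exact: (lbm2_moll 0 e0 lV2).
exact: (lbm2M (lbm2_moll 1 e0 lY) (lbm2_moll 1 e0 lY)).
Qed.

Let harm n : (0 : R) < n.+1%:R^-1. Proof. by rewrite invr_gt0. Qed.

Lemma residual_cvg0 N : 0 <= N ->
  RI 0 1 (fun t => RI (- N) N (fun x => `|residual n.+1%:R^-1 t x|)) @[n --> \oo] --> (0 : R).
Proof.
move=> N0.
have NN : - N <= N by rewrite -subr_ge0 opprK addr_ge0.
(* For each [x] this agrees with the residual at almost every [t], and for each [t] it tends to 0 at
   almost every [x], where both [V] and its square are recovered from their mollifications. *)
pose G n t x := `|moll n.+1%:R^-1 (fun z => V t z ^+ 2) 0 x - moll n.+1%:R^-1 (V t) 0 x ^+ 2|.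
have lG n : lbm2 (G n).
  apply: lbm2_norm; apply: lbm2B; first exact: (lbm2_moll 0 (harm n) lV2).
  exact: (lbm2M (lbm2_moll 0 (harm n) lV) (lbm2_moll 0 (harm n) lV)).
have GM n t x : `|G n t x| <= M ^+ 2 + M ^+ 2.
  rewrite normr_id; apply: le_trans (ler_normB _ _) _; apply: lerD; first exact: moll_V2_le.
  by rewrite normrX lerXn2r ?nnegrE// moll_V_le.
have E n : RI 0 1 (fun t => RI (- N) N (fun x => `|residual n.+1%:R^-1 t x|)) =
    RI 0 1 (fun t => RI (- N) N (G n t)).
  have lr := lbm2_norm (lbm2_residual (harm n)).
  rewrite (RI_Fubini 0 1 (- N) N lr) (RI_Fubini 0 1 (- N) N (lG n)).
  apply: eq_RI => x _; apply: eq_RI_ae; [exact: lbm2_sectr lr|exact: lbm2_sectr (lG n)|].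
  by apply: ae_imp (ae_moll_Y1 x (harm n)) _ => t H /H; rewrite /G /residual => ->.
rewrite (_ : (fun n => _) = fun n => RI 0 1 (fun t => RI (- N) N (G n t))); last by apply/funext.
apply: (@RI_cvg0 _ _ _ _ ((M ^+ 2 + M ^+ 2) * (N - - N))).
- by move=> n; exact: lbm_RI.
- by move=> n t _; apply: RI_norm_ub => //; exact: lbm2_sectl.
apply: aeW => t _; apply: (@RI_cvg0 _ _ _ _ (M ^+ 2 + M ^+ 2)).
- by move=> n; exact: lbm2_sectl.
- by move=> n x _; exact: GM.
have h1 := ae_moll_cvg (lbm2_sectl t lV2); have h2 := ae_moll_cvg (lbm2_sectl t lV).
apply: (@filterS2 _ _ (ae_filter_ringOfSetsType leb) _ _ _ _ h1 h2) => x c2 c1 _; rewrite /G -[X in _ --> X](@normr0 R R); apply: cvg_norm.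
rewrite -[X in _ --> X](subrr (V t x ^+ 2)); apply: cvgB; first exact: c2.
by rewrite expr2; exact: (cvgM c1 c1).
Qed.

(** With [N] fixed, the scale tends to 0: the terminal error, the residual and the distance from [Y]
    to its mollification disappear, although their bounds depend on [N]. Only the boundary term
    remains, with a constant free of [N]. *)
Lemma weighted_difference_le : exists2 C, 0 <= C & forall N s, 0 <= N -> 0 <= s <= 1 ->
  RI (- N) N (fun x => weight x * (Y s x - U 0 s x) ^+ 2) <= C * weight N.
Proof.
have [W W0 HW] := lbm_bounded01 lw; have [K0 K00 HK] := bounded_difference.
pose A := M + 1; pose K := M + K0.
pose X := expR (2 * (W * ((A + 1) ^+ 2 / 4)) + 1).
have A0 : 0 <= A by rewrite addr_ge0.
have K0' : 0 <= K by rewrite addr_ge0.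
exists (4 * (W * (2 * K * A)) * X) => [|N s N0 sI].
  by rewrite !mulr_ge0 ?expR_ge0.
have NN : - N <= N by rewrite -subr_ge0 opprK addr_ge0.
set Q := RI _ _ _.
pose Res e := RI 0 1 (fun t => RI (- N) N (fun x => `|residual e t x|)).
have key e : 0 < e -> e <= 1 -> Q <= 4 * (e ^+ 2 * (N - - N) + W * (2 * weight N * K * A + K * Res e)) * X
   + 2 * M ^+ 2 * e ^+ 2 * (N - - N).
  move=> e0 e1.
  pose D k t x := moll e (Y t) k x - U k t x.
  pose p t x := moll e (Y t) 1 x + U 1 t x.
  have lm k : lbm2 (fun t x => moll e (Y t) k x) by exact: lbm2_moll.
  have lD k : lbm2 (D k) by apply: lbm2B.
  have lp : lbm2 p by apply: lbm2D.
  have dD k t x : is_derive x 1 (D k t) (D k.+1 t x).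
    by apply: derB; [exact: (jet_moll e0 e1 (lbm2_sectl t lY) k x)|exact: (jU t k x)].
  have cD2 t : continuous (D 2 t) by exact: der_continuous (dD 2%N t).
  have pA t x : 0 <= t <= 1 -> `|p t x| <= A.
    by move=> tI; apply: le_trans (ler_normD _ _) _; apply: lerD => //; exact: moll_Y1_le.
  have D1A t x : 0 <= t <= 1 -> `|D 1%N t x| <= A.
    by move=> tI; apply: le_trans (ler_normB _ _) _; apply: lerD => //; exact: moll_Y1_le.
  have close t x : 0 <= t <= 1 -> `|D 0%N t x - (Y t x - U 0 t x)| <= M * e.
    move=> tI; have := moll_Y_le x e0 tI.
    by rewrite /D; congr (`|_| <= _); move: (moll _ _ _ _) => a; ring.
  have DK t x : 0 <= t <= 1 -> `|D 0%N t x| <= K.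
    move=> tI; rewrite -[D _ _ _](subrK (Y t x - U 0 t x)).
    apply: le_trans (ler_normD _ _) _; apply: lerD; last exact: HK.
    by apply: le_trans (close t x tI) _; exact: ler_piMr.
  (* The difference of the two integrated equations, with the squares of the first derivatives
     factored. *)
  have primD x : prim (fun t => - (w t / 2 * (D 2 t x + alpha t * (D 1%N t x * p t x + residual e t x)))) (D 0%N ^~ x).
    pose N1 t := w t / 2 * (moll e (Y t) 2 x + alpha t * moll e (fun z => V t z ^+ 2) 0 x).
    have lN1 : lbm N1.
      apply: lbmM; first by apply: lbmM => //; exact: lbm_cst.
      apply: lbmD; first exact: (lbm2_sectr x (lm 2)).
      by apply: lbmM => //; exact: (lbm2_sectr x (lbm2_moll 0 e0 lV2)).
    have pm : prim (fun t => - N1 t) (fun t => moll e (Y t) 0 x).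
      move=> a b a0 ab b1.
      have aI : 0 <= a <= 1 by rewrite a0 (le_trans ab).
      have bI : 0 <= b <= 1 by rewrite b1 (le_trans a0).
      rewrite (mollified_equation x e0 aI) (mollified_equation x e0 bI) -/N1.
      by rewrite (RI_split lN1 ab b1) RI_N//; move: (moll _ _ _ _) (RI _ _ _) (RI _ _ _) => c d f; ring.
    have lr : lbm (fun t => - (w t / 2 * (U 2 t x + alpha t * U 1 t x ^+ 2))).
      apply: lbmN; apply: lbmM; first by apply: lbmM => //; exact: lbm_cst.
      apply: lbmD; first exact: lbm2_sectr (lU 2).
      by apply: lbmM => //; exact: lbm2_sectr (lbm2M (lU 1) (lU 1)).
    apply: prim_ext (primB (lbmN lN1) lr pm (pU x)) _ _ => t _ //.
    rewrite /N1 /D /p /residual; move: (moll _ _ _ _) (moll _ _ _ _) (moll _ _ _ _) => a b c; ring.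
  have := @energy_bound R alpha w (D 0%N) (D 1%N) (D 2) p (residual e) A K W N alpha01 la lw w0.
  move=> /(_ _ (lD 0%N) (lD 1%N) (lD 2) lp (lbm2_residual e0) (dD 0%N) (dD 1%N) cD2 pA D1A DK N0 primD s sI).
  rewrite -/(Res e) -/X => H.
  have {}H := H (fun t tI => le_trans (ler_norm _) (HW t tI)).
  have lq : lbm (@weight R) by exact: lbm_continuous (@weight_continuous R).
  have lY' := lbm2_sectl s (lbm2B lY (lU 0)).
  have en1 : energy (D 0%N) N 1 <= e ^+ 2 * (N - - N).
    apply: RI_ub => //.
      apply: lbmM => //; exact: lbm2_sectl (lbm2M (lD 0%N) (lD 0%N)).
    move=> x _; rewrite -[e ^+ 2]mul1r; apply: ler_pM => //; [exact/ltW/weight_gt0|exact: sqr_ge0|exact: weight_le1|].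
    rewrite -real_normK ?num_real//; apply: lerXn2r; rewrite ?nnegrE//; first exact: ltW.
    rewrite /D.
    have I1 : 0 <= (1 : R) <= 1 by rewrite ler01 lexx.
    (* At time 1 the integral in [mollified_equation] is over a point, so [D 0] is the mollification
       error of the terminal datum. *)
    rewrite (mollified_equation x e0 I1) RI_same addr0; exact: moll_terminal_le.
  have q1 : Q <= 2 * energy (D 0%N) N s + 2 * M ^+ 2 * e ^+ 2 * (N - - N).
    have lE : lbm (fun x => weight x * D 0%N s x ^+ 2).
      by apply: lbmM => //; exact: lbm2_sectl (lbm2M (lD 0%N) (lD 0%N)).
    rewrite -(RI_cst _ NN) /energy -RI_Z// -RI_D; [|exact: lbmZ|exact: lbm_cst].
    apply: RI_le.
    - by apply: lbmM => //; exact: lbmM.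
    - by apply: lbmD; [exact: lbmZ|exact: lbm_cst].
    move=> x _; have := close s x sI.
    move: (D 0%N s x) (Y s x - U 0 s x) => a b ab.
    have ab2 : (a - b) ^+ 2 <= M ^+ 2 * e ^+ 2.
      by rewrite -exprMn -real_normK ?num_real// lerXn2r ?nnegrE// mulr_ge0// ltW.
    have q0 := ltW (weight_gt0 x); have q1 := weight_le1 x.
    have b2 : b ^+ 2 <= 2 * a ^+ 2 + 2 * (a - b) ^+ 2.
      rewrite -subr_ge0; have -> : 2 * a ^+ 2 + 2 * (a - b) ^+ 2 - b ^+ 2 = (2 * a - b) ^+ 2 by ring.
      exact: sqr_ge0.
    apply: le_trans (ler_wpM2l q0 b2) _; rewrite mulrDr; apply: lerD.
      by rewrite mulrCA.
    rewrite -mulrA; apply: le_trans (_ : _ <= 1 * (2 * (a - b) ^+ 2)) _.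
      by apply: ler_wpM2r => //; rewrite mulr_ge0// sqr_ge0.
    by rewrite mul1r ler_wpM2l.
  apply: le_trans q1 _; rewrite lerD2r.
  apply: le_trans (ler_wpM2l _ H) _ => //.
  have X0 : 0 <= X by exact: expR_ge0.
  move: en1 X0 {H}; move: (energy _ _ 1) (W * _) (X) => E T Z ET Z0.
  have -> : 2 * (2 * (E + T) * Z) = 4 * (E + T) * Z by ring.
  by apply: ler_wpM2r => //; apply: ler_wpM2l => //; rewrite lerD2r.
have h0 : (n.+1%:R^-1 : R) @[n --> \oo] --> (0 : R) by exact: cvg_harmonic.
have h2 : (n.+1%:R^-1 ^+ 2 : R) @[n --> \oo] --> (0 : R).
  by rewrite -[X in _ --> X](mul0r 0); exact: (cvgM h0 h0).
have hR := residual_cvg0 N0.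
have lim : 4 * (n.+1%:R^-1 ^+ 2 * (N - - N) + W * (2 * weight N * K * A + K * Res n.+1%:R^-1)) * X
   + 2 * M ^+ 2 * n.+1%:R^-1 ^+ 2 * (N - - N) @[n --> \oo] -->
   4 * (0 * (N - - N) + W * (2 * weight N * K * A + K * 0)) * X + 2 * M ^+ 2 * 0 * (N - - N).
  have cc (c : R) : (fun _ : nat => c) @ \oo --> c by exact: cvg_cst.
  apply: cvgD; last by apply: (cvgM _ (cc _)); exact: (cvgM (cc _) h2).
  apply: (cvgM _ (cc _)); apply: (cvgM (cc _)); apply: cvgD; first exact: (cvgM h2 (cc _)).
  by apply: (cvgM (cc _)); apply: cvgD; [exact: cc|exact: (cvgM (cc _) hR)].
have -> : 4 * (W * (2 * K * A)) * X * weight N =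
   4 * (0 * (N - - N) + W * (2 * weight N * K * A + K * 0)) * X + 2 * M ^+ 2 * 0 * (N - - N) by ring.
apply: (ler_cvg_to (cvg_cst Q) lim); apply: nearW => n; apply: key; first exact: harm.
by rewrite invf_le1// ler1n.
Qed.

(** A gap [d] at one point persists as [d/2] on a neighbourhood, by the Lipschitz constants [M] and
    1 of the two functions. This bounds the weighted integral below by a fixed [c > 0], against the
    upper bound [C * weight N]. *)
Lemma weak_solution_unique t x : 0 <= t <= 1 -> Y t x = U 0 t x.
Proof.
move=> tI; apply/eqP; rewrite -subr_eq0; apply/negPn/negP => d0.
have [C C0 HC] := weighted_difference_le.
pose d := `|Y t x - U 0 t x|; have dp : 0 < d by rewrite normr_gt0.
have M1 : 0 < M + 1 by rewrite ltr_wpDl.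
pose h := d / 2 / (M + 1); have h0 : 0 < h by rewrite !divr_gt0.
have dist z : x - h <= z <= x + h -> d / 2 <= `|Y t z - U 0 t z|.
  move=> /andP[z1 z2]; have zx : `|x - z| <= h by rewrite ler_norml; apply/andP; split; lra.
  have k1 := Y_lipschitz x z tI.
  have k2 : `|U 0 t x - U 0 t z| <= 1 * `|x - z| by exact: (lipschitz_is_derive z x (jU t 0%N) (U1 t)).
  have k3 : d <= `|Y t z - U 0 t z| + (`|Y t x - Y t z| + `|U 0 t x - U 0 t z|).
    rewrite /d (_ : Y t x - U 0 t x = (Y t z - U 0 t z) + ((Y t x - Y t z) - (U 0 t x - U 0 t z))); last by ring.
    by apply: le_trans (ler_normD _ _) _; rewrite lerD2l ler_normB.
  have k4 : (M + 1) * `|x - z| <= d / 2 by rewrite mulrC -ler_pdivlMr.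
  lra.
pose q := weight (`|x| + h); have q0 : 0 < q by exact: weight_gt0.
pose c := q * (d / 2) ^+ 2 * (x + h - (x - h)).
have c0 : 0 < c by rewrite !mulr_gt0 ?exprn_gt0 ?divr_gt0//; lra.
have low N : `|x| + h <= N -> c <= C * weight N.
  move=> N1; have N0 : 0 <= N by apply: le_trans N1; rewrite addr_ge0// ltW.
  apply: le_trans (HC N t N0 tI).
  have := ler_norm x; have := ler_norm (- x); rewrite normrN => x1 x2.
  have lf : lbm (fun z => weight z * (Y t z - U 0 t z) ^+ 2).
    apply: lbmM; first exact: lbm_continuous (@weight_continuous R).
    by apply: lbmM; exact: lbm2_sectl (lbm2B lY (lU 0)).
  have f0 z : 0 <= weight z * (Y t z - U 0 t z) ^+ 2.
    by rewrite mulr_ge0 ?sqr_ge0//; exact/ltW/weight_gt0.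
  have s1 : - N <= x - h by lra.
  have s2 : x - h <= x + h by lra.
  have s3 : x + h <= N by lra.
  rewrite (RI_split lf s1 (le_trans s2 s3)) (RI_split lf s2 s3).
  apply: le_trans (_ : _ <= RI (x - h) (x + h) (fun z => weight z * (Y t z - U 0 t z) ^+ 2)) _.
    rewrite /c -RI_cst//; apply: RI_le => //; first exact: lbm_cst.
    move=> z zI; apply: ler_pM; [exact: ltW|exact: sqr_ge0| |].
      have /andP[z1 z2] := zI; apply: weight_decreasing.
      rewrite [leRHS]ger0_norm; last by rewrite addr_ge0// ltW.
      by rewrite ler_norml; apply/andP; split; lra.
    rewrite -[leRHS]real_normK ?num_real//; apply: lerXn2r; rewrite ?nnegrE//; last exact: dist.
    by rewrite divr_ge0// ltW.
  by rewrite addrCA lerDl addr_ge0// RI_ge0.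
(* Then [c (1 + N^2) <= C <= N c], which contradicts [N < 1 + N^2]. *)
pose N := Num.max (`|x| + h) (C / c).
have N1 : `|x| + h <= N by rewrite le_max lexx.
have N2 : C / c <= N by rewrite le_max lexx orbT.
have := low N N1; rewrite /weight ler_pdivlMr ?weight_den_gt0//.
rewrite ler_pdivrMr// in N2.
have Nc : N * c < c * (1 + N ^+ 2).
  rewrite mulrC ltr_pM2l//; have := sqr_ge0 (N - 1); have := sqr_ge0 N; rewrite !expr2; lra.
by move=> H; have := le_trans H N2; rewrite leNgt Nc.
Qed.

End uniqueness.

Unset Implicit Arguments.

Theorem theorem1 (R : realType) (beta : nat -> R)
    (xi_fin : exists2 eps : R, 0 < eps &
      (\sum_(1 <= p <oo) (beta p ^+ 2 * (1 + eps) ^+ p)%:E < +oo)%E)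
    (mu : probability (measurableTypeR R) R)
    (mu01 : mu `[0, 1]%classic = 1%E) :
  exists u : R -> R -> R,
    [/\ parisi_weak_solution beta mu u,
        forall w : R -> R -> R, parisi_weak_solution beta mu w ->
          forall t x, t \in `[0, 1] -> w t x = u t x,
        {within @strip R, continuous (fun z : R * R => u z.1 z.2)},
        forall t, t \in `]0, 1[ -> {for t, continuous (cdf01 mu)} ->
          forall x, derivable (u^~ x) t 1 &
        forall t, t \in `[0, 1] -> smooth1 (u t)].
Proof.
have [g [w [L L0 [w_eq w_cont w_ge0 g_nd [g_lip g_bd RI_w der_g]]]]] := xi_facts xi_fin.
have a_nd := @cdf01_nd R mu; have a01 := @cdf01_bound R mu; have a_rc := @cdf01_rc R mu.
have if0 := @inv_log_cosh R; have bf0 := @log_cosh_jet_bounded R.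
pose u := U (cdf01 mu) g (@log_cosh_jet R).
have cu k : continuous (fun z : R * R => u k z.1 z.2).
  exact: (U_continuous a_nd a01 L0 g_nd g_lip g_bd if0 bf0).
have la : lbm (cdf01 mu) by exact: (lbm_alpha a_nd a01).
exists (u 0%N); split.
- split; first exact: continuous_subspaceT.
  exists (u 1%N); split.
  + exact: (U_weak_partial_x a_nd a01 L0 g_nd g_lip g_bd).
  + exact: (U1_ess_bounded a_nd a01 L0 g_nd g_lip g_bd).
  move=> phi tphi.
  rewrite [LHS](U_weak_equation a_nd a01 a_rc L0 g_nd g_lip g_bd w_cont RI_w tphi).
  congr (_ + _); apply: eq_Rintegral => t /set_mem; rewrite [X in X -> _]/= in_itv => tI.
  by apply: eq_Rintegral => x _; rewrite w_eq.
- move=> y [cy [v [wv ev eqv]]] t x; rewrite in_itv/= => tI.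
  have [V [M [lV M0 VM vV]]] := truncated_representative ev.
  have [mv _] := ev.
  (* The given solution is constrained only on the strip; its clamped version is continuous on the
     whole plane and agrees with it there. *)
  rewrite -[LHS](_ : clamped y t x = _); last by rewrite /clamped clamp01_id.
  apply: (@weak_solution_unique R (cdf01 mu) w u (clamped y) V M) => //.
  + by move=> r; exact: (jet_U a_nd a01 L0 g_nd g_lip g_bd if0 bf0).
  + by move=> r z; exact: (U1_le a_nd a01 L0 g_nd g_lip g_bd if0 bf0).
  + exact: (U_bounded a_nd a01 L0 g_nd g_lip g_bd if0 bf0 1%N).
  + by move=> z; exact: (prim_U a_nd a01 a_rc L0 g_nd g_lip g_bd w_cont RI_w if0 bf0 z).
  + exact: clamped_continuous.
  + move=> A B N a b; exact: (weak_partial_x_tested cy wv mv lV vV).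
  + move=> A B N a jA jB a0 N0 HA HB.
    have := weak_equation_tested la w_cont w_eq cy mv lV vV eqv jA jB a0 N0 HA HB.
    have E : u 0%N 1 = log_cosh by apply/funext => z; rewrite /u U_at1.
    by rewrite E.
- exact: continuous_subspaceT.
- move=> t; rewrite in_itv/= => tI ca x.
  exact: (derivable_U a_nd a01 a_rc L0 g_nd g_lip g_bd der_g if0 bf0 tI ca).
- move=> t _; exact: (smooth_U a_nd a01 L0 g_nd g_lip g_bd if0 bf0).
Qed.
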